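(* Let $\alpha\ge1/2$, $\lambda>0$, and let $X$ be an almost surely positive random variable with $\mathbb{E}[X^{\alpha+4}]<\infty$ and $\mathbb{E}[X]=\alpha/\lambda$. Then $$D(X\|\gamma_{\alpha,\lambda})=\int_0^1\frac{1}{\lambda\tau}J_{st,\gamma}(X_\tau)\,d\tau .$$
   Context: Fix $\alpha>0,\lambda>0$. Let $\gamma_{\alpha,\lambda}(u)=\frac{\lambda^\alpha}{\Gamma(\alpha)}u^{\alpha-1}e^{-\lambda u}$, $u>0$, and let $\gamma(\alpha,\lambda)$ denote a random variable with this density. For a random variable $X$ with values in $(0,\infty)$ a.s. and $\tau\in(0,1)$, the gamma smart path $X_\tau$ is defined as follows: conditionally on $X=x$, let $K$ be Poisson with mean $\lambda\tau x/(1-\tau)$; conditionally on $X=x,K=k$, let $Y=0$ if $k=0$ and let $Y$ be gamma distributed with shape $k$ and rate $\lambda\tau/(1-\tau)$ if $k\ge1$; let $\gamma(\alpha,\lambda)$ be independent of $(X,K,Y)$; set $X_\tau=(1-\tau)\gamma(\alpha,\lambda)+\tau Y$ ($X_\tau$ always has a Lebesgue density). For a positive random variable $W$ with density $f$, $D(W\|\gamma_{\alpha,\lambda})=\int_0^\infty f\log(f/\gamma_{\alpha,\lambda})$, and $D(W\|\gamma_{\alpha,\lambda})=+\infty$ if $W$ has no density. For $W$ with differentiable positive density $f_W$, $\rho_W=(\log f_W)'$ and $J_{st,\gamma}(W)=\mathbb{E}\big[W\big(\rho_W(W)-\frac{\alpha-1}{W}+\lambda\big)^2\big]$. *)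

(* Defs.v *)
From HB Require Import structures.
From mathcomp Require Import all_boot all_order all_algebra.
From mathcomp Require Import all_classical all_reals all_analysis.
Set Implicit Arguments. Unset Strict Implicit. Unset Printing Implicit Defensive.
Import Order.TTheory GRing.Theory Num.Theory.
Import numFieldNormedType.Exports.
Local Open Scope classical_set_scope.
Local Open Scope ring_scope.

Section Defs.
Variable R : realType.
Local Notation leb := (@lebesgue_measure R).

Definition Rpos : set R := `]0, +oo[%classic.

Definition GammaR (a : R) : R :=
  fine (\int[leb]_(u in Rpos) ((u `^ (a - 1)) * expR (- u))%:E)%E.

Definition gamma_pdf (a l : R) (u : R) : R :=
  if 0 < u then l `^ a / GammaR a * u `^ (a - 1) * expR (- (l * u)) else 0.

Definition pois (m : R) (k : nat) : R := expR (- m) * m ^+ k / k`!%:R.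

(* Law of (1 - tau) gamma(alpha,lambda) + tau Y, where Y = 0 if k = 0 and
   Y ~ Gamma(k, lambda tau/(1-tau)) if k >= 1, gamma(alpha,lambda) independent of Y:
   P(... in A) *)
Definition cond_law (alpha lambda tau : R) (k : nat) (A : set R) : \bar R :=
  let c := lambda * tau / (1 - tau) in
  if k is 0%N then
    (\int[leb]_(g in Rpos)
        ((\1_A ((1 - tau) * g) : R) * gamma_pdf alpha lambda g)%:E)%E
  else
    (\int[leb]_(g in Rpos) \int[leb]_(y in Rpos)
        ((\1_A ((1 - tau) * g + tau * y) : R) * gamma_pdf alpha lambda g
           * gamma_pdf k%:R c y)%:E)%E.

(* Law of the gamma smart path X_tau, where X has law mu:
   conditionally on X = x, K ~ Poisson(lambda tau x / (1 - tau)) *)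
Definition smart_path_law (mu : probability R R) (alpha lambda tau : R)
    (A : set R) : \bar R :=
  (\int[mu]_(x in Rpos)
     \sum_(0 <= k <oo) ((pois (lambda * tau * x / (1 - tau)) k)%:E
                          * cond_law alpha lambda tau k A))%E.

Definition is_density (P : set R -> \bar R) (f : R -> R) : Prop :=
  measurable_fun setT f /\ (forall u, 0 <= f u) /\
  forall A : set R, measurable A ->
    P A = (\int[leb]_(u in A `&` Rpos) (f u)%:E)%E.

Definition rel_entropy_gamma (alpha lambda : R) (P : set R -> \bar R) : \bar R :=
  match pselect (exists f, is_density P f) with
  | left H => let f := projT1 (cid H) in
      (\int[leb]_(u in Rpos)
          (f u * ln (f u / gamma_pdf alpha lambda u))%:E)%E
  | right _ => +oo%E
  end.

(* Stein-type Fisher information J_{st,gamma}(W) for W with (positive,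
   differentiable) density f : E[ W (rho_W(W) - (alpha-1)/W + lambda)^2 ] *)
Definition J_st_gamma (alpha lambda : R) (f : R -> R) : \bar R :=
  (\int[leb]_(u in Rpos)
     (f u * (u * (derive1 f u / f u - (alpha - 1) / u + lambda) ^+ 2))%:E)%E.

End Defs.
Arguments Rpos {R}.

(* Main.v *)
(* Write h_t for the density of X_t relative to the gamma law. Given X = x, the
   Poisson mixture of gamma laws sums to a symmetric kernel in x and u built on
   0F1(; alpha; .), so h_t is smooth and solves the Laguerre heat equation
     - lambda t d_t h = u h'' + (alpha - lambda u) h'.
   For alpha >= 1/2, 0F1(; alpha; z) <= exp(2 sqrt z), which bounds h_t and its
   derivatives locally uniformly. With phi(y) = y ln y - y + 1 and
   Dent t = int phi(h_t) dgamma, two integrations by parts against a logarithmic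
   cutoff give de Bruijn's identity
     Dent t2 = Dent t1 + int_[t1, t2] J(X_t) / (lambda t) dt,
   and an explicit bound that uses only E[X] shows Dent t -> 0 as t -> 0.

   At the other end, Dent t <= D(X || gamma) by Jensen's inequality and the symmetry
   of the kernel. Conversely, if Dent t <= S for all t, then Young's inequality, weak
   convergence of X_t to X on open sets and outer regularity give the variational
   bound int g dmu + 1 <= N + S + e^(-N) int e^g dgamma for all bounded measurable
   g >= 0. Applied to multiples of indicators of null sets it shows that X has a
   density h relative to gamma, and applied to truncations of ln h it gives
   D(X || gamma) <= S. Hence D(X || gamma) = sup_t Dent t. *)
Require Import Defs.
From HB Require Import structures.
From mathcomp Require Import all_boot all_order all_algebra.
From mathcomp Require Import all_classical all_reals all_analysis.
From mathcomp Require Import measurable_realfun ring lra.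
Import Order.TTheory GRing.Theory Num.Theory.
Import numFieldNormedType.Exports.
Set Implicit Arguments.
Unset Strict Implicit.
Unset Printing Implicit Defensive.
Local Open Scope classical_set_scope.
Local Open Scope ring_scope.

(** * Calculus and integration *)

(** X need not have a density and its entropy may be infinite, so integrals can in general be
    neither assumed finite nor subtracted. Entropy is therefore measured with [phi]: it differs from
    y ln y by terms that cancel between two laws of mass one, and it is nonnegative, so that
    exchanges of integrals and limits rest mostly on Tonelli, monotone convergence and Fatou in the
    extended reals. The Poisson mean and the rates are matched so that, given K, both summands of
    X_t have rate l / (1 - t); their sum is then again gamma. Since the kernel is symmetric, its
    mass 1 in u is also its mass in x, which says that the gamma law is invariant. The threshold 1/2
    comes from (2k)! <= 4^k k! (alpha)_k, an equality at alpha = 1/2, where 0F1 is cosh(2 sqrt z).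
    When X has no density the theorem asserts that the time integral diverges. The lower bound must
    therefore start from the law of X alone: entropy enters through its dual, exponential form,
    which only involves integrals of bounded functions against that law. *)

Section Calculus.
Variable R : realType.
Local Notation leb := (@lebesgue_measure R).
Implicit Types (F f g : R -> R) (a b : R).

Lemma FTC_is_derive F f a b : a < b ->
  (forall x, a <= x <= b -> is_derive x 1 F (f x)) ->
  (forall x, a <= x <= b -> {for x, continuous f}) ->
  (\int[leb]_(x in `[a, b]) (f x)%:E = (F b - F a)%:E)%E.
Proof.
move=> ab dF cf.
have dFc x : a <= x <= b -> {for x, continuous F}.
  by move=> xab; apply/differentiable_continuous/derivable1_diffP; have [] := dF _ xab.
rewrite (@continuous_FTC2 _ f F)//.
- apply: continuous_in_subspaceT => x; rewrite inE/= in_itv/= => xab.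
  exact: cf.
- split.
  + move=> x; rewrite in_itv/= => /andP[ax xb].
    by have [] : is_derive x 1 F (f x) by apply: dF; rewrite !ltW.
  + by apply/cvg_at_right_filter/dFc; rewrite lexx ltW.
  + by apply/cvg_at_left_filter/dFc; rewrite lexx ltW.
- move=> x; rewrite in_itv/= => /andP[ax xb].
  have dx : is_derive x 1 F (f x) by apply: dF; rewrite !ltW.
  by rewrite derive1E derive_val.
Qed.

Lemma measurable_continuous_itv_cc f a b :
  (forall x, a <= x <= b -> {for x, continuous f}) ->
  measurable_fun `[a, b] f.
Proof.
move=> cf; apply: subspace_continuous_measurable_fun => //.
by apply: continuous_in_subspaceT => x; rewrite inE/= in_itv/=; exact: cf.
Qed.

(** The fundamental theorem holds on each [l n, r n], and monotone convergence is applied to [f1]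
    and [f2] separately. Splitting the derivative into two nonnegative parts and leaving [f2] on the
    right keeps the identity meaningful when both integrals are infinite. *)
Lemma exhaustion_FTC (D : set R) (l r : nat -> R) F (f1 f2 : R -> R) (d : R) :
  (forall n, l n < r n) ->
  nondecreasing_seq (fun n => `[l n, r n]%classic) ->
  \bigcup_n `[l n, r n]%classic = D ->
  (forall x, D x -> 0 <= f1 x) -> (forall x, D x -> 0 <= f2 x) ->
  (forall x, D x -> {for x, continuous f1}) ->
  (forall x, D x -> {for x, continuous f2}) ->
  (forall x, D x -> is_derive x 1 F (f1 x - f2 x)) ->
  (fun n => F (r n) - F (l n)) @ \oo --> d ->
  (\int[leb]_(x in D) (f1 x)%:E = \int[leb]_(x in D) (f2 x)%:E + d%:E)%E.
Proof.
move=> lr ndI UD f10 f20 cf1 cf2 dF Fd.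
have ID n x : l n <= x <= r n -> D x.
  by move=> xI; rewrite -UD; exists n => //=; rewrite in_itv.
have lim f : (forall x, D x -> 0 <= f x) ->
    (forall x, D x -> {for x, continuous f}) ->
  (fun n => \int[leb]_(x in `[l n, r n]) (f x)%:E)%E @ \oo -->
  (\int[leb]_(x in D) (f x)%:E)%E.
  move=> f0 cf; rewrite -UD; apply: ge0_nondecreasing_set_cvg_integral => //.
  - move=> n; apply/measurable_EFinP; apply: measurable_continuous_itv_cc => x.
    by move=> /ID; exact: cf.
  - by move=> n x /= xI; rewrite lee_fin; apply: f0; apply: (ID n); rewrite in_itv in xI.
have ndn f n : (forall x, D x -> {for x, continuous f}) ->
    (\int[leb]_(x in `[l n, r n]) (f x)%:E \is a fin_num)%E.
  move=> cf; have : leb.-integrable `[l n, r n] (EFin \o f).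
    apply: continuous_compact_integrable; first exact: segment_compact.
    apply: continuous_in_subspaceT => x; rewrite inE/= in_itv/= => /ID.
    exact: cf.
  by apply: integrable_fin_num.
have key n : (\int[leb]_(x in `[l n, r n]) (f1 x)%:E =
   \int[leb]_(x in `[l n, r n]) (f2 x)%:E + (F (r n) - F (l n))%:E)%E.
  have <- : (\int[leb]_(x in `[l n, r n]) (f1 x - f2 x)%:E =
      (F (r n) - F (l n))%:E)%E.
    apply: FTC_is_derive => // x /ID Dx; first exact: dF.
    by apply: cvgB; [exact: cf1|exact: cf2].
  have -> : (\int[leb]_(x in `[l n, r n]) (f1 x - f2 x)%:E =
      \int[leb]_(x in `[l n, r n]) ((f1 x)%:E - (f2 x)%:E))%E by [].
  rewrite integralB//; last 2 first.
  - apply: continuous_compact_integrable; first exact: segment_compact.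
    apply: continuous_in_subspaceT => x; rewrite inE/= in_itv/= => /ID.
    exact: cf1.
  - apply: continuous_compact_integrable; first exact: segment_compact.
    apply: continuous_in_subspaceT => x; rewrite inE/= in_itv/= => /ID.
    exact: cf2.
  by rewrite addeC subeK//; exact: ndn.
have h1 := lim _ f10 cf1; have h2 := lim _ f20 cf2.
have h3 : (fun n => \int[leb]_(x in `[l n, r n]) (f2 x)%:E +
    (F (r n) - F (l n))%:E)%E @ \oo --> (\int[leb]_(x in D) (f2 x)%:E + d%:E)%E.
  apply: cvgeD => //; first by rewrite fin_num_adde_defl.
  exact/cvg_EFin/Fd/nearW.
have E := funext key; rewrite E in h1.
exact: (cvg_unique _ h1 h3).
Qed.

End Calculus.

(** A zero integral would make [f] vanish almost everywhere on [D], so that [D] would lie in a null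
    set. *)
Lemma integral_gt0 d (T : measurableType d) (R : realType)
    (mu : {measure set T -> \bar R}) (D : set T) (f : T -> \bar R) :
  measurable D -> measurable_fun D f -> (0 < mu D)%E ->
  (forall x, D x -> 0 < f x)%E -> (0 < \int[mu]_(x in D) f x)%E.
Proof.
move=> mD mf D0 f0.
have I0 : (0 <= \int[mu]_(x in D) f x)%E by apply: integral_ge0 => x /f0 /ltW.
rewrite lt_neqAle I0 andbT eq_sym; apply/negP => /eqP If0.
have : (\int[mu]_(x in D) `|f x| = 0)%E.
  by rewrite -If0; apply: eq_integral => x /set_mem/f0/ltW/gee0_abs.
move/(ae_eq_integral_abs _ mD mf) => [A [mA A0 DA]].
move: D0; rewrite -A0; apply/negP; rewrite -leNgt.
apply: le_measure; rewrite ?inE// => x Dx; apply: DA => /= /(_ Dx) fx0.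
by have := f0 x Dx; rewrite fx0 ltxx.
Qed.

Section RealIntegrands.
Context d (T : measurableType d) (R : realType).
Variables (mu : {measure set T -> \bar R}) (D : set T).
Hypothesis mD : measurable D.
Implicit Types (f g : T -> R).

Lemma ge0_integralZl_real f (c : R) : measurable_fun D f ->
  (forall x, D x -> 0 <= f x) -> 0 <= c ->
  (\int[mu]_(x in D) (c * f x)%:E = c%:E * \int[mu]_(x in D) (f x)%:E)%E.
Proof.
move=> mf f0 c0; rewrite -ge0_integralZl//.
exact/measurable_EFinP.
Qed.

Lemma ge0_integralD_real f g : measurable_fun D f -> measurable_fun D g ->
  (forall x, D x -> 0 <= f x) -> (forall x, D x -> 0 <= g x) ->
  (\int[mu]_(x in D) (f x + g x)%:E =
   \int[mu]_(x in D) (f x)%:E + \int[mu]_(x in D) (g x)%:E)%E.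
Proof.
move=> mf mg f0 g0; by rewrite -ge0_integralD//; exact/measurable_EFinP.
Qed.

Lemma ge0_le_integral_real f g : measurable_fun D f -> measurable_fun D g ->
  (forall x, D x -> 0 <= f x) -> (forall x, D x -> f x <= g x) ->
  (\int[mu]_(x in D) (f x)%:E <= \int[mu]_(x in D) (g x)%:E)%E.
Proof.
move=> mf mg f0 fg; apply: ge0_le_integral => //.
- exact/measurable_EFinP.
- exact/measurable_EFinP.
Qed.

End RealIntegrands.

(** * Gamma integrals with a rate parameter *)

Section GammaFunction.
Variable R : realType.
Local Notation leb := (@lebesgue_measure R).
Implicit Types (a l u v : R) (n k : nat).

Lemma measurable_Rpos : measurable (@Rpos R).
Proof. exact: measurable_itv. Qed.

Lemma RposE u : Rpos u = (0 < u) :> Prop.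
Proof. by rewrite /Rpos/= in_itv/= andbT. Qed.

Lemma in_Rpos u : (u \in @Rpos R) = (0 < u).
Proof.
by apply/idP/idP; [move=> /set_mem; rewrite RposE|move=> h; apply/mem_set; rewrite RposE].
Qed.

Lemma nd_cc_Rpos :
  nondecreasing_seq (fun n : nat => `[n.+2%:R^-1, n.+2%:R : R]%classic).
Proof.
apply/nondecreasing_seqP => n; rewrite subsetEset => x /=; rewrite !in_itv/=.
move=> /andP[h1 h2]; apply/andP; split.
  by apply: le_trans h1; rewrite lef_pV2 ?posrE// ler_nat.
by apply: le_trans h2 _; rewrite ler_nat.
Qed.

Lemma bigcup_cc_Rpos : \bigcup_n `[n.+2%:R^-1, n.+2%:R : R]%classic = Rpos.
Proof.
apply/seteqP; split => [x [n _]/=|x].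
  rewrite in_itv/= RposE => /andP[h1 _]; apply: lt_le_trans h1.
  by rewrite invr_gt0.
rewrite RposE => x0.
have xn : exists n : nat, x <= n%:R.
  by exists (Num.truncn x).+1; rewrite ltW// truncnS_gt.
have xn' : exists n : nat, x^-1 <= n%:R.
  by exists (Num.truncn x^-1).+1; rewrite ltW// truncnS_gt.
case: xn => n xn; case: xn' => m xm; exists (n + m)%N => //=.
rewrite in_itv/=; apply/andP; split.
  rewrite invf_ple ?posrE//; apply: le_trans xm _.
  by rewrite ler_nat -addn2 -addnA (leq_trans (leq_addl n m))// addnA leq_addr.
by apply: le_trans xn _; rewrite ler_nat -addn2 -addnA leq_addr.
Qed.

Lemma continuous_powR a u : 0 < u -> {for u, continuous (fun x : R => x `^ a)}.
Proof.
move=> u0; apply/differentiable_continuous/derivable1_diffP.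
by apply: derivable_powR; rewrite in_itv/= andbT.
Qed.

(** For u > 1 the power is at most u^m with m an integer above a, and u^m is a multiple of one term
    of the exponential series at u / 2. The summand 1 in the constant covers u <= 1. *)
Lemma powR_le_expR a : 0 <= a ->
  exists2 C : R, 0 < C & forall u, 0 < u -> u `^ a <= C * expR (u / 2).
Proof.
move=> a0; pose m := (Num.truncn a).+1.
have am : a <= m%:R by rewrite ltW// truncnS_gt.
have C0 : 0 < (m`!%:R * 2 ^+ m : R) by rewrite mulr_gt0// ltr0n fact_gt0.
exists (1 + m`!%:R * 2 ^+ m); first by rewrite ltr_wpDl.
move=> u u0; have [u1|u1] := leP u 1.
  apply: (@le_trans _ _ 1).
    apply: (@le_trans _ _ (1 `^ a)); last by rewrite powR1.
    by apply: ge0_ler_powR => //; rewrite nnegrE// ltW.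
  rewrite -[leLHS]mul1r ler_pM//.
    by rewrite lerDl ltW.
  by rewrite -expR0 ler_expR divr_ge0// ltW.
apply: (@le_trans _ _ (u ^+ m)).
  by rewrite -powR_mulrn ?(ltW u0)// ler_powR// ltW.
apply: (@le_trans _ _ (m`!%:R * 2 ^+ m * expR (u / 2))); last first.
  by rewrite ler_wpM2r ?expR_ge0// lerDr.
have := @expR_ge1Dxn _ (u / 2) (Num.truncn a).
rewrite -/m => /(_ (divr_ge0 (ltW u0) (ler0n R 2))) h.
rewrite -mulrA -ler_pdivrMl ?ltr0n ?fact_gt0// -ler_pdivrMl ?exprn_gt0//.
apply: le_trans h; rewrite exprMn exprVn.
rewrite -[leLHS]add0r lerD//.
by rewrite (mulrC m`!%:R^-1) mulrA (mulrC (2 ^- m)).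
Qed.

Lemma cvg_powR_expR a l : 0 <= a -> 0 < l ->
  (fun n => n.+2%:R `^ a * expR (- (l * n.+2%:R)) : R) @ \oo --> 0.
Proof.
move=> a0 l0.
(* with t = l n, t^a <= C e^{t/2} *)
have [C C0 hC] := powR_le_expR a0.
apply: (@squeeze_cvgr _ _ _ _ (fun=> 0)
    (fun n => C * l `^ (- a) * ((2 / l) * n.+1%:R^-1) : R)).
- apply: nearW => n; rewrite mulr_ge0 ?powR_ge0 ?expR_ge0//=.
  have n0 : 0 < l * n.+2%:R by rewrite mulr_gt0.
  have := hC _ n0; rewrite powRM ?(ltW l0)// => h.
  have -> : n.+2%:R `^ a = l `^ (- a) * (l `^ a * n.+2%:R `^ a).
    by rewrite mulrA -powRD ?addNr ?powRr0 ?mul1r// (gt_eqF l0) implybT.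
  rewrite -[leRHS]mulrA [leRHS]mulrCA -[leLHS]mulrA ler_wpM2l ?powR_ge0//.
  apply: (@le_trans _ _ (C * expR (l * n.+2%:R / 2) * expR (- (l * n.+2%:R)))).
    by rewrite ler_wpM2r ?expR_ge0.
  rewrite -mulrA -expRD ler_wpM2l ?(ltW C0)//.
  have -> : l * n.+2%:R / 2 - l * n.+2%:R = - (l * n.+2%:R / 2) by field.
  rewrite expRN -[leRHS]invrK lef_pV2 ?posrE ?expR_gt0//; last first.
    by rewrite invr_gt0 mulr_gt0// divr_gt0.
  rewrite invfM invrK invf_div.
  apply: le_trans (expR_ge1Dx _).
  have -> : n.+2%:R = n.+1%:R + 1 :> R by rewrite natr1.
  by move: (n.+1%:R : R) => x; rewrite mulrDr mulr1 mulrDl; lra.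
- exact: cvg_cst.
- rewrite -[X in _ --> X](mulr0 (C * l `^ (- a))); apply: cvgMr.
  rewrite -[X in _ --> X](mulr0 (2 / l)); apply: cvgMr.
  exact: cvg_harmonic.
Qed.

Lemma cvg_inv2 : (fun n => n.+2%:R^-1 : R) @ \oo --> (0 : R).
Proof. by have := @cvg_harmonic R; rewrite -(cvg_shiftS (@harmonic R)). Qed.

Lemma cvg_powR_inv a : 0 < a -> (fun n => (n.+2%:R^-1 : R) `^ a) @ \oo --> 0.
Proof.
move=> a0.
have h := powR_cvg0 a0.
move/cvg_at_rightP: h; apply; split; first by move=> n; rewrite invr_gt0.
exact: cvg_inv2.
Qed.

Lemma cvg_expR_inv l : (fun n => expR (- (l * n.+2%:R^-1)) : R) @ \oo --> (1 : R).
Proof.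
have h : (fun n => - (l * n.+2%:R^-1) : R) @ \oo --> (0 : R).
  rewrite -[X in _ --> X]oppr0; apply: cvgN.
  rewrite -[X in _ --> X](mulr0 l); apply: cvgMr.
  exact: cvg_inv2.
rewrite -[X in _ --> X]expR0.
by apply: (continuous_cvg _ _ h); exact: continuous_expR.
Qed.

(** Kept in the extended reals until finiteness is proved: [GammaR] applies [fine], which would
    silently send an infinite integral to 0. *)
Definition gammaI a l : \bar R :=
  (\int[leb]_(u in Rpos) (u `^ (a - 1) * expR (- (l * u)))%:E)%E.

Lemma continuous_gammaI a l u : 0 < u ->
  {for u, continuous (fun u => u `^ (a - 1) * expR (- (l * u)))}.
Proof.
move=> u0; apply: cvgM; first exact: continuous_powR.
apply: continuous_comp; last exact: continuous_expR.
by apply: cvgN; apply: cvgMr; exact: cvg_id.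
Qed.

Lemma measurable_continuous_Rpos (f : R -> R) :
  (forall u, 0 < u -> {for u, continuous f}) -> measurable_fun Rpos f.
Proof.
move=> cf; apply: open_continuous_measurable_fun; first exact: interval_open.
by move=> u; rewrite in_Rpos; exact: cf.
Qed.

Lemma continuous_expRM l u : {for u, continuous (fun u : R => expR (- (l * u)))}.
Proof.
apply: continuous_comp; last exact: continuous_expR.
by apply: cvgN; apply: cvgMr; exact: cvg_id.
Qed.

Lemma measurable_gammaI a l :
  measurable_fun Rpos (fun u => u `^ (a - 1) * expR (- (l * u))).
Proof.
apply: open_continuous_measurable_fun; first exact: interval_open.
by move=> u; rewrite in_Rpos; exact: continuous_gammaI.
Qed.

(** Integration by parts with primitive u^a exp(-l u), whose values vanish at both ends. No
    finiteness is presupposed, so the relation can later transport finiteness from a + 1 to a. *)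
Lemma gammaI_rec a l : 0 < a -> 0 < l ->
  (a%:E * gammaI a l = l%:E * gammaI (a + 1) l)%E.
Proof.
move=> a0 l0; rewrite /gammaI.
have e b c : 0 < c -> (c%:E * \int[leb]_(u in Rpos) (u `^ (b - 1) * expR (- (l * u)))%:E
    = \int[leb]_(u in Rpos) (c * (u `^ (b - 1) * expR (- (l * u))))%:E)%E.
  move=> c0; rewrite ge0_integralZl_real//; [exact: measurable_Rpos|
    exact: measurable_gammaI| |exact: ltW].
  by move=> u _; rewrite mulr_ge0 ?powR_ge0 ?expR_ge0.
rewrite (e a a a0) (e (a + 1) l l0).
rewrite -[RHS]adde0.
apply: (@exhaustion_FTC R Rpos (fun n => n.+2%:R^-1) (fun n => n.+2%:R)
  (fun u => u `^ a * expR (- (l * u)))).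
- by move=> n; rewrite (@lt_le_trans _ _ 1)// ?invf_lt1// ?ltr1n// ler1n.
- exact: nd_cc_Rpos.
- exact: bigcup_cc_Rpos.
- by move=> u _; rewrite !mulr_ge0 ?powR_ge0 ?expR_ge0// ltW.
- by move=> u _; rewrite !mulr_ge0 ?powR_ge0 ?expR_ge0// ltW.
- move=> u; rewrite RposE => u0; apply: cvgMr; exact: continuous_gammaI.
- move=> u; rewrite RposE => u0; apply: cvgMr; exact: continuous_gammaI.
- move=> u; rewrite RposE => u0.
  have h := is_derive1_powR a u0.
  apply: is_derive_eq; rewrite addrK /GRing.scale/=.
  ring.
- rewrite -[X in _ --> X]subr0; apply: cvgB.
    exact: (cvg_powR_expR (ltW a0)).
  rewrite -[X in _ --> X](mul0r 1); apply: cvgM; first exact: cvg_powR_inv.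
  exact: cvg_expR_inv.
Qed.

Lemma gammaI_ge1_lty a l : 1 <= a -> 0 < l -> (gammaI a l < +oo)%E.
Proof.
move=> a1 l0.
have a10 : 0 <= a - 1 by rewrite subr_ge0.
have [C C0 hC] := powR_le_expR a10.
pose C' := C * l `^ (1 - a) * (2 / l).
have C'0 : 0 <= C' by rewrite !mulr_ge0 ?powR_ge0// ltW// ?invr_gt0.
have le1 u : Rpos u -> ((u `^ (a - 1) * expR (- (l * u)))%:E <=
    (C' * (l / 2 * expR (- (l / 2 * u))))%:E)%E.
  rewrite RposE => u0; rewrite lee_fin.
  have lu : 0 < l * u by rewrite mulr_gt0.
  have := hC _ lu; rewrite powRM ?(ltW l0) ?(ltW u0)// => h.
  have -> : u `^ (a - 1) = l `^ (1 - a) * (l `^ (a - 1) * u `^ (a - 1)).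
    rewrite mulrA -powRD; last by rewrite (gt_eqF l0) implybT.
    by rewrite addrA subrK subrr powRr0 mul1r.
  have -> : C' * (l / 2 * expR (- (l / 2 * u))) =
      l `^ (1 - a) * (C * expR (l * u / 2)) * expR (- (l * u)).
    rewrite /C' -[in RHS]mulrA -[in X in _ = X]mulrA -expRD.
    have -> : l * u / 2 - l * u = - (l / 2 * u) by field.
    by field; rewrite gt_eqF.
  by rewrite ler_wpM2r ?expR_ge0// ler_wpM2l ?powR_ge0.
apply: (@le_lt_trans _ _ (\int[leb]_(u in Rpos)
    (C' * (l / 2 * expR (- (l / 2 * u))))%:E)%E).
  apply: ge0_le_integral => //.
  - exact: measurable_Rpos.
  - by move=> u _; rewrite lee_fin mulr_ge0 ?powR_ge0 ?expR_ge0.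
  - by apply/measurable_EFinP; exact: measurable_gammaI.
  - apply/measurable_EFinP; apply: measurable_continuous_Rpos => u u0.
    by apply: cvgMr; apply: cvgMr; exact: continuous_expRM.
have -> : (\int[leb]_(u in Rpos) (C' * (l / 2 * expR (- (l / 2 * u))))%:E =
    \int[leb]_(u in Rpos) 0%:E + C'%:E)%E.
  apply: (@exhaustion_FTC R Rpos (fun n => n.+2%:R^-1) (fun n => n.+2%:R)
  (fun u => C' * (- expR (- (l / 2 * u))))).
  - by move=> n; rewrite (@lt_le_trans _ _ 1)// ?invf_lt1// ?ltr1n// ler1n.
  - exact: nd_cc_Rpos.
  - exact: bigcup_cc_Rpos.
  - by move=> u _; apply: mulr_ge0 => //; rewrite !mulr_ge0 ?expR_ge0// ltW.
  - by [].
  - by move=> u _; apply: cvgMr; apply: cvgMr; exact: continuous_expRM.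
  - by move=> u _; exact: cvg_cst.
  - move=> u _; apply: is_derive_eq; rewrite /GRing.scale/=; ring.
  - have h0 : (fun n => expR (- (l / 2 * n.+2%:R)) : R) @ \oo --> (0 : R).
      have := @cvg_powR_expR 0 (l / 2) (lexx _) (divr_gt0 l0 (ltr0n _ 2)).
      by under eq_fun do rewrite powRr0 mul1r.
    rewrite [X in _ --> X](_ : C' = C' * (- 0) - C' * (- 1)); last by ring.
    apply: cvgB; apply: cvgMr; apply: cvgN; first exact: h0.
    exact: cvg_expR_inv.
by rewrite integral0 add0e ltry.
Qed.

(** For a < 1 the integrand is unbounded at 0; the recurrence moves the question to a + 1, where
    domination by an exponential density works. *)
Lemma gammaI_lty a l : 0 < a -> 0 < l -> (gammaI a l < +oo)%E.
Proof.
move=> a0 l0; have h : (gammaI (a + 1) l < +oo)%E.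
  by apply: gammaI_ge1_lty => //; rewrite lerDr ltW.
have := gammaI_rec a0 l0.
rewrite ltey; apply: contra_eq_neq => ->.
rewrite gt0_muley ?lte_fin//.
rewrite -ltey.
have : (gammaI (a + 1) l \is a fin_num)%E.
  rewrite ge0_fin_numE//; apply: integral_ge0 => u _.
  by rewrite lee_fin mulr_ge0 ?powR_ge0 ?expR_ge0.
move/fineK <-; by rewrite -EFinM ltry.
Qed.

Lemma gammaI_ge0 a l : (0 <= gammaI a l)%E.
Proof.
by apply: integral_ge0 => u _; rewrite lee_fin mulr_ge0 ?powR_ge0 ?expR_ge0.
Qed.

Lemma gammaI_fin_num a l : 0 < a -> 0 < l -> (gammaI a l \is a fin_num)%E.
Proof. by move=> a0 l0; rewrite ge0_fin_numE ?gammaI_ge0 ?gammaI_lty. Qed.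

Lemma gammaI1_GammaR a : 0 < a -> gammaI a 1 = (GammaR a)%:E.
Proof.
move=> a0; rewrite /GammaR /gammaI.
under eq_integral do rewrite mul1r.
rewrite fineK//.
have := gammaI_fin_num a0 ltr01; rewrite /gammaI.
by under eq_integral do rewrite mul1r.
Qed.

Lemma gammaI_gt0 a l : 0 < a -> 0 < l -> (0 < gammaI a l)%E.
Proof.
move=> a0 l0; apply: integral_gt0.
- exact: measurable_Rpos.
- by apply/measurable_EFinP; exact: measurable_gammaI.
- have h : (0 < lebesgue_measure (@Rpos R))%E.
    by rewrite lebesgue_measure_itv/= ltry addye.
  exact: h.
- by move=> u; rewrite RposE lte_fin => u0; rewrite mulr_gt0 ?powR_gt0 ?expR_gt0.
Qed.

Lemma GammaR_gt0 a : 0 < a -> 0 < GammaR a.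
Proof. by move=> a0; rewrite -lte_fin -gammaI1_GammaR// gammaI_gt0. Qed.

Lemma GammaRS a : 0 < a -> GammaR (a + 1) = a * GammaR a.
Proof.
move=> a0; have a10 : 0 < a + 1 by rewrite addr_gt0.
have := gammaI_rec a0 ltr01; rewrite mul1e !gammaI1_GammaR// -EFinM.
by move=> [<-].
Qed.

End GammaFunction.

Section Affine.
Variable R : realType.
Local Notation leb := (@lebesgue_measure R).

Lemma measurable_affine (p q : R) :
  measurable_fun setT (fun y : R => p + q * y).
Proof. by apply: measurable_funD => //; exact: measurable_funM. Qed.

(** Scaling by q the image of [leb] under the map restores the length of every half-open interval,
    and a measure with these lengths is [leb]. *)
Lemma ge0_integral_affine (p q : R) (g : R -> \bar R) : 0 < q ->
  measurable_fun setT g -> (forall y, 0 <= g y)%E ->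
  (\int[leb]_y g (p + q * y)%R * q%:E = \int[leb]_y g y)%E.
Proof.
move=> q0 mg g0.
pose phi : measurableTypeR R -> measurableTypeR R := fun y : R => p + q * y.
have mphi : measurable_fun setT phi by exact: measurable_affine.
pose qq := NngNum (ltW q0).
pose pf : {measure set (measurableTypeR R) -> \bar R} :=
  measure_function_pushforward__canonical__measure_function_Measure leb mphi.
have lebE A : measurable A -> leb A = mscale qq pf A.
  apply: lebesgue_measure_unique => _ [[x y] _ <-].
  have pre : phi @^-1` `]x, y]%classic = `](x - p) / q, (y - p) / q]%classic.
    apply/seteqP; split => z /=; rewrite !in_itv/= /phi => /andP[h1 h2].
      by rewrite ltr_pdivrMr// ler_pdivlMr// mulrC ltrBlDl lerBrDl h1 h2.
    by move: h1 h2; rewrite ltr_pdivrMr// ler_pdivlMr// mulrC ltrBlDl lerBrDl => -> ->.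
  transitivity (q%:E * leb (`](x - p) / q, (y - p) / q]%classic)%R)%E; last first.
    by rewrite -pre.
  rewrite !lebesgue_measure_itv/= !lte_fin ltr_pM2r ?invr_gt0// ltrD2r.
  case: ifPn => _; last by rewrite mule0.
  by rewrite -EFinB -EFinB -EFinM; congr EFin; field; rewrite gt_eqF.
rewrite [RHS](eq_measure_integral (mscale qq pf)); last first.
  by move=> A mA _; exact: lebE.
rewrite ge0_integral_mscale//= ge0_integral_pushforward//=.
by rewrite preimage_setT muleC.
Qed.

End Affine.

Section GammaDensity.
Variable R : realType.
Local Notation leb := (@lebesgue_measure R).
Implicit Types (a l u v w : R) (n k : nat).

Definition poch a k : R := \prod_(i < k) (a + i%:R).

Lemma poch0 a : poch a 0 = 1. Proof. by rewrite /poch big_ord0. Qed.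

Lemma pochS a k : poch a k.+1 = poch a k * (a + k%:R).
Proof. by rewrite /poch big_ord_recr. Qed.

Lemma pochSl a k : poch a k.+1 = a * poch (a + 1) k.
Proof.
rewrite /poch big_ord_recl addr0; congr *%R; apply: eq_bigr => i _.
by rewrite /= /bump/= add1n -nat1r addrA.
Qed.

Lemma poch_gt0 a k : 0 < a -> 0 < poch a k.
Proof. by move=> a0; apply: prodr_gt0 => i _; rewrite ltr_wpDr. Qed.

Lemma poch1 k : poch 1 k = k`!%:R.
Proof.
elim: k => [|k IH]; first by rewrite poch0.
by rewrite pochS IH factS natrM nat1r mulrC.
Qed.

Lemma GammaR_poch a k : 0 < a -> GammaR (a + k%:R) = poch a k * GammaR a.
Proof.
move=> a0; elim: k => [|k IH]; first by rewrite addr0 poch0 mul1r.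
by rewrite -natr1 addrA GammaRS ?IH ?pochS ?ltr_wpDr//; ring.
Qed.

Lemma GammaR1 : GammaR 1 = 1 :> R.
Proof.
rewrite /GammaR.
have -> : (\int[leb]_(u in Rpos) ((u `^ (1 - 1)) * expR (- u))%:E =
    \int[leb]_(u in Rpos) 0%:E + 1%:E)%E.
  apply: (@exhaustion_FTC R Rpos (fun n => n.+2%:R^-1) (fun n => n.+2%:R)
    (fun u => - expR (- (1 * u)))).
  - by move=> n; rewrite (@lt_le_trans _ _ 1)// ?invf_lt1// ?ltr1n// ler1n.
  - exact: nd_cc_Rpos.
  - exact: bigcup_cc_Rpos.
  - by move=> u _; rewrite mulr_ge0 ?powR_ge0 ?expR_ge0.
  - by [].
  - move=> u u0; have -> : (fun u : R => u `^ (1 - 1) * expR (- u)) =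
        (fun u : R => u `^ (1 - 1) * expR (- (1 * u))).
      by apply/funext => v; rewrite mul1r.
    by apply: continuous_gammaI; rewrite -RposE.
  - by move=> u _; exact: cvg_cst.
  - move=> u _; apply: is_derive_eq.
    by rewrite /GRing.scale/= subrr powRr0 !mul1r; ring.
  - rewrite [X in _ --> X](_ : (1:R) = - 0 - (- 1)); last by ring.
    apply: cvgB; apply: cvgN; last exact: cvg_expR_inv.
    have := @cvg_powR_expR R 0 1 (lexx _) ltr01.
    by under eq_fun do rewrite powRr0 mul1r.
by rewrite integral0 add0e.
Qed.

Lemma integral_Rpos_setT (f : R -> \bar R) : (forall u, ~ 0 < u -> f u = 0%E) ->
  (\int[leb]_(u in Rpos) f u = \int[leb]_u f u)%E.
Proof.
move=> f0; rewrite integral_mkcond; apply: eq_integral => u _.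
by rewrite patchE in_Rpos; case: ifPn => // /negP/f0 ->.
Qed.

Lemma measurable_fun_Rpos_setT (f : R -> R) : measurable_fun Rpos f ->
  (forall u, ~ 0 < u -> f u = 0) -> measurable_fun setT f.
Proof.
move=> mf f0; have -> : f = f \_ Rpos.
  by apply/funext => u; rewrite patchE in_Rpos; case: ifPn => // /negP/f0 ->.
by apply/(measurable_restrictT _ (@measurable_Rpos R)).
Qed.

Lemma gammaIE a l : 0 < a -> 0 < l -> gammaI a l = (GammaR a * l `^ (- a))%:E.
Proof.
move=> a0 l0; rewrite EFinM -gammaI1_GammaR//.
pose g v := if 0 < v then v `^ (a - 1) * expR (- v) else 0.
have mg : measurable_fun setT g.
  apply: measurable_fun_Rpos_setT; last by move=> u; rewrite /g; case: ifP.
  apply: (@eq_measurable_fun _ _ _ _ _ (fun u => u `^ (a - 1) * expR (- (1 * u)))).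
    by move=> u; rewrite in_Rpos /g mul1r => ->.
  exact: measurable_gammaI.
have g0 v : (0 <= (g v)%:E)%E.
  by rewrite lee_fin /g; case: ifP => // _; rewrite mulr_ge0 ?powR_ge0 ?expR_ge0.
have := @ge0_integral_affine R 0 l (EFin \o g) l0.
have -> : gammaI a 1 = (\int[leb]_u (g u)%:E)%E.
  rewrite -integral_Rpos_setT; last by move=> u u0; rewrite /g (negbTE (introN idP u0)).
  rewrite /gammaI; apply: eq_integral => u; rewrite in_Rpos /g => ->.
  by rewrite mul1r.
move=> /= <-//; last exact/measurable_EFinP.
rewrite -muleA -EFinM muleC -integral_Rpos_setT; last first.
  by move=> u u0; rewrite /g add0r pmulr_rgt0// (negbTE (introN idP u0)).
rewrite -ge0_integralZl_real//.
- apply: eq_integral => u; rewrite in_Rpos => u0.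
  rewrite /g add0r pmulr_rgt0// u0 powRM ?ltW//.
  rewrite mulrA mulrA -(mulrA l) -powRD; last by rewrite (gt_eqF l0) implybT.
  by rewrite addrA addNr add0r powR_inv1 ?ltW// divff ?mul1r// gt_eqF.
- exact: measurable_Rpos.
- apply: measurable_funTS; apply: measurableT_comp => //.
  exact: measurable_affine.
- by move=> u _; rewrite -lee_fin.
- by rewrite mulr_ge0 ?powR_ge0 ?ltW.
Qed.

Lemma gamma_pdf_ge0 a l u : 0 < a -> 0 <= gamma_pdf a l u.
Proof.
move=> a0; rewrite /gamma_pdf; case: ifP => // _.
by rewrite !mulr_ge0 ?powR_ge0 ?expR_ge0// invr_ge0 ltW// GammaR_gt0.
Qed.

Lemma gamma_pdf_gt0 a l u : 0 < a -> 0 < l -> 0 < u -> 0 < gamma_pdf a l u.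
Proof.
move=> a0 l0 u0; rewrite /gamma_pdf u0.
by rewrite !mulr_gt0 ?powR_gt0 ?expR_gt0// invr_gt0 GammaR_gt0.
Qed.

Lemma gamma_pdf_out a l u : ~ 0 < u -> gamma_pdf a l u = 0.
Proof. by move=> u0; rewrite /gamma_pdf (negbTE (introN idP u0)). Qed.

Lemma measurable_gamma_pdf a l : measurable_fun setT (gamma_pdf a l).
Proof.
apply: measurable_fun_Rpos_setT; last exact: gamma_pdf_out.
apply: (@eq_measurable_fun _ _ _ _ _
    (fun u => l `^ a / GammaR a * (u `^ (a - 1) * expR (- (l * u))))).
  by move=> u; rewrite in_Rpos /gamma_pdf mulrA => ->.
by apply: measurable_funM => //; exact: measurable_gammaI.
Qed.

Lemma integral_gamma_pdf a l : 0 < a -> 0 < l ->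
  (\int[leb]_(u in Rpos) (gamma_pdf a l u)%:E = 1)%E.
Proof.
move=> a0 l0; have G0 := GammaR_gt0 a0.
transitivity (\int[leb]_(u in Rpos)
    (l `^ a / GammaR a * (u `^ (a - 1) * expR (- (l * u))))%:E)%E.
  by apply: eq_integral => u; rewrite in_Rpos /gamma_pdf mulrA => ->.
rewrite ge0_integralZl_real; [|exact: measurable_Rpos|exact: measurable_gammaI| |].
- rewrite -/(gammaI a l) gammaIE// -EFinM powRN; congr EFin.
  by field; rewrite gt_eqF ?powR_gt0//= gt_eqF.
- by move=> u _; rewrite mulr_ge0 ?powR_ge0 ?expR_ge0.
- by rewrite mulr_ge0 ?powR_ge0// invr_ge0 ltW.
Qed.

(** Size-biasing a gamma law raises its shape by one; this turns moments of gamma laws into total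
    masses. *)
Lemma mul_gamma_pdf a l u : 0 < a -> 0 < l ->
  u * gamma_pdf a l u = a / l * gamma_pdf (a + 1) l u.
Proof.
move=> a0 l0; rewrite /gamma_pdf; case: ifP => [u0|]; last by rewrite !mulr0.
have -> : l `^ (a + 1) = l `^ a * l.
  by rewrite powRD ?(gt_eqF l0) ?implybT// powRr1 ?ltW.
rewrite GammaRS//.
have -> : u `^ (a + 1 - 1) = u * u `^ (a - 1).
  by rewrite mulr_powRB1 ?addrK ?ltW.
by field; rewrite !gt_eqF// GammaR_gt0.
Qed.

Lemma scale_gamma_pdf a l p w : 0 < a -> 0 < l -> 0 < p ->
  gamma_pdf a l (p^-1 * w) / p = gamma_pdf a (l / p) w.
Proof.
move=> a0 l0 p0; rewrite /gamma_pdf pmulr_rgt0 ?invr_gt0//.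
case: ifP => [w0|]; last by rewrite mul0r.
rewrite !powRM ?invr_ge0 ?ltW// mulrA (mulrA l).
have -> : p^-1 `^ a = p^-1 * p^-1 `^ (a - 1) by rewrite mulr_powRB1// invr_ge0 ltW.
ring.
Qed.

End GammaDensity.

(** * Convolution of gamma laws of equal rate and the conditional law of the path *)

Section GammaConvolution.
Variable R : realType.
Local Notation leb := (@lebesgue_measure R).
Implicit Types (a c l p v w : R) (n k : nat).

Lemma nd_cc_oc v : 0 < v ->
  nondecreasing_seq (fun n : nat => `[v * n.+2%:R^-1, v]%classic).
Proof.
move=> v0; apply/nondecreasing_seqP => n; rewrite subsetEset => x /=; rewrite !in_itv/=.
move=> /andP[h1 ->]; rewrite andbT; apply: le_trans h1.
by rewrite ler_pM2l// lef_pV2 ?posrE// ler_nat.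
Qed.

Lemma bigcup_cc_oc v : 0 < v -> \bigcup_n `[v * n.+2%:R^-1, v]%classic = `]0, v]%classic.
Proof.
move=> v0; apply/seteqP; split => [x [n _]/=|x/=].
  rewrite !in_itv/= => /andP[h1 ->]; rewrite andbT; apply: lt_le_trans h1.
  by rewrite mulr_gt0// invr_gt0.
rewrite in_itv/= => /andP[x0 xv].
pose n := Num.truncn (v / x); exists n => //=; rewrite in_itv/= xv andbT.
rewrite ler_pdivrMr// -ler_pdivrMl// mulrC.
apply: (@le_trans _ _ n.+1%:R); first by rewrite ltW// truncnS_gt.
by rewrite ler_nat.
Qed.

(** Induction on k: the derivative of w^a / a (v - w)^(k+1) trades one power of v - w for one power
    of w. An integer exponent is enough because the second shape comes from a Poisson count. *)
Lemma beta_integral a k v : 0 < a -> 0 < v ->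
  (\int[leb]_(w in `]0%R, v]) (w `^ (a - 1) * (v - w) ^+ k)%:E =
   (k`!%:R / poch a k.+1 * v `^ (a + k%:R))%:E)%E.
Proof.
move=> + v0; elim: k a => [|k IH] a a0.
  have -> : (\int[leb]_(w in `]0%R, v]) (w `^ (a - 1) * (v - w) ^+ 0)%:E =
     \int[leb]_(w in `]0%R, v]) 0%:E + (v `^ a / a)%:E)%E.
    apply: (@exhaustion_FTC R _ (fun n => v * n.+2%:R^-1) (fun=> v)
      (fun w => w `^ a / a)).
    - by move=> n; rewrite gtr_pMr// invf_lt1// ltr1n.
    - exact: nd_cc_oc.
    - exact: bigcup_cc_oc.
    - by move=> w _; rewrite expr0 mulr1 powR_ge0.
    - by [].
    - move=> w /=; rewrite in_itv/= => /andP[w0 _].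
      by apply: cvgM; [exact: continuous_powR|exact: cvg_cst].
    - by move=> w _; exact: cvg_cst.
    - move=> w /=; rewrite in_itv/= => /andP[w0 _].
      have h := is_derive1_powR a w0.
      apply: is_derive_eq; rewrite /GRing.scale/= expr0.
      by field; rewrite gt_eqF.
    - rewrite -[X in _ --> X]subr0; apply: cvgB; first exact: cvg_cst.
      rewrite [X in _ --> X](_ : (0:R) = v `^ a * 0 / a); last by rewrite mulr0 mul0r.
      apply: cvgMl; rewrite [X in X @ _](_ : _ = fun n => v `^ a * n.+2%:R^-1 `^ a).
        by apply: cvgMr; exact: cvg_powR_inv.
      by apply/funext => n; rewrite powRM ?invr_ge0// ltW.
  rewrite integral0 add0e pochS poch0 !addr0 fact0; congr EFin.
  by field; rewrite gt_eqF.
have a10 : 0 < a + 1 by rewrite addr_gt0.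
have := IH _ a10; rewrite addrK => {}IH.
have -> : (\int[leb]_(w in `]0%R, v]) (w `^ (a - 1) * (v - w) ^+ k.+1)%:E =
   \int[leb]_(w in `]0%R, v]) (k.+1%:R / a * (w `^ a * (v - w) ^+ k))%:E + 0%:E)%E.
  apply: (@exhaustion_FTC R _ (fun n => v * n.+2%:R^-1) (fun=> v)
    (fun w => w `^ a / a * (v - w) ^+ k.+1)).
  - by move=> n; rewrite gtr_pMr// invf_lt1// ltr1n.
  - exact: nd_cc_oc.
  - exact: bigcup_cc_oc.
  - move=> w /=; rewrite in_itv/= => /andP[w0 wv].
    by rewrite mulr_ge0 ?powR_ge0// exprn_ge0// subr_ge0.
  - move=> w /=; rewrite in_itv/= => /andP[w0 wv].
    by rewrite !mulr_ge0 ?powR_ge0 ?invr_ge0 ?(ltW a0)// exprn_ge0// subr_ge0.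
  - move=> w /=; rewrite in_itv/= => /andP[w0 _].
    apply: cvgM; first exact: continuous_powR.
    apply: (@continuous_comp _ _ _ (fun w => v - w) (fun x => x ^+ k.+1)).
      by apply: cvgB; [exact: cvg_cst|exact: cvg_id].
    exact: exprn_continuous.
  - move=> w /=; rewrite in_itv/= => /andP[w0 _].
    apply: cvgMr; apply: cvgM; first exact: continuous_powR.
    apply: (@continuous_comp _ _ _ (fun w => v - w) (fun x => x ^+ k)).
      by apply: cvgB; [exact: cvg_cst|exact: cvg_id].
    exact: exprn_continuous.
  - move=> w /=; rewrite in_itv/= => /andP[w0 _].
    have h := is_derive1_powR a w0.
    have h2 : is_derive w 1 (fun x : R => (v - x) ^+ k.+1) (- (k.+1%:R * (v - w) ^+ k)).
      have -> : (fun x : R => (v - x) ^+ k.+1) = (fun x : R => v - x) ^+ k.+1.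
        by apply/funext => x; rewrite exprfctE.
      have h1 : is_derive w 1 (fun x : R => v - x) (-1).
        by apply: is_derive_eq; rewrite add0r mul1r.
      have -> : - (k.+1%:R * (v - w) ^+ k) = (k.+1%:R * (v - w) ^+ k) *: (-1 : R).
        by rewrite /GRing.scale/= mulrN1.
      exact: is_deriveX.
    apply: is_derive_eq; rewrite /GRing.scale/=.
    by field; rewrite gt_eqF.
  - rewrite subrr expr0n/= mulr0.
    rewrite [X in _ --> X](_ : (0:R) = 0 - (v `^ a * 0 / a * (v - v * 0) ^+ k.+1)); last first.
      by rewrite mulr0 !mul0r subr0.
    apply: cvgB; first exact: cvg_cst.
    apply: cvgM.
      apply: cvgMl; rewrite [X in X @ _](_ : _ = fun n => v `^ a * n.+2%:R^-1 `^ a).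
        by apply: cvgMr; exact: cvg_powR_inv.
      by apply/funext => n; rewrite powRM ?invr_ge0// ltW.
    have h : (fun n => v - v * n.+2%:R^-1) @ \oo --> v - v * 0.
      by apply: cvgB; [exact: cvg_cst|apply: cvgMr; exact: cvg_inv2].
    exact: (cvg_comp _ _ h (@exprn_continuous R k.+1 _)).
rewrite adde0 ge0_integralZl_real//.
- rewrite IH -EFinM; congr EFin.
  rewrite (pochSl a) factS natrM.
  have -> : a + k.+1%:R = a + 1 + k%:R by rewrite -nat1r addrA.
  by field; rewrite !gt_eqF// ?poch_gt0.
- have h : measurable_fun setT (fun w : R => w `^ a * (v - w) ^+ k).
    by apply: measurable_funM => //; apply: measurable_funX; exact: measurable_funB.
  exact: (measurable_funTS h).
- move=> w /=; rewrite in_itv/= => /andP[w0 wv].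
  by rewrite !mulr_ge0 ?powR_ge0// exprn_ge0// subr_ge0.
- by rewrite mulr_ge0 ?invr_ge0// ltW.
Qed.

(** With equal rates the two exponentials combine to exp(-c v), which does not depend on w, and a
    Beta integral over ]0, v[ remains. *)
Lemma gamma_pdf_conv a c k v : 0 < a -> 0 < c ->
  (\int[leb]_w (gamma_pdf a c w * gamma_pdf k.+1%:R c (v - w))%:E =
   (gamma_pdf (a + k.+1%:R) c v)%:E)%E.
Proof.
move=> a0 c0; have Ga := GammaR_gt0 a0.
have Gk : 0 < GammaR (k.+1%:R : R) by exact: GammaR_gt0.
have [v0|v0] := ltP 0 v; last first.
  rewrite gamma_pdf_out ?integral0_eq//; last by apply/negP; rewrite -leNgt.
  move=> w _; have [w0|w0] := ltP 0 w; last first.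
    by rewrite gamma_pdf_out ?mul0r//; apply/negP; rewrite -leNgt.
  rewrite (@gamma_pdf_out _ k.+1%:R) ?mulr0//; apply/negP; rewrite -leNgt.
  by rewrite subr_le0 (le_trans v0)// ltW.
pose C := c `^ a / GammaR a * (c `^ k.+1%:R / GammaR k.+1%:R) * expR (- (c * v)).
have C0 : 0 <= C.
  by rewrite !mulr_ge0 ?powR_ge0 ?expR_ge0// invr_ge0 ltW.
have mb : measurable_fun setT (fun w : R => w `^ (a - 1) * (v - w) ^+ k).
  by apply: measurable_funM => //; apply: measurable_funX; exact: measurable_funB.
transitivity (\int[leb]_(w in `]0%R, v[) (C * (w `^ (a - 1) * (v - w) ^+ k))%:E)%E.
  rewrite [RHS]integral_mkcond; apply: eq_integral => w _.
  rewrite patchE; case: ifPn => [/set_mem/=|wN].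
    rewrite in_itv/= => /andP[w0 wv]; rewrite /gamma_pdf w0 subr_gt0 wv.
    rewrite -(natr1 k) addrK powR_mulrn ?subr_ge0 ?(ltW wv)// natr1.
    have -> : C = c `^ a / GammaR a * (c `^ k.+1%:R / GammaR k.+1%:R) *
        (expR (- (c * w)) * expR (- (c * (v - w)))).
      by rewrite -expRD /C; congr (_ * expR _); ring.
    congr EFin; ring.
  have : ~~ (0 < w < v).
    by apply: contra wN => wv; apply/mem_set => /=; rewrite in_itv.
  rewrite negb_and -!leNgt => /orP[w0|wv].
    by rewrite gamma_pdf_out ?mul0r//; apply/negP; rewrite -leNgt.
  by rewrite (@gamma_pdf_out _ k.+1%:R) ?mulr0//; apply/negP; rewrite -leNgt subr_le0.
rewrite integral_itv_bndo_bndc; last first.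
  have h : measurable_fun `]0, v[ (fun w : R => C * (w `^ (a - 1) * (v - w) ^+ k)).
    by apply: measurable_funTS; exact: measurable_funM.
  exact/measurable_EFinP.
rewrite ge0_integralZl_real//; last 2 first.
- exact: (measurable_funTS mb).
- move=> w /=; rewrite in_itv/= => /andP[w0 wv].
  by rewrite !mulr_ge0 ?powR_ge0// exprn_ge0// subr_ge0.
rewrite beta_integral// -EFinM; congr EFin.
rewrite /gamma_pdf v0 GammaR_poch//.
have -> : a + k.+1%:R - 1 = a + k%:R by rewrite -natr1 addrA addrK.
have -> : c `^ (a + k.+1%:R) = c `^ a * c `^ k.+1%:R.
  by rewrite powRD ?(gt_eqF c0) ?implybT.
rewrite /C; have -> : GammaR (k.+1%:R : R) = k`!%:R.
  by rewrite -nat1r GammaR_poch// poch1 GammaR1 mulr1.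
by field; rewrite !gt_eqF// ?poch_gt0// ltr0n fact_gt0.
Qed.

(** Scaling by 1 - t turns the rate l into l / (1 - t), and scaling Y by t turns its rate l t / (1 -
    t) into the same number. Equal rates make the shapes add, and the separate case Y = 0 fits in as
    the shape a + 0. *)
Lemma cond_law_gamma_pdf a l t k (A : set R) : 0 < a -> 0 < l -> 0 < t < 1 ->
  measurable A ->
  cond_law a l t k A =
  (\int[leb]_u ((\1_A u : R) * gamma_pdf (a + k%:R) (l / (1 - t)) u)%:E)%E.
Proof.
move=> a0 l0 /andP[t0 t1] mA.
have p0 : 0 < 1 - t by rewrite subr_gt0.
have c0 : 0 < l / (1 - t) by rewrite divr_gt0.
have mI : measurable_fun setT (\1_A : R -> R) by exact: measurable_indic.
have mg := @measurable_gamma_pdf R.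
have scl w : gamma_pdf a l ((1 - t)^-1 * w) / (1 - t) = gamma_pdf a (l / (1 - t)) w.
  exact: scale_gamma_pdf.
case: k => [|k]; rewrite /cond_law.
  rewrite addr0 integral_Rpos_setT; last by move=> g g0; rewrite gamma_pdf_out ?mulr0.
  rewrite -[RHS](@ge0_integral_affine R 0 (1 - t))//; last 2 first.
  - by apply/measurable_EFinP; exact: measurable_funM.
  - by move=> y; rewrite lee_fin mulr_ge0// gamma_pdf_ge0.
  rewrite muleC -ge0_integralZl_real//; last 3 first.
  - have h : measurable_fun setT (fun x : R => (\1_A : R -> R) x * gamma_pdf a (l / (1 - t)) x).
      exact: measurable_funM.
    exact: (measurableT_comp h (measurable_affine 0 (1 - t))).
  - by move=> y _; rewrite mulr_ge0// gamma_pdf_ge0.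
  - exact: ltW.
  apply: eq_integral => y _; rewrite add0r -scl mulKf ?gt_eqF//; congr EFin.
  by field; rewrite gt_eqF.
set c := l / (1 - t) in c0 scl *; set c' := l * t / (1 - t).
have c'0 : 0 < c' by rewrite divr_gt0// mulr_gt0.
have k0 : 0 < k.+1%:R :> R by [].
rewrite integral_Rpos_setT; last first.
  by move=> g g0; apply: integral0_eq => y _; rewrite gamma_pdf_out ?mulr0 ?mul0r.
transitivity (\int[leb]_g \int[leb]_v
  ((\1_A v : R) * gamma_pdf a l g * gamma_pdf k.+1%:R c (v - (1 - t) * g))%:E)%E.
  apply: eq_integral => g _.
  rewrite integral_Rpos_setT; last first.
    by move=> y y0; rewrite (@gamma_pdf_out _ k.+1%:R) ?mulr0.
  rewrite -[RHS](@ge0_integral_affine R ((1 - t) * g) t)//; last 2 first.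
  - apply/measurable_EFinP; apply: measurable_funM; first exact: measurable_funM.
    apply: measurableT_comp => //; exact: measurable_funB.
  - by move=> y; rewrite lee_fin !mulr_ge0// gamma_pdf_ge0.
  rewrite muleC -ge0_integralZl_real//; last 3 first.
  - have h : measurable_fun setT (fun v : R => (\1_A : R -> R) v * gamma_pdf a l g *
        gamma_pdf k.+1%:R c (v - (1 - t) * g)).
      apply: measurable_funM; first exact: measurable_funM.
      by apply: measurableT_comp => //; exact: measurable_funB.
    exact: (measurableT_comp h (measurable_affine _ _)).
  - by move=> y _; rewrite !mulr_ge0// gamma_pdf_ge0.
  - exact: ltW.
  apply: eq_integral => y _; congr EFin.
  rewrite (addrC _ (t * y)) addrK.
  have -> : c = c' / t by rewrite /c /c'; field; rewrite !gt_eqF.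
  rewrite -(@scale_gamma_pdf R k.+1%:R c' t (t * y) k0 c'0 t0) mulKf ?gt_eqF//.
  by field; rewrite gt_eqF.
rewrite (@fubini_tonelli _ _ _ _ _ leb leb (fun gv => (\1_A gv.2 * gamma_pdf a l gv.1 *
   gamma_pdf k.+1%:R c (gv.2 - (1 - t) * gv.1))%:E))/=; last 2 first.
- apply/measurable_EFinP; apply: measurable_funM; first apply: measurable_funM.
  + by apply: (measurableT_comp mI); exact: measurable_snd.
  + by apply: (measurableT_comp (mg a l)); exact: measurable_fst.
  + apply: (measurableT_comp (mg k.+1%:R c)); apply: measurable_funB => //.
    by apply: measurable_funM => //.
- by move=> [g v]; rewrite lee_fin/= !mulr_ge0// gamma_pdf_ge0.
apply: eq_integral => v _.
have key : (\int[leb]_x (gamma_pdf a l x * gamma_pdf k.+1%:R c (v - (1 - t) * x))%:E =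
    (gamma_pdf (a + k.+1%:R) c v)%:E)%E.
  rewrite -(@gamma_pdf_conv a c k v a0 c0) -[RHS](@ge0_integral_affine R 0 (1 - t))//; last 2 first.
  - apply/measurable_EFinP; apply: measurable_funM => //.
    by apply: (measurableT_comp (mg k.+1%:R c)); exact: measurable_funB.
  - by move=> y; rewrite lee_fin !mulr_ge0// gamma_pdf_ge0.
  rewrite muleC -ge0_integralZl_real//; last 3 first.
  - have h : measurable_fun setT (fun w : R => gamma_pdf a c w *
        gamma_pdf k.+1%:R c (v - w)).
      apply: measurable_funM => //.
      by apply: (measurableT_comp (mg k.+1%:R c)); exact: measurable_funB.
    exact: (measurableT_comp h (measurable_affine _ _)).
  - by move=> y _; rewrite !mulr_ge0// gamma_pdf_ge0.
  - exact: ltW.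
  apply: eq_integral => y _; rewrite add0r -scl mulKf ?gt_eqF//; congr EFin.
  by field; rewrite gt_eqF.
transitivity ((\1_A v)%:E * \int[leb]_x (gamma_pdf a l x *
    gamma_pdf k.+1%:R c (v - (1 - t) * x))%:E)%E; last by rewrite key EFinM.
have h : measurable_fun setT (fun x : R => gamma_pdf a l x *
    gamma_pdf k.+1%:R c (v - (1 - t) * x)).
  apply: measurable_funM => //; apply: (measurableT_comp (mg k.+1%:R c)).
  by apply: measurable_funB => //; exact: measurable_funM.
apply: etrans; last first.
  apply: (@ge0_integralZl_real _ _ _ leb _ measurableT _ _ h) => //.
  by move=> y _; rewrite mulr_ge0// gamma_pdf_ge0.
by apply: eq_integral => y _; rewrite mulrA.
Qed.

End GammaConvolution.

(** * The hypergeometric kernel of the path *)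

Section Hypergeometric.
Variable R : realType.
Implicit Types (a x z : R) (n k : nat).

(* [hyp01 a z] is 0F1(; a; z), a modified Bessel function up to normalization. *)
Definition hyp01_coef a k : R := (k`!%:R * poch a k)^-1.

Definition hyp01 a z : R := limn (pseries (hyp01_coef a) z).

Lemma hyp01_coef_gt0 a k : 0 < a -> 0 < hyp01_coef a k.
Proof. by move=> a0; rewrite invr_gt0 mulr_gt0 ?ltr0n ?fact_gt0// poch_gt0. Qed.

(** The factors after the first are at least 1, so only the first can make the product small. The
    bound compares the 0F1 series with a multiple of the exponential series. *)
Lemma poch_ge a k : 0 < a -> Num.min 1 a <= poch a k.
Proof.
move=> a0; case: k => [|k]; first by rewrite poch0 ge_min lexx.
rewrite pochSl; apply: (@le_trans _ _ a); first by rewrite ge_min lexx orbT.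
rewrite ler_pMr//; elim: k => [|k IH]; first by rewrite poch0.
rewrite pochS; apply: le_trans IH _; rewrite ler_pMr ?poch_gt0 ?addr_gt0//.
by rewrite addrC addrA lerDr addr_ge0// ltW.
Qed.

Lemma is_cvg_hyp01 a z : 0 < a -> cvgn (pseries (hyp01_coef a) z).
Proof.
move=> a0; apply: normed_cvg; rewrite /normed_series_of/=.
have m0 : 0 < Num.min 1 a by rewrite lt_min ltr01.
apply: (@series_le_cvg _ _ (fun k => (Num.min 1 a)^-1 * exp_coeff `|z| k)).
- by move=> k.
- by move=> k; rewrite mulr_ge0 ?invr_ge0 ?(ltW m0)// /exp_coeff divr_ge0// exprn_ge0.
- move=> k; rewrite normrM normrX /exp_coeff [leRHS]mulrCA.
  rewrite [leLHS]mulrC ler_wpM2l ?exprn_ge0//.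
  rewrite gtr0_norm ?hyp01_coef_gt0// /hyp01_coef invfM mulrC ler_wpM2r ?invr_ge0//.
  by rewrite lef_pV2 ?posrE ?poch_gt0// poch_ge.
- have -> : (fun k => (Num.min 1 a)^-1 * exp_coeff `|z| k) =
      (Num.min 1 a)^-1 *: exp_coeff `|z| by [].
  by apply: is_cvg_seriesZ; exact: is_cvg_series_exp_coeff.
Qed.

Lemma cvg_hyp01 a z : 0 < a -> pseries (hyp01_coef a) z @ \oo --> hyp01 a z.
Proof. by move=> a0; exact: is_cvg_hyp01. Qed.

Lemma hyp01_diffs a : 0 < a ->
  pseries_diffs (hyp01_coef a) = a^-1 *: hyp01_coef (a + 1).
Proof.
move=> a0; apply/funext => k; rewrite /pseries_diffs/hyp01_coef.
rewrite pochSl factS natrM.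
change ((k.+1%:R / (k.+1%:R * k`!%:R * (a * poch (a + 1) k))) =
  a^-1 * (k`!%:R * poch (a + 1) k)^-1).
have p0 : 0 < poch (a + 1) k by rewrite poch_gt0// addr_gt0.
by field; rewrite !gt_eqF// ltr0n fact_gt0.
Qed.

Lemma pseriesZ c (f : nat -> R) z : pseries (c *: f) z = c *: pseries f z.
Proof.
apply/funext => n; transitivity (c * \sum_(0 <= k < n) f k * z ^+ k) => //.
by rewrite mulr_sumr; apply: eq_bigr => i _; exact/esym/mulrA.
Qed.

Lemma is_derive_hyp01 a z : 0 < a ->
  is_derive z 1 (hyp01 a) (hyp01 (a + 1) z / a).
Proof.
move=> a0; have a1 : 0 < a + 1 by rewrite addr_gt0.
have a2 : 0 < a + 1 + 1 by rewrite addr_gt0.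
have cZ c b y : 0 < b -> cvgn (pseries (c *: hyp01_coef b) y).
  by move=> b0; rewrite pseriesZ; apply: (cvgP (c * hyp01 b y)); apply: cvgMr; exact: cvg_hyp01.
have dZ c (f : nat -> R) : pseries_diffs (c *: f) = c *: pseries_diffs f.
  by apply/funext => k; rewrite /pseries_diffs; exact: mulrCA.
have -> : hyp01 (a + 1) z / a = limn (pseries (pseries_diffs (hyp01_coef a)) z).
  rewrite hyp01_diffs// pseriesZ; apply/esym/cvg_lim => //.
  by rewrite mulrC; apply: cvgMr; exact: cvg_hyp01.
apply: (@pseries_snd_diffs _ _ (`|z| + 1)).
- exact: is_cvg_hyp01.
- by rewrite hyp01_diffs//; exact: cZ.
- rewrite hyp01_diffs// dZ hyp01_diffs// scalerA; exact: cZ.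
- by rewrite [ltRHS]ger0_norm ?addr_ge0// ltrDl.
Qed.

Lemma continuous_hyp01 a : 0 < a -> continuous (hyp01 a).
Proof.
move=> a0 z; apply/differentiable_continuous/derivable1_diffP.
by have [] := is_derive_hyp01 z a0.
Qed.

Lemma measurable_hyp01 a : 0 < a -> measurable_fun setT (hyp01 a).
Proof. by move=> a0; apply: continuous_measurable_fun; exact: continuous_hyp01. Qed.

Lemma hyp01_coef_rec a n : 0 < a ->
  hyp01_coef a n.+1 =
  hyp01_coef (a + 1) n.+1 + hyp01_coef (a + 1 + 1) n / (a * (a + 1)).
Proof.
move=> a0; have a1 : 0 < a + 1 by rewrite addr_gt0.
have a2 : 0 < a + 1 + 1 by rewrite addr_gt0.
have an : 0 < a + 1 + n%:R by rewrite ltr_wpDr.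
have : poch (a + 1) n * (a + 1 + n%:R) = (a + 1) * poch (a + 1 + 1) n.
  by rewrite -pochS pochSl.
move/(canRL (mulfK (lt0r_neq0 an))) => pE.
have P0 : 0 < poch (a + 1 + 1) n by rewrite poch_gt0.
have F0 : 0 < (n`!%:R : R) by rewrite ltr0n fact_gt0.
rewrite /hyp01_coef !(pochSl _ n) pE factS natrM -(natr1 n).
have n0 : 0 < (n%:R + 1 : R) by rewrite natr1.
by field; rewrite !gt_eqF//.
Qed.

(** A contiguous relation. As differentiation raises the parameter, it is the Bessel-type equation z
    F'' + a F' = F for F = [hyp01 a]. *)
Lemma hyp01_ode a z : 0 < a ->
  hyp01 a z = hyp01 (a + 1) z + z * (hyp01 (a + 1 + 1) z / (a * (a + 1))).
Proof.
move=> a0; have a1 : 0 < a + 1 by rewrite addr_gt0.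
have a2 : 0 < a + 1 + 1 by rewrite addr_gt0.
(* Multiplication by z shifts the index, so n + 1 terms on the left match only n terms of the last
   series. *)
have S n : pseries (hyp01_coef a) z n.+1 = pseries (hyp01_coef (a + 1)) z n.+1 +
    z * (pseries (hyp01_coef (a + 1 + 1)) z n / (a * (a + 1))).
  rewrite /pseries /series/=; elim: n => [|n IH].
    rewrite !big_nat1 big_nil mul0r mulr0 addr0 !expr0 !mulr1.
    by rewrite /hyp01_coef !poch0.
  rewrite big_nat_recr//= IH [in RHS]big_nat_recr//= [X in _ = _ + z * (X / _)]big_nat_recr//=.
  rewrite hyp01_coef_rec// exprS; ring.
have h1 : (fun n => pseries (hyp01_coef a) z n.+1) @ \oo --> hyp01 a z.
  by rewrite (cvg_shiftS (pseries (hyp01_coef a) z)); exact: cvg_hyp01.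
have h2 : (fun n => pseries (hyp01_coef a) z n.+1) @ \oo -->
    hyp01 (a + 1) z + z * (hyp01 (a + 1 + 1) z / (a * (a + 1))).
  under eq_fun do rewrite S.
  apply: cvgD.
    by rewrite (cvg_shiftS (pseries (hyp01_coef (a + 1)) z)); exact: cvg_hyp01.
  by apply: cvgMr; apply: cvgMl; exact: cvg_hyp01.
exact: (cvg_unique _ h1 h2).
Qed.

Lemma hyp01_ge1 a z : 0 < a -> 0 <= z -> 1 <= hyp01 a z.
Proof.
move=> a0 z0; have := @nondecreasing_cvgn_le _ (pseries (hyp01_coef a) z) _ (@is_cvg_hyp01 _ z a0) 1.
rewrite /pseries/series/= big_nat1 expr0 mulr1 /hyp01_coef poch0 fact0 mulr1 invr1; apply.
apply/nondecreasing_seqP => n; rewrite big_nat_recr//= lerDl.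
by rewrite mulr_ge0 ?exprn_ge0// ltW// hyp01_coef_gt0.
Qed.

Lemma hyp01_ge0 a z : 0 < a -> 0 <= z -> 0 <= hyp01 a z.
Proof. by move=> a0 z0; rewrite (le_trans _ (hyp01_ge1 a0 z0)). Qed.

(** The induction step compares (2k + 2)(2k + 1) with 4 (k + 1)(a + k), that is 2k + 1 with 2a + 2k;
    this is the point where 1/2 <= a enters. *)
Lemma fact_double_le a k : 1 / 2 <= a -> (k.*2)`!%:R <= k`!%:R * poch a k * 4 ^+ k.
Proof.
move=> a12; have a0 : 0 < a by rewrite (lt_le_trans _ a12).
elim: k => [|k IH]; first by rewrite poch0 fact0 !mulr1.
rewrite doubleS !factS pochS exprSr !natrM.
have -> : k.*2.+2%:R = 2 * (k%:R + 1) :> R by rewrite -!natr1 -muln2 natrM; ring.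
have -> : k.*2.+1%:R = 2 * k%:R + 1 :> R by rewrite -!natr1 -muln2 natrM; ring.
have -> : k.+1%:R = k%:R + 1 :> R by rewrite natr1.
have -> : (k%:R + 1) * k`!%:R * (poch a k * (a + k%:R)) * (4 ^+ k * 4) =
   (2 * (k%:R + 1) * (2 * (a + k%:R))) * (k`!%:R * poch a k * 4 ^+ k) by ring.
rewrite mulrA ler_pM// ?mulr_ge0// ?addr_ge0// ?mulr_ge0//.
rewrite ler_wpM2l ?mulr_ge0// ?addr_ge0//; lra.
Qed.

(** By [fact_double_le] the k-th term is at most the term of degree 2k of the exponential series at
    2 sqrt z; the odd terms are given away. *)
Lemma hyp01_le_expR a z : 1 / 2 <= a -> 0 <= z -> hyp01 a z <= expR (2 * Num.sqrt z).
Proof.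
move=> a12 z0; have a0 : 0 < a by rewrite (lt_le_trans _ a12).
set y := 2 * Num.sqrt z; have y0 : 0 <= y by rewrite mulr_ge0 ?sqrtr_ge0.
apply: limr_le; first exact: is_cvg_hyp01.
apply: nearW => n.
have nd : nondecreasing_seq (series (exp_coeff y)).
  by apply/nondecreasing_seqP => m; rewrite /series/= big_nat_recr//= lerDl exp_coeff_ge0.
apply: (@le_trans _ _ (series (exp_coeff y) n.*2)); last first.
  exact: (nondecreasing_cvgn_le nd (is_cvg_series_exp_coeff y)).
rewrite /pseries/series/=; elim: n => [|n IH]; first by rewrite !big_nil.
rewrite doubleS !big_nat_recr//=.
rewrite -addrA lerD//.
apply: (@le_trans _ _ (exp_coeff y n.*2)); last by rewrite lerDl exp_coeff_ge0.
have y2 : y ^+ 2 = 4 * z by rewrite /y exprMn sqr_sqrtr//; ring.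
rewrite /exp_coeff/= -[X in y ^+ X]muln2 mulnC exprM y2 exprMn.
rewrite [leRHS]mulrAC ler_wpM2r ?exprn_ge0// /hyp01_coef.
rewrite -[leLHS]mul1r ler_pdivrMr ?mulr_gt0 ?ltr0n ?fact_gt0 ?poch_gt0//.
rewrite mulrAC ler_pdivlMr ?ltr0n ?fact_gt0// mul1r mulrC.
exact: fact_double_le.
Qed.

End Hypergeometric.

Section PoissonMoments.
Variable R : realType.
Implicit Types (m : R) (k n : nat).

Lemma pois_ge0 m k : 0 <= m -> 0 <= pois m k.
Proof. by move=> m0; rewrite /pois !mulr_ge0 ?expR_ge0 ?exprn_ge0 ?invr_ge0. Qed.

(** The source of all factorial moments of the Poisson law: a factor k lowers the index and releases
    one mean. *)
Lemma poisS m k : k.+1%:R * pois m k.+1 = m * pois m k.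
Proof.
rewrite /pois factS natrM exprS.
have K0 : (k.+1%:R : R) != 0 by [].
have F0 : (k`!%:R : R) != 0 by rewrite pnatr_eq0 -lt0n fact_gt0.
by move: (k.+1%:R : R) (k`!%:R : R) K0 F0 => K F K0 F0; field; rewrite ?K0 ?F0.
Qed.

Lemma cvg_pois m : series (pois m) @ \oo --> (1 : R).
Proof.
have -> : (1:R) = expR (- m) * expR m by rewrite -expRD addNr expR0.
have -> : series (pois m) = (fun n => expR (- m) * series (exp_coeff m) n).
  apply/funext => n; rewrite /series/= mulr_sumr; apply: eq_bigr => k _.
  by rewrite /pois /exp_coeff mulrA.
by apply: cvgMr; exact: is_cvg_series_exp_coeff.
Qed.

Lemma cvg_pois1 m : series (fun k => k%:R * pois m k) @ \oo --> m.
Proof.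
rewrite -(cvg_shiftS (series _)).
have -> : (fun n => series (fun k => k%:R * pois m k) n.+1) = (fun n => m * series (pois m) n).
  apply/funext => n; rewrite /series/= big_nat_recl//= mul0r add0r mulr_sumr.
  by apply: eq_bigr => k _; exact: poisS.
have : (fun n => m * series (pois m) n) @ \oo --> m * 1.
  by apply: cvgMr; exact: cvg_pois.
by rewrite mulr1.
Qed.

Lemma cvg_pois2 m : series (fun k => k%:R * (k%:R - 1) * pois m k) @ \oo --> m ^+ 2.
Proof.
rewrite -(cvg_shiftS (series _)).
have -> : (fun n => series (fun k => k%:R * (k%:R - 1) * pois m k) n.+1) =
   (fun n => m * series (fun k => k%:R * pois m k) n).
  apply/funext => n; rewrite /series/= big_nat_recl//= !mul0r add0r mulr_sumr.
  apply: eq_bigr => k _; rewrite -(natr1 k) addrK natr1 mulrAC poisS.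
  by rewrite mulrAC mulrA.
by apply: cvgMr; exact: cvg_pois1.
Qed.

Lemma nneseries_cvg (f : nat -> R) (s : R) : series f @ \oo --> s ->
  (\sum_(0 <= k <oo) (f k)%:E = s%:E)%E.
Proof.
move=> fs; apply/cvg_lim => //.
under eq_fun do rewrite sumEFin.
exact/cvg_EFin/fs/nearW.
Qed.

End PoissonMoments.

(** * The transition kernel as a Poisson mixture, with its mass and first two moments *)

Section Kernel.
Variable R : realType.
Local Notation leb := (@lebesgue_measure R).
Variables (a l : R).
Hypotheses (a0 : 0 < a) (l0 : 0 < l).
Implicit Types (t x u : R) (k : nat).

(** [theta t * x] is the Poisson mean given X = x and [rate t] the common rate of both summands of
    X_t. Their product [bcoef t = rate t * theta t] is the coefficient of x u in the argument of
    0F1. *)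
Definition theta t : R := l * t / (1 - t).
Definition bcoef t : R := l ^+ 2 * t / (1 - t) ^+ 2.
Definition rate t : R := l / (1 - t).

(* Density at [u] of X_t given X = x, relative to the gamma law. *)
Definition ker t x u : R :=
  (1 - t) `^ (- a) * expR (- (theta t * (x + u))) * hyp01 a (bcoef t * (x * u)).

Lemma theta_gt0 t : 0 < t < 1 -> 0 < theta t.
Proof. by move=> /andP[t0 t1]; rewrite divr_gt0 ?mulr_gt0// subr_gt0. Qed.

Lemma bcoef_gt0 t : 0 < t < 1 -> 0 < bcoef t.
Proof.
by move=> /andP[t0 t1]; rewrite divr_gt0 ?mulr_gt0 ?exprn_gt0// subr_gt0.
Qed.

Lemma rate_gt0 t : 0 < t < 1 -> 0 < rate t.
Proof. by move=> /andP[t0 t1]; rewrite divr_gt0// subr_gt0. Qed.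

Lemma bcoefE t : 0 < t < 1 -> bcoef t = rate t * theta t.
Proof.
move=> /andP[t0 t1]; rewrite /bcoef/rate/theta; field.
by rewrite gt_eqF// subr_gt0.
Qed.

Lemma rateE t : 0 < t < 1 -> rate t = l + theta t.
Proof.
move=> /andP[t0 t1]; rewrite /rate/theta; field.
by rewrite gt_eqF// subr_gt0.
Qed.

Lemma kerC t x u : ker t x u = ker t u x.
Proof. by rewrite /ker (addrC x) (mulrC x). Qed.

Lemma ker_gt0 t x u : 0 < t < 1 -> 0 <= x -> 0 <= u -> 0 < ker t x u.
Proof.
move=> t01 x0 u0; rewrite !mulr_gt0 ?expR_gt0 ?powR_gt0//.
  by case/andP: t01 => _ t1; rewrite subr_gt0.
rewrite (lt_le_trans _ (hyp01_ge1 a0 _))//.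
by rewrite (mulr_ge0 (ltW (bcoef_gt0 t01)))// mulr_ge0.
Qed.

(** Origin of the symmetry: the k-th powers of x from the Poisson weight and of u from the gamma
    density pair up as (x u)^k, while [rate t = l + theta t] splits exp(-rate u) into the reference
    factor exp(-l u) and exp(-theta u), the partner of exp(-theta x). The quotient of Gamma values
    leaves the Pochhammer symbol of the 0F1 coefficient. *)
Lemma pois_gamma_pdf t x u k : 0 < t < 1 -> 0 <= x -> 0 < u ->
  pois (l * t * x / (1 - t)) k * gamma_pdf (a + k%:R) (rate t) u =
  gamma_pdf a l u * ((1 - t) `^ (- a) * expR (- (theta t * (x + u)))) *
    (hyp01_coef a k * (bcoef t * (x * u)) ^+ k).
Proof.
move=> t01 x0 u0; have Ga := GammaR_gt0 a0.
have r0 := rate_gt0 t01.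
rewrite /pois /gamma_pdf u0 GammaR_poch// bcoefE//.
have -> : l * t * x / (1 - t) = theta t * x by rewrite /theta mulrAC.
have -> : rate t `^ (a + k%:R) = l `^ a * (1 - t) `^ (- a) * rate t ^+ k.
  rewrite powRD ?(gt_eqF r0) ?implybT// powR_mulrn ?ltW//; congr (_ * _).
  rewrite /rate powRM ?(ltW l0)//; last by rewrite invr_ge0 subr_ge0; case/andP: t01 => _ /ltW.
  congr (_ * _); rewrite powRN -powR_inv1; last by rewrite subr_ge0; case/andP: t01 => _ /ltW.
  by rewrite -powRrM mulN1r powRN.
have -> : u `^ (a + k%:R - 1) = u `^ (a - 1) * u ^+ k.
  have -> : a + k%:R - 1 = (a - 1) + k%:R by rewrite addrAC.
  rewrite (@powRD _ _ (a - 1)) ?powR_mulrn ?(ltW u0)//.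
  by rewrite (gt_eqF u0) implybT.
have -> : expR (- (theta t * (x + u))) =
   expR (- (theta t * x)) * expR (- (theta t * u)) by rewrite -expRD; congr expR; ring.
have -> : expR (- (rate t * u)) = expR (- (l * u)) * expR (- (theta t * u)).
  by rewrite -expRD rateE//; congr expR; ring.
rewrite /hyp01_coef !exprMn.
by field; rewrite !gt_eqF ?poch_gt0 ?ltr0n ?fact_gt0.
Qed.

Lemma nneseries_pois_gamma_pdf t x u : 0 < t < 1 -> 0 <= x ->
  (\sum_(0 <= k <oo) (pois (l * t * x / (1 - t)) k *
      gamma_pdf (a + k%:R) (rate t) u)%:E = (gamma_pdf a l u * ker t x u)%:E)%E.
Proof.
move=> t01 x0; have [u0|u0] := ltP 0 u; last first.
  have u0' : ~ 0 < u by apply/negP; rewrite -leNgt.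
  rewrite eseries0 ?gamma_pdf_out ?mul0r// => k _ _.
  by rewrite gamma_pdf_out ?mulr0.
apply: nneseries_cvg.
set C := gamma_pdf a l u * ((1 - t) `^ (- a) * expR (- (theta t * (x + u)))).
have -> : gamma_pdf a l u * ker t x u = C * hyp01 a (bcoef t * (x * u)).
  by rewrite /C/ker; ring.
have -> : series (fun k => pois (l * t * x / (1 - t)) k * gamma_pdf (a + k%:R) (rate t) u) =
   (fun n => C * pseries (hyp01_coef a) (bcoef t * (x * u)) n).
  apply/funext => n; rewrite /pseries/series/= mulr_sumr.
  by apply: eq_bigr => k _; exact: pois_gamma_pdf.
by apply: cvgMr; exact: cvg_hyp01.
Qed.

(** Reduces integrals against the kernel to gamma integrals and Poisson sums; nonnegativity of [g]
    licenses the exchange of sum and integral. *)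
Lemma integral_ker_mixture t x (g : R -> R) : 0 < t < 1 -> 0 <= x ->
  measurable_fun setT g -> (forall u, 0 <= g u) ->
  (\int[leb]_u (g u * (gamma_pdf a l u * ker t x u))%:E =
   \sum_(0 <= k <oo) ((pois (l * t * x / (1 - t)) k)%:E *
     \int[leb]_u (g u * gamma_pdf (a + k%:R) (rate t) u)%:E))%E.
Proof.
move=> t01 x0 mg g0.
have m0 : 0 <= l * t * x / (1 - t).
  case/andP: t01 => t0 t1.
  by rewrite !mulr_ge0// ?invr_ge0 ?subr_ge0 ltW.
have ak k : 0 < a + k%:R by rewrite ltr_wpDr.
have mgk k : measurable_fun setT (fun u => g u * gamma_pdf (a + k%:R) (rate t) u).
  by apply: measurable_funM => //; exact: measurable_gamma_pdf.
transitivity (\int[leb]_u (\sum_(0 <= k <oo) (pois (l * t * x / (1 - t)) k *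
   (g u * gamma_pdf (a + k%:R) (rate t) u))%:E))%E.
  apply: eq_integral => u _; rewrite EFinM -nneseries_pois_gamma_pdf//.
  rewrite -nneseriesZl; last first.
    by move=> k _; rewrite lee_fin mulr_ge0 ?pois_ge0 ?gamma_pdf_ge0.
  by apply: eq_eseriesr => k _; rewrite -EFinM mulrCA.
rewrite integral_nneseries//.
- apply: eq_eseriesr => k _; rewrite ge0_integralZl_real//.
  + exact: mgk.
  + by move=> u _; rewrite mulr_ge0// gamma_pdf_ge0.
  + exact: pois_ge0.
- move=> k; have h : measurable_fun setT (fun u => pois (l * t * x / (1 - t)) k * (g u * gamma_pdf (a + k%:R) (rate t) u)).
    exact: measurable_funM.
  exact/measurable_EFinP.
- move=> k u _; rewrite lee_fin (mulr_ge0 (pois_ge0 _ m0))//.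
  by rewrite mulr_ge0// gamma_pdf_ge0.
Qed.

Lemma integral_gamma_pdfT b c : 0 < b -> 0 < c ->
  (\int[leb]_u (gamma_pdf b c u)%:E = 1)%E.
Proof.
move=> b0 c0; rewrite -integral_Rpos_setT ?integral_gamma_pdf//.
by move=> u u0; rewrite gamma_pdf_out.
Qed.

(** The absolute value makes the integrand suitable for [integral_ker_mixture], which asks for
    nonnegativity on the whole line; the density vanishes where it matters. *)
Lemma integral_id_gamma_pdf b c : 0 < b -> 0 < c ->
  (\int[leb]_u (`|u| * gamma_pdf b c u)%:E = (b / c)%:E)%E.
Proof.
move=> b0 c0.
transitivity (\int[leb]_u (b / c * gamma_pdf (b + 1) c u)%:E)%E.
  apply: eq_integral => u _; rewrite -mul_gamma_pdf//.
  have [u0|u0] := ltP 0 u; first by rewrite gtr0_norm.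
  by rewrite gamma_pdf_out ?mulr0//; apply/negP; rewrite -leNgt.
rewrite ge0_integralZl_real//.
- by rewrite integral_gamma_pdfT ?mule1// addr_gt0.
- exact: measurable_gamma_pdf.
- by move=> u _; rewrite gamma_pdf_ge0// addr_gt0.
- by rewrite divr_ge0// ltW.
Qed.

Lemma integral_sqr_gamma_pdf b c : 0 < b -> 0 < c ->
  (\int[leb]_u (u ^+ 2 * gamma_pdf b c u)%:E = (b * (b + 1) / c ^+ 2)%:E)%E.
Proof.
move=> b0 c0; have b1 : 0 < b + 1 by rewrite addr_gt0.
transitivity (\int[leb]_u (b / c * ((b + 1) / c) * gamma_pdf (b + 1 + 1) c u)%:E)%E.
  apply: eq_integral => u _; rewrite -[in RHS]mulrA -mul_gamma_pdf// mulrCA.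
  by rewrite -mul_gamma_pdf// mulrA.
rewrite ge0_integralZl_real//.
- rewrite integral_gamma_pdfT ?mule1 ?addr_gt0//; congr EFin.
  by field; rewrite gt_eqF.
- exact: measurable_gamma_pdf.
- by move=> u _; rewrite gamma_pdf_ge0// addr_gt0.
- by rewrite mulr_ge0// divr_ge0// ltW.
Qed.

Lemma integral_ker t x : 0 < t < 1 -> 0 <= x ->
  (\int[leb]_u (gamma_pdf a l u * ker t x u)%:E = 1)%E.
Proof.
move=> t01 x0.
transitivity (\int[leb]_u (1 * (gamma_pdf a l u * ker t x u))%:E)%E.
  by apply: eq_integral => u _; rewrite mul1r.
rewrite (@integral_ker_mixture t x (fun=> 1))//.
rewrite -[RHS](nneseries_cvg (@cvg_pois R (l * t * x / (1 - t)))).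
apply: eq_eseriesr => k _.
have -> : (\int[leb]_u (1 * gamma_pdf (a + k%:R) (rate t) u)%:E = 1)%E.
  rewrite -(@integral_gamma_pdfT (a + k%:R) (rate t)) ?rate_gt0 ?ltr_wpDr//.
  by apply: eq_integral => u _; rewrite mul1r.
by rewrite mule1.
Qed.

Lemma integral_ker_id t x : 0 < t < 1 -> 0 <= x ->
  (\int[leb]_u (`|u| * (gamma_pdf a l u * ker t x u))%:E =
   ((1 - t) * (a / l) + t * x)%:E)%E.
Proof.
move=> t01 x0; have r0 := rate_gt0 t01.
rewrite (@integral_ker_mixture t x (fun u => `|u|))//.
pose m := l * t * x / (1 - t).
have t1 : 0 < 1 - t by case/andP: t01 => _ t1; rewrite subr_gt0.
have -> : (1 - t) * (a / l) + t * x = (a * 1 + m) / rate t.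
  rewrite /m /rate; field; rewrite !gt_eqF//.
apply: etrans; last first.
  apply: (@nneseries_cvg _ (fun k => (a * pois m k + k%:R * pois m k) / rate t)).
  have -> : series (fun k => (a * pois m k + k%:R * pois m k) / rate t) =
     (fun n => (a * series (pois m) n + series (fun k => k%:R * pois m k) n) / rate t).
    apply/funext => n; rewrite /series/= mulr_sumr -big_split/= mulr_suml.
    by apply: eq_bigr.
  apply: cvgMl; apply: cvgD; last exact: cvg_pois1.
  by apply: cvgMr; exact: cvg_pois.
apply: eq_eseriesr => k _; rewrite integral_id_gamma_pdf ?ltr_wpDr//.
by rewrite -EFinM; congr EFin; rewrite /m; ring.
Qed.

Lemma integral_ker_sqr t x : 0 < t < 1 -> 0 <= x ->
  (\int[leb]_u (u ^+ 2 * (gamma_pdf a l u * ker t x u))%:E =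
   ((a * (a + 1) + 2 * (a + 1) * (theta t * x) + (theta t * x) ^+ 2) / rate t ^+ 2)%:E)%E.
Proof.
move=> t01 x0; have r0 := rate_gt0 t01.
rewrite (@integral_ker_mixture t x (fun u => u ^+ 2))//; last first.
  by move=> u; exact: sqr_ge0.
pose m := l * t * x / (1 - t).
have -> : theta t * x = m by rewrite /theta /m mulrAC.
apply: etrans; last first.
  (* The second moment of shape a + k has numerator (a + k)(a + k + 1) = a (a + 1) + 2 (a + 1) k + k
     (k - 1), expanded here in factorial powers of k, whose Poisson sums are known. *)
  apply: (@nneseries_cvg _ (fun k => (a * (a + 1) * pois m k +
    2 * (a + 1) * (k%:R * pois m k) + k%:R * (k%:R - 1) * pois m k) / rate t ^+ 2)).
  have -> : series (fun k => (a * (a + 1) * pois m k +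
    2 * (a + 1) * (k%:R * pois m k) + k%:R * (k%:R - 1) * pois m k) / rate t ^+ 2) =
     (fun n => (a * (a + 1) * series (pois m) n + 2 * (a + 1) *
      series (fun k => k%:R * pois m k) n + series (fun k => k%:R * (k%:R - 1) * pois m k) n) / rate t ^+ 2).
    apply/funext => n; rewrite /series/= !mulr_sumr -!big_split/= mulr_suml.
    by apply: eq_bigr.
  apply: cvgMl; apply: cvgD; last exact: cvg_pois2.
  apply: cvgD; last by apply: cvgMr; exact: cvg_pois1.
  rewrite -[X in _ --> X]mulr1; apply: cvgMr; exact: cvg_pois.
apply: eq_eseriesr => k _; rewrite integral_sqr_gamma_pdf ?ltr_wpDr//.
by rewrite -EFinM; congr EFin; rewrite /m; ring.
Qed.

End Kernel.

(** * Differentiation and continuity under an integral with bounded integrands *)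

Section UnderIntegral.
Context d (Y : measurableType d) (R : realType).
Variables (P : probability Y R) (D : set Y).
Hypothesis mD : measurable D.
Implicit Types (f : R -> Y -> R).

Lemma bounded_integrable (g : Y -> R) (C : R) : measurable_fun D g ->
  (forall y, D y -> `|g y| <= C) -> P.-integrable D (EFin \o g).
Proof.
move=> mg gC; apply: (@le_integrable _ _ _ P D mD _ (EFin \o cst C)).
- exact/measurable_EFinP.
- move=> y Dy /=; rewrite lee_fin; apply: le_trans (gC _ Dy) _.
  by rewrite ler_norm.
- exact: finite_measure_integrable_cst.
Qed.

Lemma is_derive_under_integral f f' (a u v C : R) : u < a < v ->
  (forall x, u < x < v -> measurable_fun D (f x)) ->
  (forall x y, u < x < v -> D y -> `|f x y| <= C) ->
  (forall x y, u < x < v -> D y -> is_derive x 1 (f ^~ y) (f' x y)) ->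
  (forall x y, u < x < v -> D y -> `|f' x y| <= C) ->
  is_derive a 1 (fun x => \int[P]_(y in D) f x y) (\int[P]_(y in D) f' a y).
Proof.
move=> uav mf fC df f'C.
have Ia : `]u, v[%classic a by rewrite /= in_itv.
have C0 : D !=set0 -> 0 <= C by move=> [y Dy]; apply: le_trans (fC _ _ uav Dy).
have itf x : `]u, v[%classic x -> P.-integrable D (EFin \o f x).
  by rewrite /= in_itv/= => xI; apply: (@bounded_integrable _ C); [exact: mf|move=> y; exact: fC].
have dvf x y : `]u, v[%classic x -> D y -> derivable (f ^~ y) x 1.
  by rewrite /= in_itv/= => xI Dy; have [] := df _ _ xI Dy.
have d1E x y : u < x < v -> D y -> derive1 (f ^~ y) x = f' x y.
  by move=> xI Dy; have h := df _ _ xI Dy; rewrite derive1E derive_val.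
(* The dominating function must be nonnegative, and [C] itself can be negative when [D] is empty. *)
have ub x y : `]u, v[%classic x -> D y -> `|derive1 (f ^~ y) x| <= `|C|.
  rewrite /= in_itv/= => xI Dy; rewrite d1E//; apply: le_trans (f'C _ _ xI Dy) _.
  exact: ler_norm.
have iC : P.-integrable D (EFin \o cst `|C|) by exact: finite_measure_integrable_cst.
have h1 := derivable_under_integral mD Ia itf dvf (fun=> normr_ge0 C) iC ub.
have h2 := differentiation_under_integral mD Ia itf dvf (fun=> normr_ge0 C) iC ub.
apply: DeriveDef; first exact: h1.
rewrite -derive1E h2; apply: eq_Rintegral => y /set_mem Dy.
exact: d1E.
Qed.

Lemma continuous_under_integral_bounded f (a u v C : R) : u < a < v ->
  (forall x, u < x < v -> measurable_fun D (f x)) ->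
  (forall x y, u < x < v -> D y -> `|f x y| <= C) ->
  (forall x y, u < x < v -> D y -> {for x, continuous (f ^~ y)}) ->
  {for a, continuous (fun x => \int[P]_(y in D) f x y)}.
Proof.
move=> uav mf fC cf.
have itf x : `]u, v[%classic x -> P.-integrable D (EFin \o f x).
  by rewrite /= in_itv/= => xI; apply: (@bounded_integrable _ C); [exact: mf|move=> y; exact: fC].
apply: (@continuity_under_integral _ _ _ P f D mD u v itf _ (cst C)).
- apply: aeW => y Dy x /set_mem/=; rewrite in_itv/= => xI; exact: cf.
- exact: finite_measure_integrable_cst.
- by move=> x /=; rewrite in_itv/= => xI; apply: aeW => y; exact: fC.
- by apply/mem_set => /=; rewrite in_itv.
Qed.

End UnderIntegral.

Section KernelCalculus.
Variable R : realType.
Variables (l : R).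
Hypotheses (l0 : 0 < l).
Local Notation theta := (theta l).
Local Notation bcoef := (bcoef l).
Implicit Types (c t x u n : R) (i : nat).

(* Up to a factor free of [x], these functions span the derivatives of [ker]:
   differentiating 0F1 raises its parameter [c] and brings out a power of [x]. *)
Definition Kf i c t x u : R :=
  x ^+ i * expR (- (theta t * x)) * hyp01 c (bcoef t * (x * u)).

Lemma Kf_ge0 i c t x u : 0 < c -> 0 < t < 1 -> 0 <= x -> 0 <= u -> 0 <= Kf i c t x u.
Proof.
move=> c0 t01 x0 u0; rewrite mulr_ge0 ?mulr_ge0 ?expR_ge0 ?exprn_ge0//.
by rewrite hyp01_ge0// (mulr_ge0 (ltW (bcoef_gt0 l0 t01)))// mulr_ge0.
Qed.

Lemma theta_le t1 t2 : t1 <= t2 -> t2 < 1 -> theta t1 <= theta t2.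
Proof.
move=> t12 t21; have t11 : t1 < 1 by exact: le_lt_trans t12 t21.
rewrite /theta ler_pdivrMr ?subr_gt0// mulrAC ler_pdivlMr ?subr_gt0//.
by rewrite -!mulrA ler_wpM2l ?(ltW l0)//; nra.
Qed.

Lemma bcoef_le t1 t2 : 0 <= t1 -> t1 <= t2 -> t2 < 1 -> bcoef t1 <= bcoef t2.
Proof.
move=> t10 t12 t21; have t11 : t1 < 1 by exact: le_lt_trans t12 t21.
rewrite /bcoef; apply: ler_pM.
- by rewrite mulr_ge0// sqr_ge0.
- by rewrite invr_ge0 sqr_ge0.
- by rewrite ler_wpM2l// sqr_ge0.
- rewrite lef_pV2 ?posrE ?exprn_gt0 ?subr_gt0//.
  by rewrite lerXn2r ?nnegrE ?subr_ge0 ?(ltW t21) ?(ltW t11)// lerD2l lerN2.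
Qed.

Definition Kbound i t1 t2 n : R :=
  i`!%:R * (2 / theta t1) ^+ i * expR (2 * bcoef t2 * n / theta t1).

(** The decay exp(-theta t1 x) is spent in two halves. By the arithmetic-geometric mean inequality
    one half absorbs 2 sqrt(bcoef x u), up to a constant linear in u; the other absorbs x^i through
    one term of the exponential series. The bound is uniform in x and so dominates under any law of
    X. *)
Lemma Kf_le i c t1 t2 n t x u : 1 / 2 <= c -> 0 < t1 -> t2 < 1 -> t1 <= t <= t2 ->
  0 <= x -> 0 <= u <= n -> Kf i c t x u <= Kbound i t1 t2 n.
Proof.
move=> c12 t10 t21 /andP[t1t tt2] x0 /andP[u0 un].
have c0 : 0 < c by rewrite (lt_le_trans _ c12).
have t01 : 0 < t < 1 by rewrite (lt_le_trans t10 t1t) (le_lt_trans tt2 t21).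
have t101 : 0 < t1 < 1 by rewrite t10 (le_lt_trans t1t)//; case/andP: t01.
have th1 := theta_gt0 l0 t101; have b0 := bcoef_gt0 l0 t01.
have thl := theta_le t1t (andP t01).2.
have bl := bcoef_le (ltW (andP t01).1) tt2 t21.
have z0 : 0 <= bcoef t * (x * u) by rewrite (mulr_ge0 (ltW b0))// mulr_ge0.
set y := theta t1 * x / 2.
have y0 : 0 <= y by rewrite divr_ge0// (mulr_ge0 (ltW th1)).
have b2n : 0 <= 2 * bcoef t2 * n / theta t1.
  apply: divr_ge0; last exact: ltW.
  apply: mulr_ge0; last exact: le_trans un.
  by apply: mulr_ge0 => //; exact: le_trans (ltW b0) bl.
have hz : 2 * Num.sqrt (bcoef t * (x * u)) <= y + 2 * bcoef t2 * n / theta t1.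
  apply: (@le_trans _ _ (y + 2 * bcoef t * u / theta t1)); last first.
    have h : bcoef t * u <= bcoef t2 * n by apply: ler_pM => //; exact: ltW.
    rewrite lerD2l ler_wpM2r ?invr_ge0 ?(ltW th1)//.
    by rewrite -(mulrA 2 (bcoef t)) -(mulrA 2 (bcoef t2)) ler_wpM2l.
  set w := 2 * bcoef t * u / theta t1.
  have w0 : 0 <= w.
    apply: divr_ge0; last exact: ltW.
    by apply: mulr_ge0 => //; apply: mulr_ge0 => //; exact: ltW.
  have -> : bcoef t * (x * u) = y * w.
    by rewrite /y /w; field; rewrite gt_eqF.
  rewrite sqrtrM//.
  have := sqr_ge0 (Num.sqrt y - Num.sqrt w); rewrite sqrrB !sqr_sqrtr//.
  lra.
apply: (@le_trans _ _ (x ^+ i * expR (- (theta t * x)) *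
    expR (y + 2 * bcoef t2 * n / theta t1))).
  rewrite ler_wpM2l ?mulr_ge0 ?exprn_ge0 ?expR_ge0//.
  by apply: le_trans (hyp01_le_expR c12 z0) _; rewrite ler_expR.
rewrite expRD mulrA /Kbound ler_wpM2r ?expR_ge0//.
rewrite -mulrA -expRD.
apply: (@le_trans _ _ (x ^+ i * expR (- y))).
  rewrite ler_wpM2l ?exprn_ge0// ler_expR.
  have : theta t1 * x <= theta t * x by rewrite ler_wpM2r.
  by rewrite /y; lra.
have yi : y ^+ i / i`!%:R <= expR y.
  case: i => [|i]; first by rewrite expr0 fact0 divr1 -expR0 ler_expR.
  by apply: le_trans (expR_ge1Dxn i y0); rewrite lerDr.
have -> : x = 2 / theta t1 * y by rewrite /y; field; rewrite gt_eqF.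
have q0 : 0 <= 2 / theta t1 by apply: divr_ge0 => //; exact: ltW.
rewrite exprMn -mulrA [leRHS]mulrC ler_wpM2l ?exprn_ge0//.
rewrite expRN ler_pdivrMr ?expR_gt0// mulrC.
by rewrite -ler_pdivrMr// ?ltr0n ?fact_gt0.
Qed.

Lemma Kbound_ge0 i t1 t2 n : 0 < t1 < 1 -> 0 <= Kbound i t1 t2 n.
Proof.
move=> t101; rewrite /Kbound mulr_ge0 ?expR_ge0// mulr_ge0// exprn_ge0//.
by rewrite divr_ge0// ltW// theta_gt0.
Qed.

Lemma is_derive_Kf_u i c t x u : 0 < c ->
  is_derive u 1 (Kf i c t x) (bcoef t / c * Kf i.+1 (c + 1) t x u).
Proof.
move=> c0.
have h1 : is_derive u 1 (fun u : R => bcoef t * (x * u)) (bcoef t * x).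
  by apply: is_derive_eq; rewrite /GRing.scale/=; ring.
have h2 := @is_derive_hyp01 R c (bcoef t * (x * u)) c0.
have h3 := @is_derive1_comp R (hyp01 c) (fun u => bcoef t * (x * u)) u _ _ h2 h1.
have h4 := @is_deriveZ _ _ _ (hyp01 c \o (fun u : R => bcoef t * (x * u))) (x ^+ i * expR (- (theta t * x))) _ _ _ h3.
apply: (is_derive_eq h4); rewrite /Kf /GRing.scale/= exprS.
by field; rewrite gt_eqF.
Qed.

Lemma is_derive_theta t : t < 1 -> is_derive t 1 theta (l / (1 - t) ^+ 2).
Proof.
move=> t1; have t10 : 1 - t != 0 by rewrite gt_eqF// subr_gt0.
have h1 : is_derive t 1 (fun t : R => 1 - t) (-1).
  by apply: is_derive_eq; rewrite add0r mul1r.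
have h2 := @is_deriveV R (fun t : R => 1 - t) t _ 1 t10 h1.
have h3 : is_derive t 1 (fun t : R => l * t) l.
  by apply: is_derive_eq; rewrite /GRing.scale/= mulr1.
have h4 := is_deriveM h3 h2.
apply: (is_derive_eq h4); rewrite /GRing.scale/=.
by field.
Qed.

Lemma is_derive_bcoef t : t < 1 ->
  is_derive t 1 bcoef (l ^+ 2 * (1 + t) / (1 - t) ^+ 3).
Proof.
move=> t1; have t10 : 1 - t != 0 by rewrite gt_eqF// subr_gt0.
have h1 : is_derive t 1 (fun t : R => 1 - t) (-1).
  by apply: is_derive_eq; rewrite add0r mul1r.
have h1' := is_deriveX 2 h1.
have t12 : ((fun t : R => 1 - t) ^+ 2) t != 0 by rewrite exprfctE expf_neq0.
have h2 := is_deriveV t12 h1'.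
have h3 : is_derive t 1 (fun t : R => l ^+ 2 * t) (l ^+ 2).
  by apply: is_derive_eq; rewrite /GRing.scale/= mulr1.
have h4 := is_deriveM h3 h2.
apply: (is_derive_eq h4); rewrite /GRing.scale/= exprfctE.
by field.
Qed.

Lemma is_derive_Kf_t c t x u : 0 < c -> t < 1 ->
  is_derive t 1 (fun t => Kf 0 c t x u)
    (l ^+ 2 * (1 + t) / (1 - t) ^+ 3 * u / c * Kf 1 (c + 1) t x u -
     l / (1 - t) ^+ 2 * Kf 1 c t x u).
Proof.
move=> c0 t1; have dt := is_derive_theta t1; have db := is_derive_bcoef t1.
have h1 : is_derive t 1 (fun t => bcoef t * (x * u)) (l ^+ 2 * (1 + t) / (1 - t) ^+ 3 * (x * u)).
  by apply: is_derive_eq; rewrite /GRing.scale/=; ring.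
have h2 := @is_derive_hyp01 R c (bcoef t * (x * u)) c0.
have h3 := @is_derive1_comp R (hyp01 c) (fun t => bcoef t * (x * u)) t _ _ h2 h1.
have h4 : is_derive t 1 (fun t => expR (- (theta t * x))) (- (l / (1 - t) ^+ 2 * x) * expR (- (theta t * x))).
  have h5 : is_derive t 1 (fun t => - (theta t * x)) (- (l / (1 - t) ^+ 2 * x)).
    by apply: is_derive_eq; rewrite /GRing.scale/=; ring.
  by apply: (is_derive_eq (is_derive1_comp (is_derive_expR _) h5)); rewrite mulrC.
have -> : (fun t => Kf 0 c t x u) = (fun t => expR (- (theta t * x)) * hyp01 c (bcoef t * (x * u))).
  by apply/funext => s; rewrite /Kf expr0 mul1r.
apply: (is_derive_eq (is_deriveM h4 h3)).
rewrite /Kf /GRing.scale/= !expr1.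
by field; rewrite !gt_eqF//= subr_gt0.
Qed.

Lemma continuous_Kf_t i c t x u : 0 < c -> t < 1 ->
  {for t, continuous (fun t => Kf i c t x u)}.
Proof.
move=> c0 t1; have dt := is_derive_theta t1; have db := is_derive_bcoef t1.
have ct : {for t, continuous theta}.
  by apply/differentiable_continuous/derivable1_diffP; case: dt.
have cb : {for t, continuous bcoef}.
  by apply/differentiable_continuous/derivable1_diffP; case: db.
apply: cvgM.
  apply: cvgMr; apply: continuous_comp; last exact: continuous_expR.
  by apply: cvgN; apply: cvgMl; exact: ct.
apply: (@continuous_comp _ _ _ (fun t => bcoef t * (x * u)) (hyp01 c)); last exact: continuous_hyp01.
by apply: cvgMl; exact: cb.
Qed.

(** [hyp01_ode] at the level of integrands. It eliminates the term with parameter a that appears in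
    the time derivative of the density but not in its space derivatives. *)
Lemma Kf_rec a t x u : 0 < a ->
  Kf 1 a t x u = Kf 1 (a + 1) t x u + bcoef t * u / (a * (a + 1)) * Kf 2 (a + 1 + 1) t x u.
Proof.
move=> a0; rewrite /Kf (hyp01_ode _ a0) !expr1 expr2.
by field; rewrite !gt_eqF// addr_gt0.
Qed.

Lemma measurable_Kf_x i c t u : 0 < c -> measurable_fun setT (fun x => Kf i c t x u).
Proof.
move=> c0; apply: continuous_measurable_fun => x.
apply: cvgM.
  apply: cvgM; first exact: exprn_continuous.
  exact: continuous_expRM.
apply: (@continuous_comp _ _ _ (fun x => bcoef t * (x * u)) (hyp01 c)); last exact: continuous_hyp01.
by apply: cvgMr; apply: cvgMl; exact: cvg_id.
Qed.

End KernelCalculus.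

(** * The relative density of the path and its heat equation *)

Section Moments.
Variable R : realType.
Variables (l : R) (mu : probability R R).
Hypotheses (l0 : 0 < l) (mupos : mu Rpos = 1%E).
Local Notation theta := (theta l).
Local Notation bcoef := (bcoef l).
Local Notation Kf := (Kf l).
Implicit Types (c t x u n : R) (i : nat).

Definition Hf i c t u : R := \int[mu]_(x in Rpos) Kf i c t x u.

Lemma measurable_Kf i c t u : 0 < c -> measurable_fun Rpos (fun x => Kf i c t x u).
Proof. by move=> c0; apply: measurable_funTS; exact: measurable_Kf_x. Qed.

Lemma integrable_Kf i c t u : 1 / 2 <= c -> 0 < t < 1 -> 0 <= u ->
  mu.-integrable Rpos (EFin \o (fun x => Kf i c t x u)).
Proof.
move=> c12 t01 u0; have c0 : 0 < c by rewrite (lt_le_trans _ c12).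
apply: (@bounded_integrable _ _ _ mu _ (@measurable_Rpos R) _ (Kbound l i t t u)).
  exact: measurable_Kf.
move=> x; rewrite RposE => x0; case/andP: (t01) => t0 t1.
rewrite ger0_norm; first by apply: Kf_le => //; rewrite ?lexx ?u0 ?ltW.
by apply: Kf_ge0 => //; exact: ltW.
Qed.

Lemma EFin_Hf i c t u : 1 / 2 <= c -> 0 < t < 1 -> 0 <= u ->
  ((Hf i c t u)%:E = \int[mu]_(x in Rpos) (Kf i c t x u)%:E)%E.
Proof.
move=> c12 t01 u0; rewrite /Hf /Rintegral fineK//.
apply: integrable_fin_num; first exact: (@measurable_Rpos R).
exact: integrable_Kf.
Qed.

Lemma Hf_ge0 i c t u : 0 < c -> 0 < t < 1 -> 0 <= u -> 0 <= Hf i c t u.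
Proof.
move=> c0 t01 u0; apply: Rintegral_ge0 => x; rewrite RposE => /ltW x0.
exact: Kf_ge0.
Qed.

Lemma Hf_gt0 i c t u : 1 / 2 <= c -> 0 < t < 1 -> 0 <= u -> 0 < Hf i c t u.
Proof.
move=> c12 t01 u0; have c0 : 0 < c by rewrite (lt_le_trans _ c12).
rewrite -lte_fin EFin_Hf//; apply: integral_gt0.
- exact: (@measurable_Rpos R).
- by apply/measurable_EFinP; exact: measurable_Kf.
- have h : (0 < mu Rpos)%E by rewrite mupos lte01.
  exact: h.
- move=> x; rewrite RposE lte_fin => x0.
  rewrite mulr_gt0 ?mulr_gt0 ?expR_gt0 ?exprn_gt0//.
  rewrite (lt_le_trans _ (hyp01_ge1 c0 _))//.
  by rewrite (mulr_ge0 (ltW (bcoef_gt0 l0 t01)))// mulr_ge0// ltW.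
Qed.

Lemma Hf_le i c t1 t2 n t u : 1 / 2 <= c -> 0 < t1 -> t2 < 1 -> t1 <= t <= t2 ->
  0 <= u <= n -> Hf i c t u <= Kbound l i t1 t2 n.
Proof.
move=> c12 t10 t21 tt un; have c0 : 0 < c by rewrite (lt_le_trans _ c12).
have t01 : 0 < t < 1.
  by case/andP: tt => h1 h2; rewrite (lt_le_trans t10 h1) (le_lt_trans h2 t21).
have u0 : 0 <= u by case/andP: un.
rewrite -lee_fin EFin_Hf//.
apply: (@le_trans _ _ (\int[mu]_(x in Rpos) (Kbound l i t1 t2 n)%:E)%E).
  apply: ge0_le_integral_real => //.
  - exact: (@measurable_Rpos R).
  - exact: measurable_Kf.
  - by move=> x; rewrite RposE => /ltW x0; exact: Kf_ge0.
  - by move=> x; rewrite RposE => /ltW x0; exact: Kf_le.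
rewrite integral_cst; last exact: (@measurable_Rpos R).
have h : ((Kbound l i t1 t2 n)%:E * mu Rpos <= (Kbound l i t1 t2 n)%:E)%E.
  by rewrite mupos mule1.
exact: h.
Qed.

Lemma is_derive_Hf_u i c t u : 1 / 2 <= c -> 0 < t < 1 -> 0 < u ->
  is_derive u 1 (Hf i c t) (bcoef t / c * Hf i.+1 (c + 1) t u).
Proof.
move=> c12 t01 u0; have c0 : 0 < c by rewrite (lt_le_trans _ c12).
have c112 : 1 / 2 <= c + 1 by rewrite (le_trans c12)// lerDl.
have b0 := bcoef_gt0 l0 t01; case/andP: (t01) => t0 t1.
pose C := Num.max (Kbound l i t t (u + 1)) (bcoef t / c * Kbound l i.+1 t t (u + 1)).
have -> : bcoef t / c * Hf i.+1 (c + 1) t u =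
   \int[mu]_(x in Rpos) (bcoef t / c * Kf i.+1 (c + 1) t x u).
  rewrite RintegralZl//; first exact: (@measurable_Rpos R).
  exact: (integrable_Kf _ c112 t01 (ltW u0)).
apply: (@is_derive_under_integral _ _ _ mu Rpos (@measurable_Rpos R)
   (fun u x => Kf i c t x u) (fun u x => bcoef t / c * Kf i.+1 (c + 1) t x u)
   u 0 (u + 1) C).
- by rewrite u0/= ltrDl.
- by move=> v _; exact: measurable_Kf.
- move=> v x /andP[v0 vu]; rewrite RposE => /ltW x0; rewrite le_max.
  rewrite ger0_norm ?Kf_ge0 ?(ltW v0)//; apply/orP; left.
  by apply: Kf_le => //; rewrite ?lexx ?ltW.
- by move=> v x _ _; exact: is_derive_Kf_u.
- move=> v x /andP[v0 vu]; rewrite RposE => /ltW x0; rewrite le_max.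
  have bc : 0 <= bcoef t / c by rewrite divr_ge0 ?ltW.
  have k0 : 0 <= Kf i.+1 (c + 1) t x v by rewrite Kf_ge0 ?(ltW v0)// addr_gt0.
  rewrite ger0_norm; last exact: mulr_ge0.
  apply/orP; right; apply: ler_wpM2l => //.
  by apply: Kf_le => //; rewrite ?lexx ?ltW.
Qed.

Lemma Rintegral_Kf_lin i c j d (p q : R) t u : 1 / 2 <= c -> 1 / 2 <= d ->
  0 < t < 1 -> 0 <= u ->
  \int[mu]_(x in Rpos) (p * Kf i c t x u - q * Kf j d t x u) =
  p * Hf i c t u - q * Hf j d t u.
Proof.
move=> c12 d12 t01 u0.
have mR := @measurable_Rpos R.
rewrite RintegralB//; last 2 first.
- by have := integrableZl mR p (integrable_Kf i c12 t01 u0); apply: eq_integrable.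
- by have := integrableZl mR q (integrable_Kf j d12 t01 u0); apply: eq_integrable.
by rewrite !RintegralZl//; exact: integrable_Kf.
Qed.

Lemma is_derive_Hf_t c t u : 1 / 2 <= c -> 0 < t < 1 -> 0 <= u ->
  is_derive t 1 (fun t => Hf 0 c t u)
    (l ^+ 2 * (1 + t) / (1 - t) ^+ 3 * u / c * Hf 1 (c + 1) t u -
     l / (1 - t) ^+ 2 * Hf 1 c t u).
Proof.
move=> c12 t01 u0; have c0 : 0 < c by rewrite (lt_le_trans _ c12).
have c112 : 1 / 2 <= c + 1 by rewrite (le_trans c12)// lerDl.
case/andP: (t01) => t0 t1.
(* Midpoints towards 0 and 1. On this window the time coefficients are largest at [t2], and [Kbound]
   controls the kernel terms uniformly. *)
pose t1' := t / 2; pose t2 := (t + 1) / 2.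
have t1'0 : 0 < t1' by rewrite divr_gt0.
have t2t : t < t2 by rewrite /t2; lra.
have t1't : t1' < t by rewrite /t1'; lra.
have t21 : t2 < 1 by rewrite /t2; lra.
pose B := Kbound l 1 t1' t2 u.
have B0 : 0 <= B by apply: Kbound_ge0 => //; rewrite t1'0 (lt_trans t1't).
pose C := Num.max (Kbound l 0 t1' t2 u)
  (l ^+ 2 * 2 / (1 - t2) ^+ 3 * u / c * B + l / (1 - t2) ^+ 2 * B).
rewrite -Rintegral_Kf_lin//.
apply: (@is_derive_under_integral _ _ _ mu Rpos (@measurable_Rpos R)
   (fun t x => Kf 0 c t x u) (fun t x =>  l ^+ 2 * (1 + t) / (1 - t) ^+ 3 * u / c * Kf 1 (c + 1) t x u -
     l / (1 - t) ^+ 2 * Kf 1 c t x u)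
   t t1' t2 C).
- by rewrite t1't.
- by move=> s _; exact: measurable_Kf.
- move=> s x /andP[s1 s2]; rewrite RposE => /ltW x0; rewrite le_max.
  have s01 : 0 < s < 1 by rewrite (lt_trans t1'0 s1) (lt_trans s2).
  rewrite ger0_norm ?Kf_ge0//; apply/orP; left.
  by apply: Kf_le => //; rewrite ?u0 ?lexx ?ltW.
- move=> s x /andP[s1 s2] _; apply: is_derive_Kf_t => //; exact: lt_trans s2 t21.
- move=> s x /andP[s1 s2]; rewrite RposE => /ltW x0; rewrite le_max.
  have s01 : 0 < s < 1 by rewrite (lt_trans t1'0 s1) (lt_trans s2).
  have s10 : 0 < 1 - s by case/andP: s01 => _; rewrite subr_gt0.
  have t210 : 0 < 1 - t2 by rewrite subr_gt0.
  have K1 : 0 <= Kf 1 (c + 1) s x u <= B.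
    rewrite Kf_ge0 ?addr_gt0//=.
    by apply: Kf_le => //; rewrite ?u0 ?lexx ?ltW.
  have K2 : 0 <= Kf 1 c s x u <= B.
    rewrite Kf_ge0//=.
    by apply: Kf_le => //; rewrite ?u0 ?lexx ?ltW.
  have l2 : 0 <= l ^+ 2 by exact: sqr_ge0.
  apply/orP; right; apply: le_trans (ler_normB _ _) _; apply: lerD.
    case/andP: K1 => K10 K11; case/andP: s01 => s0 _.
    have p0 : 0 <= l ^+ 2 * (1 + s) by rewrite mulr_ge0// addr_ge0// ltW.
    have i0 : 0 <= (1 - s) ^- 3 by rewrite invr_ge0 exprn_ge0// ltW.
    have p1 : 0 <= l ^+ 2 * (1 + s) / (1 - s) ^+ 3 * u / c.
      by rewrite mulr_ge0 ?invr_ge0 ?(ltW c0)// mulr_ge0// mulr_ge0.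
    rewrite ger0_norm; last exact: mulr_ge0.
    apply: ler_pM => //; rewrite ler_wpM2r ?invr_ge0 ?(ltW c0)// ler_wpM2r//.
    apply: ler_pM => //.
      by rewrite ler_wpM2l//; lra.
    rewrite lef_pV2 ?posrE ?exprn_gt0// lerXn2r ?nnegrE ?ltW//; lra.
  case/andP: K2 => K20 K21.
  have p1 : 0 <= l / (1 - s) ^+ 2 by rewrite divr_ge0 ?(ltW l0)// exprn_ge0// ltW.
  rewrite ger0_norm; last exact: mulr_ge0.
  apply: ler_pM => //; rewrite ler_wpM2l ?(ltW l0)//.
  rewrite lef_pV2 ?posrE ?exprn_gt0// lerXn2r ?nnegrE ?ltW//; lra.
Qed.

Lemma continuous_Hf_t i c t u : 1 / 2 <= c -> 0 < t < 1 -> 0 <= u ->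
  {for t, continuous (fun t => Hf i c t u)}.
Proof.
move=> c12 t01 u0; have c0 : 0 < c by rewrite (lt_le_trans _ c12).
case/andP: (t01) => t0 t1.
pose t1' := t / 2; pose t2 := (t + 1) / 2.
have t1'0 : 0 < t1' by rewrite divr_gt0.
have t2t : t < t2 by rewrite /t2; lra.
have t1't : t1' < t by rewrite /t1'; lra.
have t21 : t2 < 1 by rewrite /t2; lra.
apply: (@continuous_under_integral_bounded _ _ _ mu Rpos (@measurable_Rpos R)
   (fun t x => Kf i c t x u) t t1' t2 (Kbound l i t1' t2 u)).
- by rewrite t1't.
- by move=> s _; exact: measurable_Kf.
- move=> s x /andP[s1 s2]; rewrite RposE => /ltW x0.
  have s01 : 0 < s < 1 by rewrite (lt_trans t1'0 s1) (lt_trans s2).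
  rewrite ger0_norm ?Kf_ge0//.
  by apply: Kf_le => //; rewrite ?u0 ?lexx ?ltW.
- move=> s x /andP[s1 s2] _; apply: continuous_Kf_t => //; exact: lt_trans s2 t21.
Qed.

Lemma Hf_rec a t u : 1 / 2 <= a -> 0 < t < 1 -> 0 <= u ->
  Hf 1 a t u = Hf 1 (a + 1) t u + bcoef t * u / (a * (a + 1)) * Hf 2 (a + 1 + 1) t u.
Proof.
move=> a12 t01 u0; have a0 : 0 < a by rewrite (lt_le_trans _ a12).
have a112 : 1 / 2 <= a + 1 by rewrite (le_trans a12)// lerDl.
have a212 : 1 / 2 <= a + 1 + 1 by rewrite (le_trans a112)// lerDl.
have := @Rintegral_Kf_lin 1 (a + 1) 2 (a + 1 + 1) 1 (- (bcoef t * u / (a * (a + 1)))) t u a112 a212 t01 u0.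
rewrite mul1r mulNr opprK => <-; apply: eq_Rintegral => x _.
by rewrite (Kf_rec l t x u a0) mul1r mulNr opprK.
Qed.

End Moments.

(** * Tonelli's theorem on a rectangle *)

Section TonelliOn.
Context d1 d2 (T1 : measurableType d1) (T2 : measurableType d2) (R : realType).
Variables (m1 : {sigma_finite_measure set T1 -> \bar R}).
Variables (m2 : {sigma_finite_measure set T2 -> \bar R}).
Variables (D1 : set T1) (D2 : set T2) (f : T1 * T2 -> \bar R).
Hypotheses (mD1 : measurable D1) (mD2 : measurable D2).
Hypothesis mf : measurable_fun (D1 `*` D2) f.
Hypothesis f0 : forall x y, D1 x -> D2 y -> (0 <= f (x, y))%E.

(** Extension by zero: [f] is measurable and nonnegative on the rectangle only, as for expressions
    that are meaningful just for 0 < t < 1 and u > 0. *)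
Let g := f \_ (D1 `*` D2).

Let mg : measurable_fun setT g.
Proof. by apply/(measurable_restrictT _ (measurableX mD1 mD2)). Qed.

Let g0 p : (0 <= g p)%E.
Proof. by rewrite /g patchE; case: ifPn => // /set_mem; case: p => x y [] /f0; exact. Qed.

Let gE x y : g (x, y) = if (x \in D1) && (y \in D2) then f (x, y) else 0%E.
Proof. by rewrite /g patchE in_setX. Qed.

Let int1 x : (\int[m2]_y g (x, y) = ((fun x => \int[m2]_(y in D2) f (x, y)) \_ D1) x)%E.
Proof.
rewrite patchE; case: ifPn => xD.
  rewrite [RHS]integral_mkcond; apply: eq_integral => y _.
  by rewrite gE xD/= patchE.
by apply: integral0_eq => y _; rewrite gE (negbTE xD).
Qed.

Let int2 y : (\int[m1]_x g (x, y) = ((fun y => \int[m1]_(x in D1) f (x, y)) \_ D2) y)%E.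
Proof.
rewrite patchE; case: ifPn => yD.
  rewrite [RHS]integral_mkcond; apply: eq_integral => x _.
  by rewrite gE yD andbT/= patchE.
by apply: integral0_eq => x _; rewrite gE (negbTE yD) andbF.
Qed.

Lemma measurable_tonelli_on1 :
  measurable_fun D1 (fun x => \int[m2]_(y in D2) f (x, y))%E.
Proof.
have := @measurable_fun_fubini_tonelli_F _ _ _ _ _ m2 g mg g0; rewrite /fubini_F.
have -> : (fun x => \int[m2]_y g (x, y))%E = (fun x => \int[m2]_(y in D2) f (x, y))%E \_ D1.
  by apply/funext => x; exact: int1.
by move/(measurable_restrictT _ mD1).
Qed.

Lemma measurable_tonelli_on2 :
  measurable_fun D2 (fun y => \int[m1]_(x in D1) f (x, y))%E.
Proof.
have := @measurable_fun_fubini_tonelli_G _ _ _ _ _ m1 g mg g0; rewrite /fubini_G.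
have -> : (fun y => \int[m1]_x g (x, y))%E = (fun y => \int[m1]_(x in D1) f (x, y))%E \_ D2.
  by apply/funext => y; exact: int2.
by move/(measurable_restrictT _ mD2).
Qed.

Lemma tonelli_on : (\int[m1]_(x in D1) \int[m2]_(y in D2) f (x, y) =
  \int[m2]_(y in D2) \int[m1]_(x in D1) f (x, y))%E.
Proof.
rewrite [LHS]integral_mkcond [RHS]integral_mkcond.
have := @fubini_tonelli _ _ _ _ _ m1 m2 g mg g0; rewrite /fubini_F /fubini_G.
have -> : (fun x => \int[m2]_y g (x, y))%E = (fun x => \int[m2]_(y in D2) f (x, y))%E \_ D1.
  by apply/funext => x; exact: int1.
have -> : (fun y => \int[m1]_x g (x, y))%E = (fun y => \int[m1]_(x in D1) f (x, y))%E \_ D2.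
  by apply/funext => y; exact: int2.
by [].
Qed.

End TonelliOn.

(** * Joint measurability in time and space *)

Section JointMeasurability.
Variable R : realType.
Variables (l : R) (mu : probability R R).
Hypotheses (l0 : 0 < l) (mupos : mu Rpos = 1%E).
Local Notation theta := (theta l).
Local Notation bcoef := (bcoef l).
Local Notation Kf := (Kf l).
Implicit Types (c t x u n : R) (i : nat).

Definition U01 : set R := `]0, 1[%classic.

Definition strip : set (R * R) := U01 `*` Rpos.

Lemma U01E t : U01 t = (0 < t < 1) :> Prop.
Proof. by rewrite /U01/= in_itv. Qed.

Lemma measurable_U01 : measurable U01.
Proof. exact: measurable_itv. Qed.

Lemma measurable_strip : measurable strip.
Proof. by apply: measurableX; exact: measurable_itv. Qed.

Lemma measurable_inv_onem : measurable_fun U01 (fun t : R => (1 - t)^-1).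
Proof.
apply: open_continuous_measurable_fun; first exact: interval_open.
move=> t /set_mem; rewrite U01E => /andP[_ t1].
apply: cvgV; first by rewrite gt_eqF// subr_gt0.
by apply: cvgB; [exact: cvg_cst|exact: cvg_id].
Qed.

Lemma measurable_theta : measurable_fun U01 theta.
Proof.
apply: measurable_funM; last exact: measurable_inv_onem.
by apply: measurable_funM.
Qed.

Lemma measurable_bcoef : measurable_fun U01 bcoef.
Proof.
have -> : bcoef = (fun t => l ^+ 2 * t * (1 - t)^-1 ^+ 2).
  by apply/funext => t; rewrite /bcoef exprVn.
apply: measurable_funM; first exact: measurable_funM.
by apply: measurable_funX; exact: measurable_inv_onem.
Qed.

Lemma measurable_Kf_joint i c : 0 < c ->
  measurable_fun (strip `*` Rpos) (fun p : (R * R) * R => Kf i c p.1.1 p.2 p.1.2).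
Proof.
move=> c0.
have mt (f : R -> R) : measurable_fun U01 f ->
    measurable_fun (strip `*` Rpos) (fun p : (R * R) * R => f p.1.1).
  move=> mf; apply: (measurable_comp (F := U01) (f := f)
    (g := fun p : (R * R) * R => p.1.1)) => //; first exact: measurable_U01.
    by move=> _ [[[t u] x] /= [[h _] _] <-].
  apply: measurable_funTS; apply: measurableT_comp; exact: measurable_fst.
have mx : measurable_fun (strip `*` Rpos) (fun p : (R * R) * R => p.2).
  by apply: measurable_funTS; exact: measurable_snd.
have mu' : measurable_fun (strip `*` Rpos) (fun p : (R * R) * R => p.1.2).
  by apply: measurable_funTS; apply: measurableT_comp; [exact: measurable_snd|exact: measurable_fst].
apply: measurable_funM.
  apply: measurable_funM; first exact: measurable_funX.
  apply: measurableT_comp => //; apply: measurableT_comp => //.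
  by apply: measurable_funM => //; apply: mt; exact: measurable_theta.
apply: (measurableT_comp (measurable_hyp01 c0)).
apply: measurable_funM; first by apply: mt; exact: measurable_bcoef.
exact: measurable_funM.
Qed.

Lemma measurable_Hf i c : 1 / 2 <= c ->
  measurable_fun strip (fun p : R * R => Hf l mu i c p.1 p.2).
Proof.
move=> c12; have c0 : 0 < c by rewrite (lt_le_trans _ c12).
have h : measurable_fun strip
    (fun p : R * R => \int[mu]_(x in Rpos) (Kf i c p.1 x p.2)%:E)%E.
  apply: (@measurable_tonelli_on1 _ _ _ _ _ mu strip Rpos
    (fun q : (R * R) * R => (Kf i c q.1.1 q.2 q.1.2)%:E)).
  - exact: measurable_strip.
  - exact: (@measurable_Rpos R).
  - by apply/measurable_EFinP; exact: measurable_Kf_joint.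
  - move=> [t u] x [/= t01 u0]; rewrite RposE => x0.
    move: t01 u0; rewrite U01E RposE => t01 /ltW u0.
    by rewrite lee_fin; apply: Kf_ge0 => //; exact: ltW.
by have := measurableT_comp (@fine_measurable R setT measurableT) h.
Qed.

End JointMeasurability.

Section RelativeDensity.
Variable R : realType.
Variables (a l : R) (mu : probability R R).
Hypotheses (a12 : 1 / 2 <= a) (l0 : 0 < l) (mupos : mu Rpos = 1%E).
Local Notation theta := (theta l).
Local Notation bcoef := (bcoef l).
Local Notation Kf := (Kf l).
Local Notation Hf := (Hf l mu).
Local Notation leb := (@lebesgue_measure R).
Implicit Types (c t x u n : R) (i : nat).

Let a0 : 0 < a. Proof. by rewrite (lt_le_trans _ a12). Qed.
Let a112 : 1 / 2 <= a + 1. Proof. by rewrite (le_trans a12)// lerDl. Qed.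
Let a212 : 1 / 2 <= a + 1 + 1. Proof. by rewrite (le_trans a112)// lerDl. Qed.

Definition prefac t u : R := (1 - t) `^ (- a) * expR (- (theta t * u)).

(* The density of X_t relative to the gamma law, followed by the closed forms of
   its partial derivatives. *)
Definition dens t u : R := prefac t u * Hf 0 a t u.

Definition dens_u t u : R :=
  prefac t u * (bcoef t / a * Hf 1 (a + 1) t u - theta t * Hf 0 a t u).

Definition dens_uu t u : R :=
  prefac t u * (bcoef t / a * (bcoef t / (a + 1)) * Hf 2 (a + 1 + 1) t u
    - 2 * theta t * (bcoef t / a) * Hf 1 (a + 1) t u + theta t ^+ 2 * Hf 0 a t u).

Definition dens_t t u : R :=
  prefac t u * ((a / (1 - t) - l / (1 - t) ^+ 2 * u) * Hf 0 a t u +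
    (l ^+ 2 * (1 + t) / (1 - t) ^+ 3 * u / a * Hf 1 (a + 1) t u -
     l / (1 - t) ^+ 2 * Hf 1 a t u)).

Lemma prefac_gt0 t u : t < 1 -> 0 < prefac t u.
Proof. by move=> t1; rewrite mulr_gt0 ?expR_gt0// powR_gt0// subr_gt0. Qed.

Lemma dens_gt0 t u : 0 < t < 1 -> 0 <= u -> 0 < dens t u.
Proof.
move=> t01 u0; rewrite mulr_gt0//; last exact: Hf_gt0.
by apply: prefac_gt0; case/andP: t01.
Qed.

Lemma is_derive_prefac_u t u : is_derive u 1 (prefac t) (- theta t * prefac t u).
Proof.
rewrite /prefac.
have h : is_derive u 1 (fun u : R => - (theta t * u)) (- theta t).
  by apply: is_derive_eq; rewrite /GRing.scale/= mulr1.
have h2 := @is_derive1_comp R expR (fun u => - (theta t * u)) u _ _ (is_derive_expR _) h.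
have h3 := @is_deriveZ _ _ _ (expR \o (fun u : R => - (theta t * u))) ((1 - t) `^ (- a)) _ _ _ h2.
by apply: (is_derive_eq h3); rewrite /GRing.scale/=; ring.
Qed.

Lemma is_derive_prefac_t t u : t < 1 ->
  is_derive t 1 (prefac ^~ u) ((a / (1 - t) - l / (1 - t) ^+ 2 * u) * prefac t u).
Proof.
move=> t1; have t10 : 0 < 1 - t by rewrite subr_gt0.
have dt := is_derive_theta l t1.
have h : is_derive t 1 (fun t : R => - (theta t * u)) (- (l / (1 - t) ^+ 2 * u)).
  by apply: is_derive_eq; rewrite /GRing.scale/=; ring.
have h2 := @is_derive1_comp R expR (fun t => - (theta t * u)) t _ _ (is_derive_expR _) h.
have h1 : is_derive t 1 (fun t : R => 1 - t) (-1).
  by apply: is_derive_eq; rewrite add0r mul1r.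
have h3 := @is_derive1_comp R (fun x => x `^ (- a)) (fun t => 1 - t) t _ _ (is_derive1_powR (- a) t10) h1.
apply: (is_derive_eq (is_deriveM h3 h2)); rewrite /prefac /GRing.scale/=.
have -> : (1 - t) `^ (- a - 1) = (1 - t) `^ (- a) / (1 - t).
  by rewrite powRB ?(gt_eqF t10) ?implybT// powRr1// ltW.
by field; rewrite gt_eqF.
Qed.

Lemma is_derive_dens_u t u : 0 < t < 1 -> 0 < u ->
  is_derive u 1 (dens t) (dens_u t u).
Proof.
move=> t01 u0.
have h1 := is_derive_prefac_u t u.
have h2 := is_derive_Hf_u mu l0 0 a12 t01 u0.
by apply: (is_derive_eq (is_deriveM h1 h2)); rewrite /dens_u /GRing.scale/=; ring.
Qed.

Lemma is_derive_dens_uu t u : 0 < t < 1 -> 0 < u ->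
  is_derive u 1 (dens_u t) (dens_uu t u).
Proof.
move=> t01 u0.
have h1 := is_derive_prefac_u t u.
have h2 := is_derive_Hf_u mu l0 0 a12 t01 u0.
have h3 := is_derive_Hf_u mu l0 1 a112 t01 u0.
have h4 : is_derive u 1 (fun u => bcoef t / a * Hf 1 (a + 1) t u - theta t * Hf 0 a t u)
   (bcoef t / a * (bcoef t / (a + 1) * Hf 2 (a + 1 + 1) t u) -
     theta t * (bcoef t / a * Hf 1 (a + 1) t u)).
  have h5 := @is_deriveZ _ _ _ (Hf 1 (a + 1) t) (bcoef t / a) _ _ _ h3.
  have h6 := @is_deriveZ _ _ _ (Hf 0 a t) (theta t) _ _ _ h2.
  exact: (is_derive_eq (is_deriveB h5 h6)).
by apply: (is_derive_eq (is_deriveM h1 h4)); rewrite /dens_uu /GRing.scale/=; ring.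
Qed.

Lemma is_derive_dens_t t u : 0 < t < 1 -> 0 <= u ->
  is_derive t 1 (dens ^~ u) (dens_t t u).
Proof.
move=> t01 u0; have t1 : t < 1 by case/andP: t01.
have h1 := is_derive_prefac_t u t1.
have h2 := is_derive_Hf_t mu l0 a12 t01 u0.
by apply: (is_derive_eq (is_deriveM h1 h2)); rewrite /dens_t /GRing.scale/=; ring.
Qed.

(* The Laguerre heat equation in the time [- ln t]; it reduces to the
   differential equation of 0F1. *)
Lemma dens_heat t u : 0 < t < 1 -> 0 <= u ->
  - (l * t) * dens_t t u = u * dens_uu t u + (a - l * u) * dens_u t u.
Proof.
move=> t01 u0; have t1 : 0 < 1 - t by case/andP: t01; rewrite subr_gt0.
rewrite /dens_t /dens_uu /dens_u (Hf_rec mu l0 a12 t01 u0) /theta /bcoef.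
have a1 : 0 < a + 1 by rewrite addr_gt0.
by field; rewrite !gt_eqF.
Qed.

Lemma continuous_prefac_t t u : t < 1 -> {for t, continuous (prefac ^~ u)}.
Proof.
move=> t1; apply/differentiable_continuous/derivable1_diffP.
by case: (is_derive_prefac_t u t1).
Qed.

Lemma continuous_dens_t t u : 0 < t < 1 -> 0 <= u -> {for t, continuous (dens_t ^~ u)}.
Proof.
move=> t01 u0; have t1 : t < 1 by case/andP: t01.
have t10 : 1 - t != 0 by rewrite gt_eqF// subr_gt0.
have ct : {for t, continuous (fun t : R => 1 - t)} by apply: cvgB; [exact: cvg_cst|exact: cvg_id].
have ci : {for t, continuous (fun t : R => (1 - t)^-1)} by apply: cvgV.
have cik k : {for t, continuous (fun t : R => ((1 - t) ^+ k)^-1)}.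
  apply: cvgV; first by rewrite expf_neq0.
  by apply: (@continuous_comp _ _ _ (fun t => 1 - t) (fun x => x ^+ k)) => //; exact: exprn_continuous.
have cH i c : 1 / 2 <= c -> {for t, continuous (fun t => Hf i c t u)}.
  by move=> c12; exact: continuous_Hf_t.
apply: cvgM; first exact: continuous_prefac_t.
apply: cvgD.
  apply: cvgM; last exact: cH.
  apply: cvgB; first by apply: cvgMr; exact: ci.
  by apply: cvgMl; apply: cvgMr; exact: cik.
apply: cvgB; last by apply: cvgM; [apply: cvgMr; exact: cik|exact: cH].
apply: cvgM; last exact: cH.
apply: cvgMl; apply: cvgMl; apply: cvgM; last exact: cik.
by apply: cvgMr; apply: cvgD; [exact: cvg_cst|exact: cvg_id].
Qed.

Lemma measurable_prefac_joint :
  measurable_fun (@strip R) (fun p : R * R => prefac p.1 p.2).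
Proof.
have mt (f : R -> R) : measurable_fun (@U01 R) f ->
    measurable_fun (@strip R) (fun p : R * R => f p.1).
  move=> mf; apply: (measurable_comp (F := @U01 R) (f := f)
    (g := fun p : R * R => p.1)) => //; first exact: measurable_U01.
    by move=> _ [[t u] /= [h _] <-].
  by apply: measurable_funTS; exact: measurable_fst.
apply: measurable_funM.
  apply: (mt (fun t => (1 - t) `^ (- a))); apply: measurable_funTS.
  apply: (measurableT_comp (measurable_powR _)).
  exact: measurable_funB.
apply: measurableT_comp => //; apply: measurableT_comp => //.
apply: measurable_funM; first by apply: mt; exact: measurable_theta.
by apply: measurable_funTS; exact: measurable_snd.
Qed.

Lemma measurable_dens_joint : measurable_fun (@strip R) (fun p : R * R => dens p.1 p.2).
Proof.
apply: measurable_funM; first exact: measurable_prefac_joint.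
exact: measurable_Hf.
Qed.

Lemma measurable_fst_strip (f : R -> R) : measurable_fun (@U01 R) f ->
  measurable_fun (@strip R) (fun p : R * R => f p.1).
Proof.
move=> mf; apply: (measurable_comp (F := @U01 R) (f := f)
  (g := fun p : R * R => p.1)) => //; first exact: measurable_U01.
  by move=> _ [[t u] /= [h _] <-].
by apply: measurable_funTS; exact: measurable_fst.
Qed.

Lemma measurable_snd_strip : measurable_fun (@strip R) (fun p : R * R => p.2).
Proof. by apply: measurable_funTS; exact: measurable_snd. Qed.

Lemma measurable_dens_u_joint :
  measurable_fun (@strip R) (fun p : R * R => dens_u p.1 p.2).
Proof.
apply: measurable_funM; first exact: measurable_prefac_joint.
apply: measurable_funB; apply: measurable_funM; try exact: measurable_Hf.
  apply: measurable_funM => //.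
  by apply: measurable_fst_strip; exact: measurable_bcoef.
by apply: measurable_fst_strip; exact: measurable_theta.
Qed.

Lemma measurable_dens_t_joint :
  measurable_fun (@strip R) (fun p : R * R => dens_t p.1 p.2).
Proof.
have mi k : measurable_fun (@U01 R) (fun t => (1 - t) ^- k).
  have -> : (fun t : R => (1 - t) ^- k) = (fun t => (1 - t)^-1 ^+ k).
    by apply/funext => t; rewrite exprVn.
  by apply: measurable_funX; exact: measurable_inv_onem.
have ms := measurable_snd_strip.
apply: measurable_funM; first exact: measurable_prefac_joint.
apply: measurable_funD.
  apply: measurable_funM; last exact: measurable_Hf.
  apply: measurable_funB.
    apply: (@measurable_fst_strip (fun t => a / (1 - t))).
    by apply: measurable_funM => //; exact: measurable_inv_onem.
  apply: measurable_funM => //.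
  apply: (@measurable_fst_strip (fun t => l / (1 - t) ^+ 2)).
  by apply: measurable_funM => //; exact: mi.
apply: measurable_funB; apply: measurable_funM; try exact: measurable_Hf.
  apply: measurable_funM => //; apply: measurable_funM => //.
  apply: (@measurable_fst_strip (fun t => l ^+ 2 * (1 + t) / (1 - t) ^+ 3)).
  apply: measurable_funM; last exact: mi.
  by apply: measurable_funM => //; exact: measurable_funD.
apply: (@measurable_fst_strip (fun t => l / (1 - t) ^+ 2)).
by apply: measurable_funM => //; exact: mi.
Qed.

End RelativeDensity.

(** * Relative entropy along the path *)

Section EntropyFunction.
Variable R : realType.
Implicit Types (b g y : R).

(** The terms - y + 1 cancel in the integral of a relative density against a probability, and they
    make the function nonnegative with convex conjugate exp(g) - 1. *)
Definition phi y : R := y * ln y - y + 1.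

(** This is 1 + z <= exp(z) at z = g - ln y, multiplied by y. *)
Lemma phi_young y g : 0 <= y -> y * g <= phi y + expR g - 1.
Proof.
rewrite le_eqVlt => /predU1P[<-|y0].
  by rewrite /phi !mul0r subr0 add0r addrAC subrr add0r expR_ge0.
have := expR_ge1Dx (g - ln y); rewrite expRD expRN lnK ?posrE//.
rewrite ler_pdivlMr// /phi => h; lra.
Qed.

Lemma phi_ge0 y : 0 <= y -> 0 <= phi y.
Proof. by move=> y0; have := @phi_young y 0 y0; rewrite mulr0 expR0 addrK. Qed.

Lemma measurable_phi : measurable_fun setT phi.
Proof.
apply: measurable_funD => //; apply: measurable_funB => //.
by apply: measurable_funM => //; exact: measurable_ln.
Qed.

(** Young's inequality with slope ln b = phi'(b) is the tangent line of [phi] at b; it is integrated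
    against the weight [w], under which [f] has mean b. *)
Lemma phi_jensen d (T : measurableType d) (nu : {measure set T -> \bar R})
    (D : set T) (w f : T -> R) b : measurable D ->
  measurable_fun D w -> measurable_fun D f ->
  (forall x, D x -> 0 <= w x) -> (forall x, D x -> 0 <= f x) -> 0 < b ->
  (\int[nu]_(x in D) (w x)%:E = 1)%E ->
  (\int[nu]_(x in D) (w x * f x)%:E = b%:E)%E ->
  ((phi b)%:E <= \int[nu]_(x in D) (w x * phi (f x))%:E)%E.
Proof.
move=> mD mw mf w0 f0 b0 Iw If.
(* The positive and negative parts of ln b are put on opposite sides, so that both integrands are
   nonnegative and the integral of [phi] may be infinite. *)
pose p := Num.max (ln b) 0; pose q := Num.max (- ln b) 0.
have p0 : 0 <= p by rewrite le_max lexx orbT.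
have q0 : 0 <= q by rewrite le_max lexx orbT.
have pq : p - q = ln b.
  by rewrite /p /q; case: (lerP 0 (ln b)) => h; case: (lerP 0 (- ln b)) => h'; lra.
have mphi : measurable_fun D (fun x => phi (f x)).
  exact: (measurableT_comp measurable_phi).
have mwf : measurable_fun D (fun x => w x * f x) by exact: measurable_funM.
have mwp : measurable_fun D (fun x => w x * phi (f x)) by exact: measurable_funM.
have wf0 x : D x -> 0 <= w x * f x by move=> Dx; rewrite mulr_ge0 ?w0 ?f0.
have wp0 x : D x -> 0 <= w x * phi (f x) by move=> Dx; rewrite mulr_ge0 ?w0 ?phi_ge0 ?f0.
have bw0 x : D x -> 0 <= b * w x by move=> Dx; rewrite mulr_ge0 ?w0 ?ltW.
have : (\int[nu]_(x in D) (p * (w x * f x) + w x)%:E <=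
    \int[nu]_(x in D) (w x * phi (f x) + (b * w x + q * (w x * f x)))%:E)%E.
  apply: ge0_le_integral_real => //.
  - by apply: measurable_funD => //; exact: measurable_funM.
  - apply: measurable_funD => //; apply: measurable_funD; exact: measurable_funM.
  - by move=> x Dx; rewrite addr_ge0 ?w0// mulr_ge0 ?wf0.
  - move=> x Dx; have := @phi_young (f x) (ln b) (f0 _ Dx).
    rewrite lnK ?posrE// -pq => /(ler_wpM2l (w0 _ Dx)); lra.
have If' : (\int[nu]_(x in D) (f x * w x)%:E = b%:E)%E.
  by rewrite -If; apply: eq_integral => x _; rewrite mulrC.
have mM (r : R) h : measurable_fun D h -> measurable_fun D (fun x => r * h x).
  by move=> mh; exact: measurable_funM.
have E1 : (\int[nu]_(x in D) (p * (w x * f x) + w x)%:E = p%:E * b%:E + 1)%E.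
  rewrite ge0_integralD_real//; first by rewrite ge0_integralZl_real// If Iw.
  - exact: mM.
  - by move=> x Dx; rewrite mulr_ge0 ?wf0.
have E2 : (\int[nu]_(x in D) (b * w x + q * (w x * f x))%:E = b%:E + q%:E * b%:E)%E.
  rewrite ge0_integralD_real//.
  - by rewrite !ge0_integralZl_real// ?(ltW b0)// If Iw mule1.
  - exact: mM.
  - exact: mM.
  - by move=> x Dx; rewrite mulr_ge0 ?wf0.
rewrite E1 ge0_integralD_real//; last 2 first.
- by apply: measurable_funD; exact: mM.
- by move=> x Dx; rewrite addr_ge0 ?bw0// mulr_ge0 ?wf0.
rewrite E2.
move: (\int[nu]_(x in D) (w x * phi (f x))%:E)%E => [s| |] //=.
- rewrite -!EFinM -!EFinD !lee_fin /phi -pq => h; lra.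
- by move=> _; exact: leey.
Qed.

End EntropyFunction.

(** * The law of X_t and a bound for its entropy *)

Section PathLaw.
Variable R : realType.
Variables (a l : R) (mu : probability R R).
Hypotheses (a12 : 1 / 2 <= a) (l0 : 0 < l) (mupos : mu Rpos = 1%E).
Local Notation theta := (theta l).
Local Notation bcoef := (bcoef l).
Local Notation dens := (dens a l mu).
Local Notation gam := (gamma_pdf a l).
Local Notation ker := (ker a l).
Local Notation leb := (@lebesgue_measure R).
Implicit Types (c t x u n : R) (i : nat).

Let a0 : 0 < a. Proof. by rewrite (lt_le_trans _ a12). Qed.

Lemma kerE t x u : ker t x u = prefac a l t u * Kf l 0 a t x u.
Proof.
rewrite /ker /prefac /Kf expr0 mul1r mulrDr opprD expRD; ring.
Qed.

Lemma measurable_ker_joint t :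
  measurable_fun setT (fun p : R * R => ker t p.1 p.2).
Proof.
apply: measurable_funM.
  apply: measurable_funM => //; apply: measurableT_comp => //.
  apply: measurableT_comp => //; apply: measurable_funM => //.
  by apply: measurable_funD; [exact: measurable_fst|exact: measurable_snd].
apply: (measurableT_comp (measurable_hyp01 a0)); apply: measurable_funM => //.
by apply: measurable_funM; [exact: measurable_fst|exact: measurable_snd].
Qed.

Lemma EFin_dens t u : 0 < t < 1 -> 0 <= u ->
  ((dens t u)%:E = \int[mu]_(x in Rpos) (ker t x u)%:E)%E.
Proof.
move=> t01 u0; have t1 : t < 1 by case/andP: t01.
rewrite /dens EFinM EFin_Hf// -ge0_integralZl_real.
- by apply: eq_integral => x _; rewrite kerE.
- exact: (@measurable_Rpos R).
- exact: measurable_Kf.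
- by move=> x; rewrite RposE => /ltW x0; exact: Kf_ge0.
- by rewrite ltW// prefac_gt0.
Qed.

Lemma integral_path t (g : R -> R) : 0 < t < 1 ->
  measurable_fun setT g -> (forall u, 0 <= g u) ->
  (\int[mu]_(x in Rpos) \int[leb]_u (g u * (gam u * ker t x u))%:E =
   \int[leb]_(u in Rpos) (g u * (gam u * dens t u))%:E)%E.
Proof.
move=> t01 mg g0.
have mk : measurable_fun (Rpos `*` Rpos)
    (fun p : R * R => g p.2 * (gam p.2 * ker t p.1 p.2)).
  apply: measurable_funTS; apply: measurable_funM.
    by apply: (measurableT_comp mg); exact: measurable_snd.
  apply: measurable_funM; last exact: measurable_ker_joint.
  by apply: (measurableT_comp (@measurable_gamma_pdf R a l)); exact: measurable_snd.
transitivity (\int[mu]_(x in Rpos) \int[leb]_(u in Rpos) (g u * (gam u * ker t x u))%:E)%E.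
  apply: eq_integral => x _; apply/esym; apply: integral_Rpos_setT => u u0.
  by rewrite gamma_pdf_out ?mul0r ?mulr0.
transitivity (\int[leb]_(u in Rpos) \int[mu]_(x in Rpos) (g u * (gam u * ker t x u))%:E)%E.
  apply: (@tonelli_on _ _ _ _ _ mu leb Rpos Rpos
    (fun p => (g p.2 * (gam p.2 * ker t p.1 p.2))%:E)).
  - exact: (@measurable_Rpos R).
  - exact: (@measurable_Rpos R).
  - by apply/measurable_EFinP; exact: mk.
  - move=> x u; rewrite !RposE => /ltW x0 /ltW u0.
    by rewrite lee_fin mulr_ge0// mulr_ge0 ?gamma_pdf_ge0// ltW// ker_gt0.
apply: eq_integral => u; rewrite in_Rpos => /ltW u0.
transitivity (\int[mu]_(x in Rpos) (g u * gam u * ker t x u)%:E)%E.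
  by apply: eq_integral => x _; rewrite mulrA.
rewrite ge0_integralZl_real.
- by rewrite -EFin_dens// -EFinM mulrA.
- exact: (@measurable_Rpos R).
- apply: measurable_funTS.
  have h : measurable_fun setT (fun x : R => (x, u)) by exact: measurable_fun_pair.
  exact: (measurableT_comp (measurable_ker_joint t) h).
- by move=> x; rewrite RposE => /ltW x0; rewrite ltW// ker_gt0.
- by rewrite mulr_ge0 ?gamma_pdf_ge0.
Qed.

Lemma smart_path_lawE t (A : set R) : 0 < t < 1 -> measurable A ->
  smart_path_law mu a l t A = (\int[leb]_(u in A `&` Rpos) (gam u * dens t u)%:E)%E.
Proof.
move=> t01 mA; rewrite /smart_path_law.
have mI : measurable_fun setT (\1_A : R -> R) by exact: measurable_indic.
transitivity (\int[mu]_(x in Rpos) \int[leb]_u ((\1_A u : R) * (gam u * ker t x u))%:E)%E.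
  apply: eq_integral => x; rewrite in_Rpos => /ltW x0.
  rewrite integral_ker_mixture//.
  by apply: eq_eseriesr => k _; rewrite cond_law_gamma_pdf.
rewrite integral_path// [RHS]integral_mkcondl; apply: eq_integral => u _.
by rewrite patchE indicE; case: ifPn => uA; rewrite ?mul1r ?mul0r.
Qed.

Lemma measurable_dens t : 0 < t < 1 -> measurable_fun Rpos (dens t).
Proof.
move=> t01; apply: measurable_continuous_Rpos => u u0.
apply/differentiable_continuous/derivable1_diffP.
by case: (is_derive_dens_u mu a12 l0 t01 u0).
Qed.

Lemma measurable_gam_dens t : 0 < t < 1 -> measurable_fun setT (fun u => gam u * dens t u).
Proof.
move=> t01; apply: measurable_fun_Rpos_setT; last first.
  by move=> u u0; rewrite gamma_pdf_out ?mul0r.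
apply: measurable_funM; last exact: measurable_dens.
by apply: measurable_funTS; exact: measurable_gamma_pdf.
Qed.

Lemma is_density_dens t : 0 < t < 1 ->
  is_density (smart_path_law mu a l t) (fun u => gam u * dens t u).
Proof.
move=> t01; split; first exact: measurable_gam_dens.
split; last by move=> A mA; exact: smart_path_lawE.
move=> u; have [u0|u0] := ltP 0 u; last first.
  by rewrite gamma_pdf_out ?mul0r//; apply/negP; rewrite -leNgt.
by rewrite mulr_ge0 ?gamma_pdf_ge0// ltW// dens_gt0// ltW.
Qed.

Definition Dent t : \bar R :=
  (\int[leb]_(u in Rpos) (gam u * phi (dens t u))%:E)%E.

Lemma Dent_ge0 t : 0 < t < 1 -> (0 <= Dent t)%E.
Proof.
move=> t01; apply: integral_ge0 => u; rewrite RposE => /ltW u0.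
by rewrite lee_fin mulr_ge0 ?gamma_pdf_ge0// phi_ge0// ltW// dens_gt0.
Qed.

(** The factor exp(-theta (x + u)) is dropped and 2 sqrt(x u) <= x + u is used. The result is linear
    in x and u, with coefficients that vanish as t -> 0. *)
Lemma ln_ker_le t x u : 0 < t < 1 -> 0 <= x -> 0 <= u ->
  ln (ker t x u) <= - a * ln (1 - t) + Num.sqrt (bcoef t) * (x + u).
Proof.
move=> t01 x0 u0; have t1 : 0 < 1 - t by case/andP: t01; rewrite subr_gt0.
have b0 := bcoef_gt0 l0 t01; have th0 := theta_gt0 l0 t01.
rewrite -(ln_powR (1 - t)) -[X in _ + X]expRK -lnM ?posrE ?powR_gt0 ?expR_gt0//.
rewrite ler_ln ?posrE ?ker_gt0// ?mulr_gt0 ?powR_gt0 ?expR_gt0//.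
rewrite /ker -mulrA ler_wpM2l ?powR_ge0//.
have bxu : 0 <= bcoef t * (x * u) by rewrite (mulr_ge0 (ltW b0))// mulr_ge0.
apply: (@le_trans _ _ (1 * expR (2 * Num.sqrt (bcoef t * (x * u))))).
  apply: ler_pM; rewrite ?expR_ge0//.
  - exact: hyp01_ge0.
  - rewrite -[leRHS]expR0 ler_expR oppr_le0 (mulr_ge0 (ltW th0))//.
    exact: addr_ge0.
  - exact: hyp01_le_expR.
rewrite mul1r ler_expR sqrtrM ?(ltW b0)// mulrCA ler_wpM2l ?sqrtr_ge0//.
rewrite sqrtrM//; have := sqr_ge0 (Num.sqrt x - Num.sqrt u).
by rewrite sqrrB !sqr_sqrtr//; lra.
Qed.

(** Entropy of one conditional law: [ln_ker_le] is integrated against the kernel, whose mass and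
    mean are known. The terms - y + 1 of [phi] are moved across the inequality so that both
    integrands stay nonnegative. *)
Lemma integral_ker_entropy t x : 0 < t < 1 -> 0 <= x ->
  (\int[leb]_(u in Rpos) (gam u * phi (ker t x u))%:E <=
   (- a * ln (1 - t) + Num.sqrt (bcoef t) * (x + ((1 - t) * (a / l) + t * x)))%:E)%E.
Proof.
move=> t01 x0.
have mR := @measurable_Rpos R.
have t1 : 0 < 1 - t <= 1 by case/andP: t01 => *; apply/andP; split; lra.
have A0 : 0 <= - a * ln (1 - t).
  by rewrite mulNr -mulrN mulr_ge0 ?(ltW a0)// oppr_ge0 ln_le0//; case/andP: t1.
pose k := Num.sqrt (bcoef t); have k0 : 0 <= k by exact: sqrtr_ge0.
set A := - a * ln (1 - t) in A0 *.
have mg : measurable_fun Rpos gam by apply: measurable_funTS; exact: measurable_gamma_pdf.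
have mk : measurable_fun Rpos (ker t x).
  apply: measurable_funTS.
  have h : measurable_fun setT (fun u : R => (x, u)) by exact: measurable_fun_pair.
  exact: (measurableT_comp (measurable_ker_joint t) h).
have mgk : measurable_fun Rpos (fun u => gam u * ker t x u) by exact: measurable_funM.
have mgp : measurable_fun Rpos (fun u => gam u * phi (ker t x u)).
  by apply: measurable_funM => //; apply: (measurableT_comp (@measurable_phi R)).
have gk0 u : Rpos u -> 0 <= gam u * ker t x u.
  by rewrite RposE => /ltW u0; rewrite mulr_ge0 ?gamma_pdf_ge0// ltW// ker_gt0.
have gp0 u : Rpos u -> 0 <= gam u * phi (ker t x u).
  by rewrite RposE => /ltW u0; rewrite mulr_ge0 ?gamma_pdf_ge0// phi_ge0// ltW// ker_gt0.
have I1 : (\int[leb]_(u in Rpos) (gam u * ker t x u)%:E = 1)%E.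
  rewrite integral_Rpos_setT ?integral_ker// => u u0.
  by rewrite gamma_pdf_out ?mul0r.
have I2 : (\int[leb]_(u in Rpos) (`|u| * (gam u * ker t x u))%:E =
    ((1 - t) * (a / l) + t * x)%:E)%E.
  rewrite integral_Rpos_setT ?integral_ker_id// => u u0.
  by rewrite gamma_pdf_out ?mul0r ?mulr0.
have mid : measurable_fun Rpos (fun u : R => `|u| * (gam u * ker t x u)).
  by apply: measurable_funM => //; apply: measurable_funTS.
have id0 (u : R) : Rpos u -> 0 <= `|u| * (gam u * ker t x u).
  by move=> u0; rewrite mulr_ge0 ?gk0.
have : (\int[leb]_(u in Rpos) (gam u * phi (ker t x u) + gam u * ker t x u)%:E <=
  \int[leb]_(u in Rpos) ((A + k * x) * (gam u * ker t x u) +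
      (k * (`|u| * (gam u * ker t x u)) + gam u))%:E)%E.
  have Akx : 0 <= A + k * x by rewrite addr_ge0// mulr_ge0.
  apply: ge0_le_integral_real => //.
  - exact: measurable_funD.
  - by apply: measurable_funD; [exact: measurable_funM|apply: measurable_funD => //; exact: measurable_funM].
  - by move=> u u0; rewrite addr_ge0 ?gk0 ?gp0.
  - move=> u; rewrite RposE => u0; have := ln_ker_le t01 x0 (ltW u0).
    have ku := ker_gt0 a0 l0 t01 x0 (ltW u0).
    rewrite -/A -/k (gtr0_norm u0) => h.
    have g0 : 0 <= gam u by rewrite gamma_pdf_ge0.
    have := ler_wpM2l (mulr_ge0 g0 (ltW ku)) h; rewrite /phi; lra.
rewrite ge0_integralD_real// I1 ge0_integralD_real//; last 4 first.
- exact: measurable_funM.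
- by apply: measurable_funD => //; exact: measurable_funM.
- by move=> u u0; rewrite mulr_ge0 ?gk0// addr_ge0// mulr_ge0.
- by move=> u u0; rewrite addr_ge0 ?gamma_pdf_ge0// mulr_ge0 ?id0.
rewrite ge0_integralD_real//; last 3 first.
- exact: measurable_funM.
- by move=> u u0; rewrite mulr_ge0 ?id0.
- by move=> u u0; rewrite gamma_pdf_ge0.
rewrite !ge0_integralZl_real//; last by rewrite addr_ge0// mulr_ge0.
rewrite I1 I2 integral_gamma_pdf// mule1 -EFinM -!EFinD.
move: (\int[leb]_(u in Rpos) (gam u * phi (ker t x u))%:E)%E => [s| |] //=.
- by rewrite -EFinD !lee_fin -/k; lra.
- by move=> _; exact: leNye.
Qed.

Lemma measurable_gam_phi t : 0 < t < 1 ->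
  measurable_fun Rpos (fun u => gam u * phi (dens t u)).
Proof.
move=> t01; apply: measurable_funM.
  by apply: measurable_funTS; exact: measurable_gamma_pdf.
by apply: (measurableT_comp (@measurable_phi R)); exact: measurable_dens.
Qed.

(** By convexity, the entropy of the mixture over X is at most the mean entropy of the conditional
    laws, which is controlled linearly in x. The bound serves twice: it vanishes as t -> 0, and it
    is uniform on compact time intervals, where it controls the error of the cutoff. *)
Lemma Dent_le t : 0 < t < 1 ->
  (\int[mu]_(x in Rpos) x%:E = (a / l)%:E)%E ->
  (Dent t <= (- a * ln (1 - t) + Num.sqrt (bcoef t) * (2 * (a / l)))%:E)%E.
Proof.
move=> t01 EX; have mR := @measurable_Rpos R.
have t1 : 0 < 1 - t <= 1 by case/andP: t01 => *; apply/andP; split; lra.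
have A0 : 0 <= - a * ln (1 - t).
  by rewrite mulNr -mulrN mulr_ge0 ?(ltW a0)// oppr_ge0 ln_le0//; case/andP: t1.
pose k := Num.sqrt (bcoef t); have k0 : 0 <= k by exact: sqrtr_ge0.
have mk := measurable_ker_joint t.
have mkx u : measurable_fun Rpos (fun x => ker t x u).
  apply: measurable_funTS.
  have h : measurable_fun setT (fun x : R => (x, u)) by exact: measurable_fun_pair.
  exact: (measurableT_comp mk h).
have mgp : measurable_fun setT (fun p : R * R => gam p.2 * phi (ker t p.1 p.2)).
  apply: measurable_funM.
    by apply: (measurableT_comp (@measurable_gamma_pdf R a l)); exact: measurable_snd.
  exact: (measurableT_comp (@measurable_phi R) mk).
have gp0 x u : Rpos x -> Rpos u -> 0 <= gam u * phi (ker t x u).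
  rewrite !RposE => /ltW x0 /ltW u0.
  by rewrite mulr_ge0 ?gamma_pdf_ge0// phi_ge0// ltW// ker_gt0.
have al0 : 0 <= a / l by rewrite divr_ge0 ?ltW.
apply: (@le_trans _ _ (\int[leb]_(u in Rpos) \int[mu]_(x in Rpos)
    (gam u * phi (ker t x u))%:E)%E).
  apply: ge0_le_integral => //.
  - move=> u; rewrite RposE => /ltW u0; rewrite lee_fin mulr_ge0 ?gamma_pdf_ge0//.
    by rewrite phi_ge0// ltW// dens_gt0.
  - by apply/measurable_EFinP; exact: measurable_gam_phi.
  - apply: (@measurable_tonelli_on2 _ _ _ _ _ mu Rpos Rpos
      (fun p => (gam p.2 * phi (ker t p.1 p.2))%:E)) => //.
    by apply/measurable_EFinP; apply: measurable_funTS.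
  - move=> u; rewrite RposE => u0; rewrite ge0_integralZl_real//; last 3 first.
    + by apply: (measurableT_comp (@measurable_phi R)).
    + by move=> x; rewrite RposE => /ltW x0; rewrite phi_ge0// ltW// ker_gt0// ltW.
    + exact: gamma_pdf_ge0.
    rewrite EFinM lee_wpmul2l ?lee_fin ?gamma_pdf_ge0//.
    have h := @phi_jensen _ _ R mu Rpos (fun=> 1) (fun x => ker t x u) (dens t u) mR.
    apply: le_trans (h _ _ _ _ _ _ _) _ => //.
    + by move=> x; rewrite RposE => /ltW x0; rewrite ltW// ker_gt0// ltW.
    + by rewrite dens_gt0// ltW.
    + have e : (\int[mu]_(x in Rpos) 1%:E = mu Rpos)%E.
        by rewrite integral_cst// mul1e.
      by rewrite e mupos.
    + rewrite EFin_dens ?(ltW u0)//; apply: eq_integral => x _; by rewrite mul1r.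
    + rewrite (_ : (\int[mu]_(x in Rpos) (1 * phi (ker t x u))%:E =
        \int[mu]_(x in Rpos) (phi (ker t x u))%:E)%E)//.
      by apply: eq_integral => x _; rewrite mul1r.
have -> : (\int[leb]_(u in Rpos) \int[mu]_(x in Rpos) (gam u * phi (ker t x u))%:E =
   \int[mu]_(x in Rpos) \int[leb]_(u in Rpos) (gam u * phi (ker t x u))%:E)%E.
  apply/esym; apply: (@tonelli_on _ _ _ _ _ mu leb Rpos Rpos
    (fun p => (gam p.2 * phi (ker t p.1 p.2))%:E)) => //.
  by apply/measurable_EFinP; apply: measurable_funTS.
apply: (@le_trans _ _ (\int[mu]_(x in Rpos)
    ((- a * ln (1 - t) + k * ((1 - t) * (a / l))) + (k * (1 + t)) * x)%:E)%E).
  apply: ge0_le_integral => //.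
  - by move=> x x0; apply: integral_ge0 => u u0; rewrite lee_fin gp0.
  - apply: (@measurable_tonelli_on1 _ _ _ _ _ leb Rpos Rpos
      (fun p => (gam p.2 * phi (ker t p.1 p.2))%:E)) => //.
    by apply/measurable_EFinP; apply: measurable_funTS.
  - apply/measurable_EFinP; apply: measurable_funD => //; exact: measurable_funM.
  - move=> x; rewrite RposE => /ltW x0.
    apply: le_trans (integral_ker_entropy t01 x0) _.
    by rewrite lee_fin -/k; lra.
have kt0 : 0 <= k * (1 + t) by case/andP: t01 => *; rewrite mulr_ge0//; lra.
have B0 : 0 <= - a * ln (1 - t) + k * ((1 - t) * (a / l)).
  by rewrite addr_ge0// mulr_ge0// mulr_ge0// ltW//; case/andP: t1.
rewrite ge0_integralD_real//; last first.
  by move=> x; rewrite RposE => /ltW x0; rewrite mulr_ge0.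
rewrite integral_cst// ge0_integralZl_real//; last first.
  by move=> x; rewrite RposE => /ltW.
rewrite EX.
have -> : ((- a * ln (1 - t) + k * ((1 - t) * (a / l)))%:E * mu Rpos =
   (- a * ln (1 - t) + k * ((1 - t) * (a / l)))%:E)%E by rewrite mupos mule1.
by rewrite -EFinM -EFinD lee_fin -/k; lra.
Qed.

End PathLaw.

(** * Integration by parts with a cutoff *)

Section Flux.
Variable R : realType.
Variables (a l : R) (mu : probability R R).
Hypotheses (a12 : 1 / 2 <= a) (l0 : 0 < l) (mupos : mu Rpos = 1%E).
Local Notation theta := (theta l).
Local Notation bcoef := (bcoef l).
Local Notation dens := (dens a l mu).
Local Notation dens_u := (dens_u a l mu).
Local Notation dens_t := (dens_t a l mu).
Local Notation Hf := (Hf l mu).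
Local Notation gam := (gamma_pdf a l).
Local Notation leb := (@lebesgue_measure R).
Implicit Types (c t x u n N : R) (i : nat).

Let a0 : 0 < a. Proof. by rewrite (lt_le_trans _ a12). Qed.
Let a112 : 1 / 2 <= a + 1. Proof. by rewrite (le_trans a12)// lerDl. Qed.
Let a212 : 1 / 2 <= a + 1 + 1. Proof. by rewrite (le_trans a112)// lerDl. Qed.

(* The cutoff [cut N] vanishes to second order at [expR N - 1], and its logarithmic
   shape makes its image [Lcut N] under the Laguerre generator O(1/N) on the whole
   interval, so that no decay of the density at infinity is needed. *)
Definition cutp N u : R := 1 - ln (1 + u) / N.
Definition cut N u : R := cutp N u ^+ 2.
Definition cut1 N u : R := - (2 * cutp N u / (N * (1 + u))).
Definition cut2 N u : R := 2 / (N * (1 + u)) ^+ 2 + 2 * cutp N u / (N * (1 + u) ^+ 2).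
Definition Lcut N u : R := u * cut2 N u + (a - l * u) * cut1 N u.

Lemma is_derive_cutp N u : 0 < u -> N != 0 ->
  is_derive u 1 (cutp N) (- (N * (1 + u))^-1).
Proof.
move=> u0 N0; have u1 : 0 < 1 + u by rewrite addr_gt0.
have h1 : is_derive u 1 (fun u : R => 1 + u) 1.
  exact: (is_derive_eq (is_deriveD (@is_derive_cst _ _ _ (1 : R) u 1) (@is_derive_id _ _ u 1)) (add0r 1)).
have h2 := @is_derive1_comp R (@ln R) (fun u => 1 + u) u _ _ (is_derive1_ln u1) h1.
have h3 : is_derive u 1 (fun u : R => N^-1 * ln (1 + u)) (N^-1 * (1 + u)^-1).
  have h4 := @is_deriveZ _ _ _ (@ln R \o (fun u : R => 1 + u)) N^-1 _ _ _ h2.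
  by apply: (is_derive_eq h4); rewrite /GRing.scale/= mulr1.
have -> : cutp N = (fun u : R => 1 - N^-1 * ln (1 + u)).
  by apply/funext => v; rewrite /cutp mulrC.
by apply: is_derive_eq; rewrite invfM; ring.
Qed.

Lemma is_derive_cut N u : 0 < u -> N != 0 -> is_derive u 1 (cut N) (cut1 N u).
Proof.
move=> u0 N0; have h := is_derive_cutp u0 N0.
have -> : cut N = cutp N ^+ 2 by apply/funext => v; rewrite exprfctE.
apply: (is_derive_eq (is_deriveX 2 h)); rewrite /cut1 /GRing.scale/= expr1.
by rewrite mulrN.
Qed.

Lemma is_derive_cut1 N u : 0 < u -> N != 0 -> is_derive u 1 (cut1 N) (cut2 N u).
Proof.
move=> u0 N0; have u1 : 0 < 1 + u by rewrite addr_gt0.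
have h := is_derive_cutp u0 N0.
have h1 : is_derive u 1 (fun u : R => N * (1 + u)) N.
  by apply: is_derive_eq; rewrite add0r /GRing.scale/= mulr1.
have nz : N * (1 + u) != 0 by rewrite mulf_neq0// gt_eqF.
have h2 := @is_deriveV R (fun u : R => N * (1 + u)) u _ 1 nz h1.
have h3 := is_deriveM h h2.
have h4 := @is_deriveZ _ _ _ _ (- 2) _ _ _ h3.
have -> : cut1 N = (- 2 \*: (cutp N * (fun u : R => (N * (1 + u))^-1))).
  apply/funext => v; transitivity (- 2 * (cutp N v * (N * (1 + v))^-1)) => //.
  by rewrite /cut1; ring.
apply: (is_derive_eq h4); rewrite /cut2 /GRing.scale/=.
by field; rewrite N0 gt_eqF.
Qed.

Lemma cutp_ge0 N u : 0 < N -> 0 <= u -> u <= expR N - 1 -> 0 <= cutp N u <= 1.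
Proof.
move=> N0 u0 uU; have u1 : 0 < 1 + u by rewrite ltr_pwDl.
apply/andP; split.
  rewrite subr_ge0 ler_pdivrMr// mul1r -[leRHS]expRK ler_ln ?posrE ?expR_gt0//.
  by rewrite addrC -lerBrDr.
by rewrite gerBl divr_ge0 ?(ltW N0)// ln_ge0// lerDl.
Qed.

Lemma cut_itv N u : 0 < N -> 0 <= u -> u <= expR N - 1 -> 0 <= cut N u <= 1.
Proof.
move=> N0 u0 uU; have /andP[h1 h2] := cutp_ge0 N0 u0 uU.
by rewrite exprn_ge0//= exprn_ile1.
Qed.

Lemma cut_end N : N != 0 -> cut N (expR N - 1) = 0 /\ cut1 N (expR N - 1) = 0.
Proof.
move=> N0; have h : cutp N (expR N - 1) = 0.
  by rewrite /cutp (_ : 1 + (expR N - 1) = expR N) ?expRK ?divff ?subrr//; ring.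
by rewrite /cut /cut1 h expr0n/= mulr0 mul0r oppr0.
Qed.

(** The logarithm makes [cut1] carry a factor 1 / (1 + u), which offsets the linear growth of the
    drift: |a - l u| / (1 + u) <= a + l. The other factors u / (1 + u), 1 / (1 + u), 1 / N and
    [cutp] lie in [0, 1], so the two second-order terms contribute at most 2 each. *)
Lemma Lcut_le N u : 1 <= N -> 0 <= u -> u <= expR N - 1 ->
  `|Lcut N u| <= (4 + 2 * a + 2 * l) / N.
Proof.
move=> N1 u0 uU; have N0 : 0 < N by rewrite (lt_le_trans _ N1).
have /andP[p0 p1] := cutp_ge0 N0 u0 uU.
have u1 : 1 <= 1 + u by rewrite lerDl.
have u10 : 0 < 1 + u by rewrite (lt_le_trans _ u1).
rewrite /Lcut; set p := cutp N u in p0 p1 *.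
have -> : u * cut2 N u + (a - l * u) * cut1 N u =
   (2 * (u / (1 + u)) / (1 + u) / N + 2 * p * (u / (1 + u)) / (1 + u)
     - 2 * p * ((a - l * u) / (1 + u))) / N.
  rewrite /cut1 /cut2 -/p; field.
  by rewrite !gt_eqF.
rewrite normrM [X in _ * X]gtr0_norm ?invr_gt0// ler_wpM2r ?invr_ge0 ?(ltW N0)//.
have q01 : 0 <= u / (1 + u) <= 1.
  by rewrite divr_ge0 ?(ltW u10)//= ler_pdivrMr// mul1r lerDr.
have i01 : 0 <= (1 + u)^-1 <= 1.
  by rewrite invr_ge0 (ltW u10)/= invf_le1.
have N01 : 0 <= N^-1 <= 1 by rewrite invr_ge0 (ltW N0)/= invf_le1.
have r1 : `|(a - l * u) / (1 + u)| <= a + l.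
  rewrite normrM [X in _ * X]gtr0_norm ?invr_gt0// ler_pdivrMr//.
  apply: le_trans (ler_normB _ _) _.
  rewrite (gtr0_norm a0) ger0_norm ?mulr_ge0 ?(ltW l0)//.
  by have := mulr_ge0 (ltW a0) u0; have := ltW l0; nra.
have prod01 (x y : R) : 0 <= x <= 1 -> 0 <= y <= 1 -> 0 <= x * y <= 1.
  by move=> /andP[x0 x1] /andP[y0 y1]; rewrite mulr_ge0//= mulr_ile1.
have p01 : 0 <= p <= 1 by rewrite p0.
have A1 := prod01 _ _ (prod01 _ _ q01 i01) N01.
have A2 := prod01 _ _ (prod01 _ _ p01 q01) i01.
have A3 : `|p * ((a - l * u) / (1 + u))| <= a + l.
  rewrite normrM ger0_norm//; apply: le_trans r1.
  by rewrite ler_piMl.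
move: A3; rewrite ler_norml => /andP[A31 A32].
case/andP: A1 => A11 A12; case/andP: A2 => A21 A22.
rewrite ler_norml; apply/andP; split; lra.
Qed.

(** [gamx] is the gamma density without its case distinction, hence differentiable by formula.
    [wgt], which is u times it for u > 0, puts the Laguerre operator in divergence form: (wgt h')' =
    gamx (u h'' + (a - l u) h'). *)
Definition gamC : R := l `^ a / GammaR a.
Definition wgt u : R := gamC * (u `^ a * expR (- (l * u))).
Definition gamx u : R := gamC * (u `^ (a - 1) * expR (- (l * u))).

Lemma gamxE u : 0 < u -> gam u = gamx u.
Proof. by move=> u0; rewrite /gamma_pdf u0 /gamx /gamC mulrA. Qed.

Lemma wgtE u : 0 < u -> wgt u = u * gamx u.
Proof.
move=> u0; rewrite /wgt /gamx -(mulr_powRB1 (ltW u0) a0); ring.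
Qed.

Lemma is_derive_wgt u : 0 < u -> is_derive u 1 wgt ((a - l * u) * gamx u).
Proof.
move=> u0; have h := is_derive1_powR a u0.
have h1 : is_derive u 1 (fun u : R => - (l * u)) (- l).
  by apply: is_derive_eq; rewrite /GRing.scale/= mulr1.
have h2 := @is_derive1_comp R expR (fun u => - (l * u)) u _ _ (is_derive_expR _) h1.
have h4 := @is_deriveZ _ _ _ _ gamC _ _ _ (is_deriveM h h2).
apply: (is_derive_eq h4); rewrite /gamx /GRing.scale/=.
rewrite -{1}(mulr_powRB1 (ltW u0) a0); ring.
Qed.

Lemma is_derive_phi (y : R) : 0 < y -> is_derive y 1 (@phi R) (ln y).
Proof.
move=> y0; have h := is_derive1_ln y0.
have h1 := is_deriveM (@is_derive_id _ _ y 1) h.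
have h2 := is_deriveD (is_deriveB h1 (@is_derive_id _ _ y 1)) (@is_derive_cst _ _ _ (1 : R) y 1).
by apply: (is_derive_eq h2); rewrite /GRing.scale/=; field; rewrite gt_eqF.
Qed.

(* Boundary term of the two integrations by parts against [cut N]. *)
Definition flux N t u : R :=
  cut N u * (ln (dens t u) * (wgt u * dens_u t u)) - cut1 N u * (wgt u * phi (dens t u)).

Definition fisher t u : R := u * (dens_u t u ^+ 2 / dens t u).

Definition fluxd N t u : R :=
  cut N u * (gamx u * fisher t u)
  - l * t * (cut N u * (gamx u * (ln (dens t u) * dens_t t u)))
  - Lcut N u * (gamx u * phi (dens t u)).

(** The divergence form yields the Fisher term, from differentiating the logarithm, and ln h times
    the Laguerre operator of h, which the heat equation turns into a time derivative. The term cut'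
    ln h wgt h' cancels against the derivative of phi(h) in the second summand, since phi' = ln;
    what remains there is [Lcut]. *)
Lemma is_derive_flux N t u : N != 0 -> 0 < t < 1 -> 0 < u ->
  is_derive u 1 (flux N t) (fluxd N t u).
Proof.
move=> N0 t01 u0.
have h0 := dens_gt0 a12 l0 mupos t01 (ltW u0).
have dc := is_derive_cut u0 N0; have dc1 := is_derive_cut1 u0 N0.
have dw := is_derive_wgt u0.
have dh := is_derive_dens_u mu a12 l0 t01 u0.
have dh1 := is_derive_dens_uu mu a12 l0 t01 u0.
have dl := @is_derive1_comp R (@ln R) (dens t) u _ _ (is_derive1_ln h0) dh.
have dp := @is_derive1_comp R (@phi R) (dens t) u _ _ (is_derive_phi h0) dh.
have d1 := is_deriveM dc (is_deriveM dl (is_deriveM dw dh1)).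
have d2 := is_deriveM dc1 (is_deriveM dw dp).
apply: (is_derive_eq (is_deriveB d1 d2)).
have heat := dens_heat mu a12 l0 t01 (ltW u0).
have e : dens_uu a l mu t u =
    (- (l * t) * dens_t t u - (a - l * u) * dens_u t u) / u.
  by rewrite heat addrK mulrAC divff ?mul1r// gt_eqF.
rewrite /GRing.scale/= !mulrfctE !compE e /fluxd /fisher /Lcut wgtE//.
by field; rewrite !gt_eqF.
Qed.

Lemma continuous_is_derive (f : R -> R) u d : is_derive u 1 f d -> {for u, continuous f}.
Proof. by move=> h; apply/differentiable_continuous/derivable1_diffP; case: h. Qed.

Lemma continuous_Hf_u i c t u : 1 / 2 <= c -> 0 < t < 1 -> 0 < u ->
  {for u, continuous (Hf i c t)}.
Proof. by move=> c12 t01 u0; exact: (continuous_is_derive (is_derive_Hf_u mu l0 i c12 t01 u0)). Qed.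

Lemma continuous_dens_t_u t u : 0 < t < 1 -> 0 < u -> {for u, continuous (dens_t t)}.
Proof.
move=> t01 u0; have cH := continuous_Hf_u.
apply: cvgM; first exact: (continuous_is_derive (is_derive_prefac_u a l t u)).
apply: cvgD.
  apply: cvgM; last exact: cH.
  by apply: cvgB; [exact: cvg_cst|apply: cvgMr; exact: cvg_id].
apply: cvgB; last by apply: cvgMr; exact: cH.
apply: cvgM; last exact: cH.
by apply: cvgMl; apply: cvgMr; exact: cvg_id.
Qed.

Lemma continuous_dens_u t u : 0 < t < 1 -> 0 < u -> {for u, continuous (dens t)}.
Proof. by move=> t01 u0; exact: (continuous_is_derive (is_derive_dens_u mu a12 l0 t01 u0)). Qed.

Lemma continuous_ln_dens_u t u : 0 < t < 1 -> 0 < u ->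
  {for u, continuous (fun u => ln (dens t u))}.
Proof.
move=> t01 u0; apply: (@continuous_comp _ _ _ (dens t) (@ln R)).
  exact: continuous_dens_u.
by apply: continuous_ln; apply: dens_gt0 => //; exact: ltW.
Qed.

Lemma continuous_phi (y : R) : 0 < y -> {for y, continuous (@phi R)}.
Proof. by move=> y0; exact: (continuous_is_derive (is_derive_phi y0)). Qed.

Lemma continuous_phi_dens_u t u : 0 < t < 1 -> 0 < u ->
  {for u, continuous (fun u => phi (dens t u))}.
Proof.
move=> t01 u0; apply: (@continuous_comp _ _ _ (dens t) (@phi R)).
  exact: continuous_dens_u.
by apply: continuous_phi; apply: dens_gt0 => //; exact: ltW.
Qed.

Lemma continuous_gamx u : 0 < u -> {for u, continuous gamx}.
Proof. by move=> u0; apply: cvgMr; exact: continuous_gammaI. Qed.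

Lemma continuous_cut N u : N != 0 -> 0 < u -> {for u, continuous (cut N)}.
Proof. by move=> N0 u0; exact: (continuous_is_derive (is_derive_cut u0 N0)). Qed.

Lemma continuous_fisher t u : 0 < t < 1 -> 0 < u -> {for u, continuous (fisher t)}.
Proof.
move=> t01 u0; have h0 := dens_gt0 a12 l0 mupos t01 (ltW u0).
have c1 := continuous_is_derive (is_derive_dens_uu mu a12 l0 t01 u0).
apply: cvgM; first exact: cvg_id.
apply: cvgM.
  by apply: (@continuous_comp _ _ _ (dens_u t) (fun x => x ^+ 2)) => //; exact: exprn_continuous.
by apply: cvgV; [rewrite gt_eqF|exact: continuous_dens_u].
Qed.

Lemma continuous_Lcut N u : N != 0 -> 0 < u -> {for u, continuous (Lcut N)}.
Proof.
move=> N0 u0; have c1 := continuous_is_derive (is_derive_cut1 u0 N0).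
have cp := continuous_is_derive (is_derive_cutp u0 N0).
have u1 : 0 < 1 + u by rewrite addr_gt0.
have cu : {for u, continuous (fun u : R => 1 + u)} by apply: cvgD; [exact: cvg_cst|exact: cvg_id].
apply: cvgD; last first.
  by apply: cvgM => //; apply: cvgB; [exact: cvg_cst|apply: cvgMr; exact: cvg_id].
apply: cvgM; first exact: cvg_id.
apply: cvgD.
  apply: cvgMr; apply: cvgV; first by rewrite expf_neq0// mulf_neq0// gt_eqF.
  apply: (@continuous_comp _ _ _ (fun u : R => N * (1 + u)) (fun x => x ^+ 2)).
    by apply: cvgMr.
  exact: exprn_continuous.
apply: cvgM; first by apply: cvgMr.
apply: cvgV; first by rewrite mulf_neq0// expf_neq0// gt_eqF.
apply: cvgMr; apply: (@continuous_comp _ _ _ (fun u : R => 1 + u) (fun x => x ^+ 2)) => //.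
exact: exprn_continuous.
Qed.

Lemma continuous_fluxd N t u : N != 0 -> 0 < t < 1 -> 0 < u ->
  {for u, continuous (fluxd N t)}.
Proof.
move=> N0 t01 u0; have cc := continuous_cut N0 u0; have cg := continuous_gamx u0.
apply: cvgB; first apply: cvgB.
- apply: cvgM => //; apply: cvgM => //; exact: continuous_fisher.
- apply: cvgMr; apply: cvgM => //; apply: cvgM => //; apply: cvgM.
    exact: continuous_ln_dens_u.
  exact: continuous_dens_t_u.
- apply: cvgM; first exact: continuous_Lcut.
  by apply: cvgM => //; exact: continuous_phi_dens_u.
Qed.

End Flux.

(** * Bounds on compact sets of times and positions *)

Section LocalBounds.
Variable R : realType.
Variables (a l : R) (mu : probability R R).
Hypotheses (a12 : 1 / 2 <= a) (l0 : 0 < l) (mupos : mu Rpos = 1%E).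
Local Notation theta := (theta l).
Local Notation bcoef := (bcoef l).
Local Notation dens := (dens a l mu).
Local Notation dens_u := (dens_u a l mu).
Local Notation dens_t := (dens_t a l mu).
Local Notation Hf := (Hf l mu).
Implicit Types (c t x u n : R) (i : nat).

Let a0 : 0 < a. Proof. by rewrite (lt_le_trans _ a12). Qed.
Let a112 : 1 / 2 <= a + 1. Proof. by rewrite (le_trans a12)// lerDl. Qed.

Variables (t1 t2 n : R).
Hypotheses (t10 : 0 < t1) (t12 : t1 <= t2) (t21 : t2 < 1) (n0 : 0 <= n).

Let S t := t1 <= t <= t2.
Let I u := 0 <= u <= n.

Let S01 t : S t -> 0 < t < 1.
Proof. by move=> /andP[h1 h2]; rewrite (lt_le_trans t10 h1) (le_lt_trans h2 t21). Qed.

(** Only existence of a bound matters, so the predicate is closed under ring operations and the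
    closed forms of the derivatives are treated factor by factor. The range of u includes 0, where
    the boundary flux has to be controlled. *)
Definition bnd (f : R -> R -> R) := exists C, forall t u, S t -> I u -> `|f t u| <= C.

Lemma bnd_cst c : bnd (fun _ _ => c). Proof. by exists `|c|. Qed.

Lemma bndD f g : bnd f -> bnd g -> bnd (fun t u => f t u + g t u).
Proof.
move=> [C hC] [D hD]; exists (C + D) => t u St Iu.
by apply: le_trans (ler_normD _ _) _; rewrite lerD ?hC ?hD.
Qed.

Lemma bndN f : bnd f -> bnd (fun t u => - f t u).
Proof. by move=> [C hC]; exists C => t u St Iu; rewrite normrN hC. Qed.

Lemma bndB f g : bnd f -> bnd g -> bnd (fun t u => f t u - g t u).
Proof. by move=> hf hg; apply: bndD => //; exact: bndN. Qed.

Lemma bndM f g : bnd f -> bnd g -> bnd (fun t u => f t u * g t u).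
Proof.
move=> [C hC] [D hD]; exists (C * D) => t u St Iu.
by rewrite normrM ler_pM ?hC ?hD.
Qed.

Lemma bndX f k : bnd f -> bnd (fun t u => f t u ^+ k).
Proof.
move=> hf; elim: k => [|k IH]; first exact: bnd_cst.
by under eq_fun2 do rewrite exprS; exact: bndM.
Qed.

Lemma bnd_id2 : bnd (fun _ u => u).
Proof. by exists n => t u _ /andP[u0 un]; rewrite ger0_norm. Qed.

Lemma bnd_id1 : bnd (fun t _ => t).
Proof. by exists 1 => t u /S01 /andP[t0 /ltW t1'] _; rewrite gtr0_norm. Qed.

Lemma bnd_inv : bnd (fun t _ => (1 - t)^-1).
Proof.
exists (1 - t2)^-1 => t u St _; have /andP[s0 s1] := S01 St.
rewrite gtr0_norm ?invr_gt0 ?subr_gt0// lef_pV2 ?posrE ?subr_gt0//.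
by rewrite lerD2l lerN2; case/andP: St.
Qed.

Lemma bnd_theta : bnd (fun t _ => theta t).
Proof. by apply: bndM bnd_inv; apply: bndM (bnd_cst _) bnd_id1. Qed.

Lemma bnd_invX k : bnd (fun t _ => (1 - t) ^- k).
Proof. by have := bndX k bnd_inv; under eq_fun2 do rewrite exprVn. Qed.

Lemma bnd_bcoef : bnd (fun t _ => bcoef t).
Proof. by apply: bndM (bnd_invX 2); apply: bndM (bnd_cst _) bnd_id1. Qed.

Lemma prefac_itv t u : S t -> I u -> expR (- (theta t2 * n)) <= prefac a l t u <= (1 - t2) `^ (- a).
Proof.
move=> St /andP[u0 un]; have /andP[s0 s1] := S01 St.
have St2 : t <= t2 by case/andP: St.
have th0 := theta_gt0 l0 (S01 St).
have th2 : theta t <= theta t2 by exact: theta_le.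
have p1 : 1 <= (1 - t) `^ (- a).
  rewrite powRN invf_ge1 ?powR_gt0 ?subr_gt0//.
  apply: (@le_trans _ _ (1 `^ a)); last by rewrite powR1.
  by rewrite ge0_ler_powR ?nnegrE ?(ltW a0)// ?subr_ge0 ?(ltW s1)// gerBl ltW.
rewrite /prefac; apply/andP; split.
  apply: (@le_trans _ _ (1 * expR (- (theta t * u)))).
    by rewrite mul1r ler_expR lerN2 ler_pM// ltW.
  by rewrite ler_wpM2r// expR_ge0.
apply: (@le_trans _ _ ((1 - t) `^ (- a) * 1)).
  rewrite ler_wpM2l ?powR_ge0// -expR0 ler_expR oppr_le0.
  by rewrite (mulr_ge0 (ltW th0)).
rewrite mulr1 !powRN lef_pV2 ?posrE ?powR_gt0 ?subr_gt0//.
by rewrite ge0_ler_powR ?nnegrE ?(ltW a0)// ?subr_ge0 ?(ltW s1) ?(ltW t21)// lerD2l lerN2.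
Qed.

Lemma bnd_prefac : bnd (prefac a l).
Proof.
exists ((1 - t2) `^ (- a)) => t u St Iu; have /andP[h1 h2] := prefac_itv St Iu.
by rewrite ger0_norm// (le_trans (expR_ge0 _) h1).
Qed.

Lemma bnd_Hf i c : 1 / 2 <= c -> bnd (fun t u => Hf i c t u).
Proof.
move=> c12; exists (Kbound l i t1 t2 n) => t u St Iu.
rewrite ger0_norm; last by apply: Hf_ge0; rewrite ?(lt_le_trans _ c12)// ?S01//; case/andP: Iu.
exact: Hf_le.
Qed.

Lemma bnd_dens : bnd dens.
Proof. by apply: bndM bnd_prefac _; exact: bnd_Hf. Qed.

Lemma bnd_dens_u : bnd dens_u.
Proof.
apply: bndM bnd_prefac _; apply: bndB; apply: bndM; try exact: bnd_Hf.
  by apply: bndM bnd_bcoef _; exact: bnd_cst.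
exact: bnd_theta.
Qed.

Lemma bnd_dens_t : bnd dens_t.
Proof.
apply: bndM bnd_prefac _; apply: bndD.
  apply: bndM; last exact: bnd_Hf.
  apply: bndB; first by apply: bndM (bnd_cst _) bnd_inv.
  by apply: bndM bnd_id2; apply: bndM (bnd_cst _) (bnd_invX 2).
apply: bndB; apply: bndM; try exact: bnd_Hf.
  apply: bndM (bnd_cst _); apply: bndM bnd_id2; apply: bndM (bnd_invX 3).
  by apply: bndM (bnd_cst _) _; apply: bndD (bnd_cst _) bnd_id1.
by apply: bndM (bnd_cst _) (bnd_invX 2).
Qed.

(** 0F1 is least at argument 0 among nonnegative ones, with value 1, and exp(-theta t x) decreases
    in t. The resulting positive lower bound for the density is what keeps its logarithm bounded. *)
Lemma Hf0_ge t u : S t -> I u -> Hf 0 a t2 0 <= Hf 0 a t u.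
Proof.
move=> St /andP[u0 un]; have t01 := S01 St; have mR := @measurable_Rpos R.
have t201 : 0 < t2 < 1 by rewrite t21 (lt_le_trans t10).
have /andP[_ tt2] := St.
rewrite -lee_fin !EFin_Hf//; apply: ge0_le_integral_real => //.
- exact: measurable_Kf.
- exact: measurable_Kf.
- by move=> x; rewrite RposE => /ltW x0; exact: Kf_ge0.
- move=> x; rewrite RposE => /ltW x0; rewrite /Kf !expr0 !mul1r mulr0 mulr0.
  apply: ler_pM; rewrite ?expR_ge0 ?hyp01_ge0//.
    by rewrite ler_expR lerN2 ler_wpM2r// theta_le.
  apply: (@le_trans _ _ 1).
    by apply: le_trans (hyp01_le_expR a12 (lexx 0)) _; rewrite sqrtr0 mulr0 expR0.
  by apply: hyp01_ge1 => //; rewrite (mulr_ge0 (ltW (bcoef_gt0 l0 t01)))// mulr_ge0.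
Qed.

Lemma dens_lower : exists2 c, 0 < c & forall t u, S t -> I u -> c <= dens t u.
Proof.
have t201 : 0 < t2 < 1 by rewrite t21 (lt_le_trans t10).
exists (expR (- (theta t2 * n)) * Hf 0 a t2 0).
  by rewrite mulr_gt0 ?expR_gt0// Hf_gt0.
move=> t u St Iu; have /andP[h1 h2] := prefac_itv St Iu.
apply: ler_pM; rewrite ?expR_ge0 ?(ltW (Hf_gt0 _ _ _ _ _ _))//.
exact: Hf0_ge.
Qed.

Lemma bnd_ln_dens : bnd (fun t u => ln (dens t u)).
Proof.
have [c c0 hc] := dens_lower; have [C hC] := bnd_dens.
exists (`|ln c| + `|ln C|) => t u St Iu.
have h1 := hc _ _ St Iu; have h0 := lt_le_trans c0 h1.
have h2 : dens t u <= C by apply: le_trans (hC _ _ St Iu); exact: ler_norm.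
have l1 : ln c <= ln (dens t u) by rewrite ler_ln ?posrE.
have l2 : ln (dens t u) <= ln C by rewrite ler_ln ?posrE// (lt_le_trans h0).
rewrite ler_norml; apply/andP; split.
  have := ler_norm (- ln c); have := normr_ge0 (ln C); rewrite normrN; lra.
apply: le_trans l2 _; apply: le_trans (ler_norm _) _.
by rewrite lerDr.
Qed.

Lemma bnd_phi_dens : bnd (fun t u => phi (dens t u)).
Proof.
apply: bndD (bnd_cst _); apply: bndB; last exact: bnd_dens.
by apply: bndM bnd_dens bnd_ln_dens.
Qed.

End LocalBounds.

(** * De Bruijn's identity with a cutoff and explicit errors *)

Section LocalDeBruijn.
Variable R : realType.
Variables (a l : R) (mu : probability R R).
Hypotheses (a12 : 1 / 2 <= a) (l0 : 0 < l) (mupos : mu Rpos = 1%E).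
Local Notation dens := (dens a l mu).
Local Notation dens_u := (dens_u a l mu).
Local Notation dens_t := (dens_t a l mu).
Local Notation gam := (gamma_pdf a l).
Local Notation gamx := (gamx a l).
Local Notation fisher := (fisher a l mu).
Local Notation fluxd := (fluxd a l mu).
Local Notation flux := (flux a l mu).
Local Notation Lcut := (Lcut a l).
Local Notation leb := (@lebesgue_measure R).
Implicit Types (t x u : R) (i : nat).

Let a0 : 0 < a. Proof. by rewrite (lt_le_trans _ a12). Qed.

Lemma measurable_inv_dens_joint :
  measurable_fun (@strip R) (fun p : R * R => (dens p.1 p.2)^-1).
Proof.
(* On positive arguments the inverse is the power -1, a measurable function of the base. *)
apply: (@eq_measurable_fun _ _ _ _ _ (fun p : R * R => dens p.1 p.2 `^ (- 1))).
  move=> [t u] /set_mem[/= t01 u0]; rewrite U01E in t01; rewrite RposE in u0.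
  by rewrite powR_inv1// ltW// dens_gt0// ltW.
exact: (measurableT_comp (measurable_powR _) (measurable_dens_joint _ a12 l0)).
Qed.

Lemma measurable_fisher_joint :
  measurable_fun (@strip R) (fun p : R * R => fisher p.1 p.2).
Proof.
apply: measurable_funM; first exact: measurable_snd_strip.
apply: measurable_funM; last exact: measurable_inv_dens_joint.
by apply: measurable_funX; exact: measurable_dens_u_joint.
Qed.

(** Removes the constant that was added to make an integrand nonnegative, in a form that tolerates
    an infinite [j]. *)
Lemma two_sided_shift (p q c d w : R) (j : \bar R) :
  ((q - p + c * w)%:E <= j + ((c + d) * w)%:E)%E ->
  (j + (c * w)%:E <= (q - p + c * w)%:E + (d * w)%:E)%E ->
  (q%:E <= p%:E + j + (d * w)%:E)%E /\ (p%:E + j <= q%:E + (d * w)%:E)%E.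
Proof.
case: j => [j| |] //=; rewrite -!EFinD !lee_fin => h1 h2; split; lra.
Qed.

Lemma measurable_snd_comp_strip (f : R -> R) : measurable_fun setT f ->
  measurable_fun (@strip R) (fun p : R * R => f p.2).
Proof.
move=> mf; apply: measurable_funTS; apply: (measurableT_comp mf).
exact: measurable_snd.
Qed.

Lemma measurable_gamx : measurable_fun setT gamx.
Proof.
apply: measurable_funM => //; apply: measurable_funM => //.
by apply: measurableT_comp => //; apply: measurableT_comp => //; exact: measurable_funM.
Qed.

Lemma measurable_cut (N : R) : measurable_fun setT (cut N).
Proof.
apply: measurable_funX; apply: measurable_funB => //; apply: measurable_funM => //.
by apply: measurableT_comp => //; exact: measurable_funD.
Qed.

Lemma measurable_lnD_joint :
  measurable_fun (@strip R) (fun p : R * R => ln (dens p.1 p.2) * dens_t p.1 p.2).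
Proof.
apply: measurable_funM; last exact: measurable_dens_t_joint.
exact: (measurableT_comp (@measurable_ln R) (measurable_dens_joint mu a12 l0)).
Qed.

Lemma gamx_ge0 u : 0 <= gamx u.
Proof.
rewrite mulr_ge0 ?mulr_ge0 ?powR_ge0 ?expR_ge0// invr_ge0 ltW//.
exact: GammaR_gt0.
Qed.

Lemma fisher_ge0 t u : 0 < t < 1 -> 0 <= u -> 0 <= fisher t u.
Proof.
by move=> t01 u0; rewrite mulr_ge0// divr_ge0 ?sqr_ge0// ltW// dens_gt0.
Qed.

Variables (t1 t2 N e : R).
Hypotheses (t10 : 0 < t1) (t12 : t1 < t2) (t21 : t2 < 1) (N1 : 1 <= N).
Hypotheses (e0 : 0 < e) (e1 : e <= 1).

Let U := expR N - 1.
Let I : set R := `[e, U]%classic.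
Let S : set R := `[t1, t2]%classic.

Let N0 : N != 0. Proof. by rewrite gt_eqF// (lt_le_trans _ N1). Qed.

Let eU : e < U.
Proof.
rewrite /U ltrBrDl; apply: (@le_lt_trans _ _ (1 + N)).
  by rewrite lerD2l (le_trans e1).
by apply: expR_gt1Dx.
Qed.

Let Ipos u : I u -> 0 < u.
Proof. by rewrite /I/= in_itv/= => /andP[eu _]; exact: lt_le_trans e0 eu. Qed.

Let IU u : I u -> 0 <= u <= U.
Proof. by move=> Iu; rewrite ltW ?Ipos//=; move: Iu; rewrite /I/= in_itv/= => /andP[]. Qed.

Let S01 t : S t -> 0 < t < 1.
Proof.
by rewrite /S/= in_itv/= => /andP[h1 h2]; rewrite (lt_le_trans t10 h1) (le_lt_trans h2 t21).
Qed.

Let mI : measurable I. Proof. exact: measurable_itv. Qed.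
Let mS : measurable S. Proof. exact: measurable_itv. Qed.

Let SI_strip : S `*` I `<=` @strip R.
Proof. by move=> [t u] [/= /S01 St /Ipos Iu]; split => /=; rewrite ?U01E ?RposE. Qed.

Let mstrip (f : R * R -> R) : measurable_fun (@strip R) f -> measurable_fun (S `*` I) f.
Proof. by move=> mf; apply: (measurable_funS _ SI_strip mf); exact: measurable_strip. Qed.

Let intI (f : R -> R) : (forall u, 0 < u -> {for u, continuous f}) ->
  leb.-integrable I (EFin \o f).
Proof.
move=> cf; apply: continuous_compact_integrable; first exact: segment_compact.
by apply: continuous_in_subspaceT => u /set_mem/Ipos; exact: cf.
Qed.

Let Int (f : R -> R) : R := \int[leb]_(u in I) f u.

Let EInt (f : R -> R) : (forall u, 0 < u -> {for u, continuous f}) ->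
  ((Int f)%:E = \int[leb]_(u in I) (f u)%:E)%E.
Proof.
move=> cf; rewrite /Int /Rintegral fineK//.
by apply: integrable_fin_num => //; exact: intI.
Qed.

Definition cutfisher t u := cut N u * (gamx u * fisher t u).
Definition cutprod t u := cut N u * (gamx u * (ln (dens t u) * dens_t t u)).
Definition cuterr t u := Lcut N u * (gamx u * phi (dens t u)).
Definition cutphi t u := cut N u * (gamx u * phi (dens t u)).

Let c_gamx u : 0 < u -> {for u, continuous gamx}.
Proof. exact: continuous_gamx. Qed.

Let c_fisher t u : 0 < t < 1 -> 0 < u -> {for u, continuous (cutfisher t)}.
Proof.
move=> t01 u0; apply: cvgM; first exact: continuous_cut.
by apply: cvgM; [exact: c_gamx|exact: continuous_fisher].
Qed.

Let c_prod t u : 0 < t < 1 -> 0 < u -> {for u, continuous (cutprod t)}.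
Proof.
move=> t01 u0; apply: cvgM; first exact: continuous_cut.
apply: cvgM; first exact: c_gamx.
by apply: cvgM; [exact: continuous_ln_dens_u|exact: continuous_dens_t_u].
Qed.

Let c_err t u : 0 < t < 1 -> 0 < u -> {for u, continuous (cuterr t)}.
Proof.
move=> t01 u0; apply: cvgM; first exact: continuous_Lcut.
by apply: cvgM; [exact: c_gamx|exact: continuous_phi_dens_u].
Qed.

Let c_phi t u : 0 < t < 1 -> 0 < u -> {for u, continuous (cutphi t)}.
Proof.
move=> t01 u0; apply: cvgM; first exact: continuous_cut.
by apply: cvgM; [exact: c_gamx|exact: continuous_phi_dens_u].
Qed.

Let cM (c : R) (f : R -> R) u : {for u, continuous f} -> {for u, continuous (fun u => c * f u)}.
Proof. by move=> cf; apply: cvgMr. Qed.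

Variables (C2 Db beta : R).
Hypothesis (C20 : 0 <= C2).
Hypothesis (hC2 : forall t u, S t -> 0 <= u <= U -> `|ln (dens t u) * dens_t t u| <= C2).
Hypothesis (hDb : forall t, S t -> (Dent a l mu t <= Db%:E)%E).
Hypothesis (hbeta : forall t, S t -> `|flux N t e| <= beta).

(** [kap] bounds [Lcut N], so [kap * Db] bounds the error caused by the cutoff, and [beta] the
    boundary flux at [e]; at [U] both the cutoff and its derivative vanish. The factor l t of the
    heat equation is at least l t1, hence the denominator of [del]. *)
Let kap := (4 + 2 * a + 2 * l) / N.
Let del := (kap * Db + beta) / (l * t1).

(* [C2] makes the integrand nonnegative, so that Tonelli applies. *)
Let G t u := cutprod t u + C2 * gamx u.

Let c_G t u : 0 < t < 1 -> 0 < u -> {for u, continuous (G t)}.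
Proof.
move=> t01 u0; apply: cvgD; first exact: c_prod.
by apply: cM; exact: c_gamx.
Qed.

Let Np : 0 < N. Proof. exact: lt_le_trans N1. Qed.

Let G_ge0 t u : S t -> I u -> 0 <= G t u.
Proof.
move=> St /IU Iu; have /andP[u0 uU] := Iu.
have /andP[c0 c1] := cut_itv Np u0 uU.
have h := hC2 St Iu; have g0 := gamx_ge0 u.
rewrite /G /cutprod mulrCA (mulrC C2) -mulrDr mulr_ge0//.
move: h; rewrite ler_norml => /andP[h1 h2].
have : `|cut N u * (ln (dens t u) * dens_t t u)| <= C2.
  rewrite normrM ger0_norm// -[leRHS]mul1r ler_pM// ler_norml.
  by rewrite h1.
by rewrite ler_norml => /andP[h3 _]; lra.
Qed.

Let m := Int gamx.

Let iG t : 0 < t < 1 -> leb.-integrable I (EFin \o G t).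
Proof. by move=> t01; apply: intI => u; exact: c_G. Qed.
Let iJ t : 0 < t < 1 -> leb.-integrable I (EFin \o cutfisher t).
Proof. by move=> t01; apply: intI => u; exact: c_fisher. Qed.
Let iE t : 0 < t < 1 -> leb.-integrable I (EFin \o cuterr t).
Proof. by move=> t01; apply: intI => u; exact: c_err. Qed.
Let igx : leb.-integrable I (EFin \o gamx).
Proof. by apply: intI => u; exact: c_gamx. Qed.

(** The fundamental theorem for [flux] on [e, U], solved for the integral that contains the time
    derivative of the cut entropy. *)
Let flux_identity t : 0 < t < 1 ->
  l * t * Int (G t) = Int (cutfisher t) + l * t * (C2 * m) - Int (cuterr t) + flux N t e.
Proof.
move=> t01.
have ftc : (\int[leb]_(u in I) (fluxd N t u)%:E = (- flux N t e)%:E)%E.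
  have -> : - flux N t e = flux N t U - flux N t e.
    have [h1 h2] := cut_end N0.
    by rewrite (_ : flux N t U = 0) ?sub0r// /flux /U h1 h2 !mul0r subr0.
  apply: FTC_is_derive => // u /andP[eu _]; have u0 := lt_le_trans e0 eu.
    exact: is_derive_flux.
  exact: continuous_fluxd.
have ftc' : Int (fluxd N t) = - flux N t e by rewrite /Int /Rintegral ftc.
have : Int (fluxd N t) = Int (cutfisher t) - l * t * (Int (G t) - C2 * m) - Int (cuterr t).
  rewrite /Int /m.
  have -> : Int gamx = \int[leb]_(u in I) gamx u by [].
  rewrite -RintegralZl//.
  have i1 : leb.-integrable I (EFin \o (fun u => C2 * gamx u)).
    by apply: intI => u u0; apply: cM; exact: c_gamx.
  have i2 : leb.-integrable I (EFin \o (fun u => G t u - C2 * gamx u)).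
    by apply: intI => u u0; apply: cvgB; [exact: c_G|apply: cM; exact: c_gamx].
  have cGg u : 0 < u -> {for u, continuous (fun u => l * t * (G t u - C2 * gamx u))}.
    move=> u0; apply: (@cM (l * t) (fun u => G t u - C2 * gamx u)).
    by apply: cvgB; [exact: c_G|apply: cM; exact: c_gamx].
  have i3 := intI cGg.
  have i4 : leb.-integrable I (EFin \o (fun u => cutfisher t u - l * t * (G t u - C2 * gamx u))).
    by apply: intI => u u0; apply: cvgB; [exact: c_fisher|exact: cGg].
  rewrite -(@RintegralB _ _ _ leb I _ _ mI (iG t01) i1) -(@RintegralZl _ _ _ leb I _ _ mI i2).
  rewrite -(@RintegralB _ _ _ leb I _ _ mI (iJ t01) i3) -(@RintegralB _ _ _ leb I _ _ mI i4 (iE t01)).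
  apply: eq_Rintegral => u _.
  by rewrite /G addrK.
rewrite ftc' => h; move: h; move: (flux N t e) (Int (G t)) => f g; lra.
Qed.

Let err_le t : S t -> `|Int (cuterr t)| <= kap * Db.
Proof.
move=> St; have t01 := S01 St.
have kap0 : 0 <= kap by rewrite divr_ge0 ?(ltW Np)// addr_ge0 ?mulr_ge0 ?addr_ge0 ?mulr_ge0// ltW.
have cgp u : 0 < u -> {for u, continuous (fun u => gamx u * phi (dens t u))}.
  by move=> u0; apply: cvgM; [exact: c_gamx|exact: continuous_phi_dens_u].
have gp0 u : 0 < u -> 0 <= gamx u * phi (dens t u).
  by move=> u0; rewrite mulr_ge0 ?gamx_ge0// phi_ge0// ltW// dens_gt0// ltW.
have h : `|Int (cuterr t)| <= Int (fun u => `|cuterr t u|) := @le_normr_Rintegral _ _ _ leb I _ mI (iE t01).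
apply: (le_trans h).
apply: (@le_trans _ _ (Int (fun u => kap * (gamx u * phi (dens t u))))).
  apply: le_Rintegral => //.
  - have := integrable_norm (iE t01); apply: eq_integrable => //.
  - by apply: intI => u u0; apply: cM; exact: cgp.
  - move=> u Iu; have /andP[u0 uU] := IU Iu; have up := Ipos Iu.
    rewrite /cuterr normrM [X in _ * X]ger0_norm ?gp0//.
    by rewrite ler_wpM2r ?gp0// Lcut_le.
rewrite /Int RintegralZl//; last by apply: intI => u; exact: cgp.
rewrite ler_wpM2l// -lee_fin -/(Int _) (EInt cgp).
apply: le_trans (hDb St).
rewrite /Dent; apply: (@le_trans _ _ (\int[leb]_(u in I) (gam u * phi (dens t u))%:E)%E).
  rewrite le_eqVlt; apply/orP; left; apply/eqP; apply: eq_integral => u /set_mem/Ipos u0.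
  by rewrite gamxE.
apply: ge0_subset_integral => //.
- exact: (@measurable_Rpos R).
- by apply/measurable_EFinP; exact: measurable_gam_phi.
- move=> u; rewrite RposE => /ltW u0.
  by rewrite lee_fin mulr_ge0 ?gamma_pdf_ge0// phi_ge0// ltW// dens_gt0.
- by move=> u /Ipos; rewrite RposE.
Qed.

Let est t : S t ->
  `|Int (G t) - ((l * t)^-1 * Int (cutfisher t) + C2 * m)| <= del.
Proof.
move=> St; have t01 := S01 St; have h := flux_identity t01.
have /andP[tp _] := t01.
have lt0 : 0 < l * t by rewrite mulr_gt0.
have -> : Int (G t) - ((l * t)^-1 * Int (cutfisher t) + C2 * m) =
    (flux N t e - Int (cuterr t)) / (l * t).
  have -> : Int (G t) = (l * t * Int (G t)) / (l * t).
    by rewrite mulrAC divff ?mul1r// gt_eqF.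
  by rewrite h; field; rewrite !gt_eqF.
have h1 : `|flux N t e - Int (cuterr t)| <= kap * Db + beta.
  apply: le_trans (ler_normB _ _) _; rewrite addrC lerD ?err_le//.
  exact: hbeta.
rewrite normrM [X in _ * X]gtr0_norm ?invr_gt0//.
apply: ler_pM => //; first by rewrite invr_ge0 ltW.
rewrite lef_pV2 ?posrE// ?mulr_gt0// ler_wpM2l ?(ltW l0)//.
by move: St; rewrite /S/= in_itv/= => /andP[].
Qed.

Let mG : measurable_fun (S `*` I) (fun p : R * R => G p.1 p.2).
Proof.
apply: mstrip; apply: measurable_funD.
  apply: measurable_funM; first exact: (measurable_snd_comp_strip (measurable_cut N)).
  apply: measurable_funM; first exact: (measurable_snd_comp_strip measurable_gamx).
  exact: measurable_lnD_joint.
by apply: measurable_funM => //; exact: (measurable_snd_comp_strip measurable_gamx).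
Qed.

Let mJ : measurable_fun (S `*` I) (fun p : R * R => cutfisher p.1 p.2).
Proof.
apply: mstrip; apply: measurable_funM; first exact: (measurable_snd_comp_strip (measurable_cut N)).
apply: measurable_funM; first exact: (measurable_snd_comp_strip measurable_gamx).
exact: measurable_fisher_joint.
Qed.

Let fisher0 t u : S t -> I u -> 0 <= cutfisher t u.
Proof.
move=> St Iu; have t01 := S01 St; have /andP[u0 uU] := IU Iu.
have /andP[c0 _] := cut_itv Np u0 uU.
by rewrite mulr_ge0// mulr_ge0 ?gamx_ge0 ?fisher_ge0.
Qed.

Let mIntG : measurable_fun S (fun t => Int (G t)).
Proof.
have h : measurable_fun S (fun t => \int[leb]_(u in I) (G t u)%:E)%E.
  apply: (@measurable_tonelli_on1 _ _ _ _ _ leb S I (fun p => (G p.1 p.2)%:E)).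
  - exact: mS.
  - exact: mI.
  - by apply/measurable_EFinP; exact: mG.
  - by move=> t u St Iu; rewrite lee_fin G_ge0.
exact: (measurableT_comp (@fine_measurable R setT measurableT) h).
Qed.

Let mIntJ : measurable_fun S (fun t => Int (cutfisher t)).
Proof.
have h : measurable_fun S (fun t => \int[leb]_(u in I) (cutfisher t u)%:E)%E.
  apply: (@measurable_tonelli_on1 _ _ _ _ _ leb S I (fun p => (cutfisher p.1 p.2)%:E)).
  - exact: mS.
  - exact: mI.
  - by apply/measurable_EFinP; exact: mJ.
  - by move=> t u St Iu; rewrite lee_fin fisher0.
exact: (measurableT_comp (@fine_measurable R setT measurableT) h).
Qed.

(** Because phi' = ln, [cutprod t u] is the time derivative of [cutphi t u]. Tonelli brings the time
    integral inside, where the fundamental theorem in t applies for each fixed u. *)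
Let IntG_t : (\int[leb]_(t in S) (Int (G t))%:E =
  (Int (cutphi t2) - Int (cutphi t1) + C2 * m * (t2 - t1))%:E)%E.
Proof.
have s1 : 0 < t1 < 1 by apply: S01; rewrite /S/= in_itv/= lexx ltW.
have s2 : 0 < t2 < 1 by apply: S01; rewrite /S/= in_itv/= lexx ltW.
transitivity (\int[leb]_(t in S) \int[leb]_(u in I) (G t u)%:E)%E.
  by apply: eq_integral => t /set_mem/S01 t01; rewrite EInt// => u; exact: c_G.
transitivity (\int[leb]_(u in I) \int[leb]_(t in S) (G t u)%:E)%E.
  apply: (@tonelli_on _ _ _ _ _ leb leb S I (fun p => (G p.1 p.2)%:E)).
  - exact: mS.
  - exact: mI.
  - by apply/measurable_EFinP; exact: mG.
  - by move=> t u St Iu; rewrite lee_fin G_ge0.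
pose K u := cutphi t2 u - cutphi t1 u + (t2 - t1) * (C2 * gamx u).
have cK0 u : 0 < u -> {for u, continuous (fun u => cutphi t2 u - cutphi t1 u)}.
  by move=> u0; apply: cvgB; exact: c_phi.
have cg u : 0 < u -> {for u, continuous (fun u => C2 * gamx u)}.
  by move=> u0; apply: cM; exact: c_gamx.
have cK u : 0 < u -> {for u, continuous K}.
  by move=> u0; apply: cvgD; [exact: cK0|apply: (@cM (t2 - t1) (fun u => C2 * gamx u)); exact: cg].
transitivity (\int[leb]_(u in I) (K u)%:E)%E.
  apply: eq_integral => u /set_mem/Ipos u0.
  pose F t := cut N u * gamx u * phi (dens t u) + (C2 * gamx u) * t.
  have -> : K u = F t2 - F t1 by rewrite /K /F /cutphi; ring.
  have h : forall t, t1 <= t <= t2 -> is_derive t 1 F (G t u).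
    move=> t tI.
    have t01 : 0 < t < 1 by apply: S01; rewrite /S/= in_itv.
    have dp := @is_derive1_comp R (@phi R) (dens ^~ u) t _ _ (is_derive_phi (dens_gt0 a12 l0 mupos t01 (ltW u0))) (is_derive_dens_t mu a12 l0 t01 (ltW u0)).
    have d1 := @is_deriveZ _ _ _ _ (cut N u * gamx u) _ _ _ dp.
    have d2 := @is_deriveZ _ _ _ _ (C2 * gamx u) _ _ _ (@is_derive_id _ _ t 1).
    apply: (is_derive_eq (is_deriveD d1 d2)).
    by rewrite /GRing.scale/= /G /cutprod; ring.
  apply: (@FTC_is_derive R F (G ^~ u) t1 t2 t12 h) => t tI.
  have t01 : 0 < t < 1 by apply: S01; rewrite /S/= in_itv.
  apply: cvgD; last exact: cvg_cst.
  apply: cvgMr; apply: cvgMr; apply: cvgM.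
    apply: (@continuous_comp _ _ _ (dens ^~ u) (@ln R)).
      exact: (continuous_is_derive (is_derive_dens_t mu a12 l0 t01 (ltW u0))).
    by apply: continuous_ln; apply: dens_gt0 => //; exact: ltW.
  by apply: continuous_dens_t => //; exact: ltW.
rewrite -EInt//; congr EFin; rewrite /Int /K.
have ic t : 0 < t < 1 -> leb.-integrable I (EFin \o cutphi t).
  by move=> t01; apply: intI => u; exact: c_phi.
have i1 := intI cK0; have i2 := intI cg.
have i3 : leb.-integrable I (EFin \o (fun u => (t2 - t1) * (C2 * gamx u))).
  by apply: intI => u u0; apply: cM; exact: cg.
rewrite (@RintegralD _ _ _ leb I _ _ mI i1 i3) (@RintegralB _ _ _ leb I _ _ mI (ic _ s2) (ic _ s1)).
by rewrite (@RintegralZl _ _ _ leb I _ _ mI i2) (@RintegralZl _ _ _ leb I _ _ mI igx) [(t2 - t1) * _]mulrC.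
Qed.

Let dS (c : R) : (\int[leb]_(t in S) c%:E = (c * (t2 - t1))%:E)%E.
Proof.
rewrite integral_cst//.
have h : (c%:E * leb S = (c * (t2 - t1))%:E)%E.
  by rewrite /S lebesgue_measure_itv/= lte_fin t12 -EFinB EFinM.
exact: h.
Qed.

Let m0 : 0 <= C2 * m.
Proof.
rewrite mulr_ge0// /m /Int; apply: Rintegral_ge0 => u _; exact: gamx_ge0.
Qed.

Let del0 : 0 <= del.
Proof.
have St : S t1 by rewrite /S/= in_itv/= lexx ltW.
exact: le_trans (normr_ge0 _) (est St).
Qed.

Let cut_fisher_integral : \bar R :=
  (\int[leb]_(t in S) ((l * t)^-1 * Int (cutfisher t))%:E)%E.

Let mlt : measurable_fun S (fun t => (l * t)^-1).
Proof.
apply: measurable_continuous_itv_cc => t tI; apply: cvgV.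
  by rewrite mulf_neq0 ?gt_eqF//; case/andP: tI => h _; exact: lt_le_trans h.
by apply: cvgMr; exact: cvg_id.
Qed.

Let mJt : measurable_fun S (fun t => (l * t)^-1 * Int (cutfisher t)).
Proof. by have h := measurable_funM mlt mIntJ; exact: h. Qed.

Let Jt0 t : S t -> 0 <= (l * t)^-1 * Int (cutfisher t).
Proof.
move=> St; have /andP[tp _] := S01 St.
rewrite mulr_ge0 ?invr_ge0 ?mulr_ge0 ?(ltW l0) ?(ltW tp)//.
by apply: Rintegral_ge0 => u Iu; exact: fisher0.
Qed.

Let local_real :
  ((Int (cutphi t2))%:E <= (Int (cutphi t1))%:E + cut_fisher_integral + (del * (t2 - t1))%:E)%E /\
  ((Int (cutphi t1))%:E + cut_fisher_integral <= (Int (cutphi t2))%:E + (del * (t2 - t1))%:E)%E.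
Proof.
have le1 : (\int[leb]_(t in S) (Int (G t))%:E <=
    cut_fisher_integral + ((C2 * m + del) * (t2 - t1))%:E)%E.
  rewrite -dS -ge0_integralD_real//; last first.
    by move=> t _; rewrite addr_ge0.
  apply: ge0_le_integral_real => //.
  - exact: measurable_funD.
  - by move=> t St; apply: Rintegral_ge0 => u Iu; exact: G_ge0.
  - move=> t St; have := est St; rewrite ler_norml => /andP[_ h]; lra.
have le2 : (cut_fisher_integral + (C2 * m * (t2 - t1))%:E <=
    \int[leb]_(t in S) (Int (G t))%:E + (del * (t2 - t1))%:E)%E.
  rewrite -!dS -!ge0_integralD_real//; last first.
    by move=> t St; apply: Rintegral_ge0 => u Iu; exact: G_ge0.
  apply: ge0_le_integral_real => //.
  - exact: measurable_funD.
  - exact: measurable_funD.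
  - by move=> t St; rewrite addr_ge0// Jt0.
  - move=> t St; have := est St; rewrite ler_norml => /andP[h _]; lra.
rewrite IntG_t in le1 le2; exact: (two_sided_shift le1 le2).
Qed.

(** The identity is split into two inequalities with an explicit error, a form in which limits can
    be taken in the extended reals without subtracting. *)
Lemma local_deBruijn :
  let Phi t := (\int[leb]_(u in `[e, (expR N - 1)%R]) (cutphi t u)%:E)%E in
  let F := (\int[leb]_(t in `[t1, t2])
    ((l * t)^-1%:E * \int[leb]_(u in `[e, (expR N - 1)%R]) (cutfisher t u)%:E))%E in
  let del := ((4 + 2 * a + 2 * l) / N * Db + beta) / (l * t1) in
  (Phi t2 <= Phi t1 + F + (del * (t2 - t1))%:E)%E /\
  (Phi t1 + F <= Phi t2 + (del * (t2 - t1))%:E)%E.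
Proof.
have s1 : 0 < t1 < 1 by apply: S01; rewrite /S/= in_itv/= lexx ltW.
have s2 : 0 < t2 < 1 by apply: S01; rewrite /S/= in_itv/= lexx ltW.
move=> Phi F d.
have P1 : Phi t1 = (Int (cutphi t1))%:E by rewrite EInt// => u; exact: c_phi.
have P2 : Phi t2 = (Int (cutphi t2))%:E by rewrite EInt// => u; exact: c_phi.
have FE : F = cut_fisher_integral.
  apply: eq_integral => t /set_mem/S01 t01.
  by rewrite EFinM EInt// => u; exact: c_fisher.
rewrite P1 P2 FE; exact: local_real.
Qed.

End LocalDeBruijn.

(** * De Bruijn's identity *)

Section Cutoff.
Variable R : realType.
Local Notation leb := (@lebesgue_measure R).
Implicit Types (u : R) (n m : nat) (f : R -> R).

(** A single index drives both approximations: the lower end e = 1 / (n + 2) tends to 0 while the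
    cutoff parameter N = n + 1 grows. The shifts give e <= 1 <= N from the start, and [chi n]
    increases with n, which is what monotone convergence asks for. *)
Definition cutI n : set R := `[n.+2%:R^-1, expR n.+1%:R - 1]%classic.
Definition chi n : R -> R := cut n.+1%:R \_ (cutI n).

Lemma measurable_cutI n : measurable (cutI n).
Proof. exact: measurable_itv. Qed.

Lemma cutI_gt0 n u : cutI n u -> 0 < u.
Proof. by rewrite /cutI/= in_itv/= => /andP[h _]; rewrite (lt_le_trans _ h). Qed.

Lemma cutI_Rpos n : cutI n `<=` Rpos.
Proof. by move=> u /cutI_gt0; rewrite RposE. Qed.

Lemma chi_ge0 n u : 0 <= chi n u.
Proof.
rewrite /chi patchE; case: ifPn => // /set_mem hu; have u0 := cutI_gt0 hu.
move: hu; rewrite /cutI/= in_itv/= => /andP[_ h].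
by have /andP[] := @cut_itv R n.+1%:R u (ltr0Sn _ _) (ltW u0) h.
Qed.

Lemma measurable_chi n : measurable_fun setT (chi n).
Proof.
apply/(measurable_restrictT _ (measurable_cutI n)).
by apply: measurable_funTS; exact: measurable_cut.
Qed.

Lemma cutI_nd n m : (n <= m)%N -> cutI n `<=` cutI m.
Proof.
move=> nm u; rewrite /cutI/= !in_itv/= => /andP[h1 h2]; apply/andP; split.
  by apply: le_trans h1; rewrite lef_pV2 ?posrE// ler_nat !ltnS.
by apply: (le_trans h2); rewrite lerD2r ler_expR ler_nat.
Qed.

Lemma chi_nd n m u : (n <= m)%N -> chi n u <= chi m u.
Proof.
move=> nm; rewrite {1}/chi patchE; case: ifPn => [/set_mem hu|_]; last exact: chi_ge0.
have u0 := cutI_gt0 hu.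
rewrite /chi patchE mem_set; last exact: cutI_nd hu.
move: hu; rewrite /cutI/= in_itv/= => /andP[_ h].
have /andP[c0 _] := @cutp_ge0 R n.+1%:R u (ltr0Sn _ _) (ltW u0) h.
rewrite /cut lerXn2r ?nnegrE//.
  apply: (le_trans c0); rewrite /cutp lerD2l lerN2 ler_wpM2l//.
    by rewrite ln_ge0// lerDl ltW.
  by rewrite lef_pV2 ?posrE// ler_nat ltnS.
rewrite /cutp lerD2l lerN2 ler_wpM2l//.
  by rewrite ln_ge0// lerDl ltW.
by rewrite lef_pV2 ?posrE// ler_nat ltnS.
Qed.

Lemma cvg_inv1 : (n.+1%:R^-1 : R) @[n --> \oo] --> (0 : R).
Proof. exact: cvg_harmonic. Qed.

Lemma chi_cvg u : 0 < u -> chi n u @[n --> \oo] --> (1 : R).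
Proof.
move=> u0.
have h1 : (1 - ln (1 + u) * n.+1%:R^-1) ^+ 2 @[n --> \oo] --> (1 : R).
  rewrite [X in _ --> X](_ : 1 = (1 - ln (1 + u) * 0) ^+ 2); last by rewrite mulr0 subr0 expr1n.
  have h : (1 - ln (1 + u) * n.+1%:R^-1) @[n --> \oo] --> 1 - ln (1 + u) * 0.
    by apply: cvgB; [exact: cvg_cst|apply: cvgMr; exact: cvg_inv1].
  rewrite expr2; have h2 := cvgM h h; exact: h2.
apply: cvg_trans h1; apply: near_eq_cvg; near=> n.
rewrite /chi patchE mem_set// /cutI/= in_itv/=; apply/andP; split.
  apply: ltW; near: n.
  by apply: (cvgr_lt _ (@cvg_inv2 R)).
rewrite lerBrDl; apply: (@le_trans _ _ (1 + n.+1%:R)); last exact: expR_ge1Dx.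
rewrite lerD2l; apply: (@le_trans _ _ n%:R); last by rewrite ler_nat.
by near: n; exact: nbhs_infty_ger.
Unshelve. all: by end_near. Qed.

Lemma integral_cut n f :
  (\int[leb]_(u in cutI n) (cut n.+1%:R u * f u)%:E =
   \int[leb]_(u in Rpos) (chi n u * f u)%:E)%E.
Proof.
have /setIidPr <- := @cutI_Rpos n.
rewrite integral_mkcondr; apply: eq_integral => u _.
by rewrite /chi !patchE; case: ifPn => //; rewrite mul0r.
Qed.

Lemma measurable_chiM n f (D : set R) : measurable_fun D f ->
  measurable_fun D (fun u => chi n u * f u).
Proof.
move=> mf; have mc : measurable_fun D (chi n) by apply: measurable_funTS; exact: measurable_chi.
have h := measurable_funM mc mf; exact: h.
Qed.

Lemma integral_chi_cvg f : measurable_fun Rpos f -> (forall u, 0 < u -> 0 <= f u) ->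
  (\int[leb]_(u in Rpos) (chi n u * f u)%:E @[n --> \oo] -->
   \int[leb]_(u in Rpos) (f u)%:E)%E.
Proof.
move=> mf f0.
have := @cvg_monotone_convergence _ _ _ leb Rpos (@measurable_Rpos R)
  (fun n u => (chi n u * f u)%:E).
have -> : (\int[leb]_(u in Rpos) (fun u => limn (fun n => (chi n u * f u)%:E)) u =
    \int[leb]_(u in Rpos) (f u)%:E)%E.
  apply: eq_integral => u; rewrite in_Rpos => u0.
  apply/cvg_lim => //; apply: cvg_EFin; first by near=> n.
  by rewrite -[X in _ --> X]mul1r; apply: cvgMl; exact: chi_cvg.
apply.
- move=> n; apply/measurable_EFinP; exact: measurable_chiM.
- by move=> n u; rewrite RposE => u0; rewrite lee_fin mulr_ge0 ?chi_ge0 ?f0.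
- move=> u; rewrite RposE => u0 n m nm; rewrite lee_fin ler_wpM2r ?f0//; exact: chi_nd.
Unshelve. all: by end_near. Qed.

Lemma integral_chi_nd f n m : measurable_fun Rpos f -> (forall u, 0 < u -> 0 <= f u) ->
  (n <= m)%N ->
  (\int[leb]_(u in Rpos) (chi n u * f u)%:E <= \int[leb]_(u in Rpos) (chi m u * f u)%:E)%E.
Proof.
move=> mf f0 nm; apply: ge0_le_integral_real.
- exact: (@measurable_Rpos R).
- exact: measurable_chiM.
- exact: measurable_chiM.
- by move=> u; rewrite RposE => u0; rewrite mulr_ge0 ?chi_ge0 ?f0.
- by move=> u; rewrite RposE => u0; rewrite ler_wpM2r ?f0//; exact: chi_nd.
Qed.

End Cutoff.

(** * Removal of the cutoff *)

Section DeBruijn.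
Variable R : realType.
Variables (a l : R) (mu : probability R R).
Hypotheses (a12 : 1 / 2 <= a) (l0 : 0 < l) (mupos : mu Rpos = 1%E).
Hypothesis EX : (\int[mu]_(x in Rpos) x%:E = (a / l)%:E)%E.
Local Notation dens := (dens a l mu).
Local Notation gam := (gamma_pdf a l).
Local Notation fisher := (fisher a l mu).
Local Notation leb := (@lebesgue_measure R).
Local Notation Dent := (Dent a l mu).
Implicit Types (t u : R) (n : nat).

Let a0 : 0 < a. Proof. by rewrite (lt_le_trans _ a12). Qed.

Definition Jrel t : \bar R := (\int[leb]_(u in Rpos) (gam u * fisher t u)%:E)%E.

Lemma measurable_gam_fisher_joint :
  measurable_fun (@strip R) (fun p : R * R => gam p.2 * fisher p.1 p.2).
Proof.
apply: measurable_funM; first exact: (measurable_snd_comp_strip (measurable_gamma_pdf a l)).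
exact: measurable_fisher_joint.
Qed.

Let gf0 t u : 0 < t < 1 -> 0 < u -> 0 <= gam u * fisher t u.
Proof.
by move=> t01 u0; rewrite mulr_ge0 ?gamma_pdf_ge0// fisher_ge0// ltW.
Qed.

Lemma measurable_gam_fisher t : 0 < t < 1 ->
  measurable_fun Rpos (fun u => gam u * fisher t u).
Proof.
move=> t01; have m1 : measurable_fun Rpos gam.
  by apply: measurable_funTS; exact: measurable_gamma_pdf.
have m2 : measurable_fun Rpos (fisher t).
  by apply: measurable_continuous_Rpos => u u0; exact: continuous_fisher.
have h := measurable_funM m1 m2; exact: h.
Qed.

Lemma Jrel_ge0 t : 0 < t < 1 -> (0 <= Jrel t)%E.
Proof. by move=> t01; apply: integral_ge0 => u; rewrite RposE => u0; rewrite lee_fin gf0. Qed.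

Let mT (h : R * R -> R) : measurable_fun (@strip R) h ->
  (forall t u, 0 < t < 1 -> 0 < u -> 0 <= h (t, u)) ->
  measurable_fun (@U01 R) (fun t => \int[leb]_(u in Rpos) (h (t, u))%:E)%E.
Proof.
move=> mh h0; apply: (@measurable_tonelli_on1 _ _ _ _ _ leb (@U01 R) Rpos (fun p => (h p)%:E)).
- exact: measurable_U01.
- exact: (@measurable_Rpos R).
- by apply/measurable_EFinP; exact: mh.
- by move=> t u; rewrite U01E RposE lee_fin; exact: h0.
Qed.

Lemma measurable_Jrel : measurable_fun (@U01 R) Jrel.
Proof. by apply: (mT measurable_gam_fisher_joint) => t u; exact: gf0. Qed.

Definition Jrel_chi n t : \bar R := (\int[leb]_(u in Rpos) (chi n u * (gam u * fisher t u))%:E)%E.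

Lemma measurable_Jrel_chi n : measurable_fun (@U01 R) (Jrel_chi n).
Proof.
apply: (mT (h := fun p => chi n p.2 * (gam p.2 * fisher p.1 p.2))).
  apply: measurable_funM; last exact: measurable_gam_fisher_joint.
  exact: (measurable_snd_comp_strip (measurable_chi n)).
by move=> t u t01 u0; rewrite mulr_ge0 ?chi_ge0// gf0.
Qed.

Variables (t1 t2 : R).
Hypotheses (t10 : 0 < t1) (t12 : t1 < t2) (t21 : t2 < 1).
Let S : set R := `[t1, t2]%classic.

Let S01 t : S t -> 0 < t < 1.
Proof.
by rewrite /S/= in_itv/= => /andP[h1 h2]; rewrite (lt_le_trans t10 h1) (le_lt_trans h2 t21).
Qed.


Let mS : measurable S. Proof. exact: measurable_itv. Qed.

Let St t : t1 <= t <= t2 -> S t. Proof. by rewrite /S/= in_itv. Qed.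

Let mlt : measurable_fun S (fun t => ((l * t)^-1)%:E).
Proof.
apply/measurable_EFinP; apply: measurable_continuous_itv_cc => t tI; apply: cvgV.
  by rewrite mulf_neq0 ?gt_eqF//; case/andP: tI => h _; exact: lt_le_trans h.
by apply: cvgMr; exact: cvg_id.
Qed.

Let lt0 t : S t -> (0 <= ((l * t)^-1)%:E)%E.
Proof. by move=> /S01/andP[h _]; rewrite lee_fin invr_ge0 mulr_ge0 ?(ltW l0)// ltW. Qed.

Let DJ n : \bar R := (\int[leb]_(t in S) ((l * t)^-1%:E * Jrel_chi n t))%E.

Let DJ_cvg : (DJ n @[n --> \oo] --> \int[leb]_(t in S) ((l * t)^-1%:E * Jrel t))%E.
Proof.
have := @cvg_monotone_convergence _ _ _ leb S mS (fun n t => ((l * t)^-1%:E * Jrel_chi n t)%E).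
have -> : (\int[leb]_(t in S) (fun t => limn (fun n => (l * t)^-1%:E * Jrel_chi n t)) t =
    \int[leb]_(t in S) ((l * t)^-1%:E * Jrel t))%E.
  apply: eq_integral => t /set_mem Stt; have t01 := S01 Stt.
  apply/cvg_lim => //; apply: cvgeZl => //.
  apply: integral_chi_cvg; first exact: measurable_gam_fisher.
  by move=> u; exact: gf0.
apply.
- move=> n; apply: emeasurable_funM => //.
  by apply: measurable_funS (measurable_Jrel_chi n) => //; exact: measurable_U01.
- move=> n t Stt; rewrite mule_ge0 ?lt0//; apply: integral_ge0 => u; rewrite RposE => u0.
  by rewrite lee_fin mulr_ge0 ?chi_ge0// gf0// S01.
- move=> t Stt n m nm; rewrite lee_wpmul2l ?lt0//; apply: integral_chi_nd => //.
    exact: measurable_gam_fisher (S01 Stt).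
  by move=> u; exact: gf0 (S01 Stt).
Qed.

Let Dchi n t : \bar R := (\int[leb]_(u in Rpos) (chi n u * (gam u * phi (dens t u)))%:E)%E.

Let gp0 t u : 0 < t < 1 -> 0 < u -> 0 <= gam u * phi (dens t u).
Proof.
by move=> t01 /ltW u0; rewrite mulr_ge0 ?gamma_pdf_ge0// phi_ge0// ltW// dens_gt0.
Qed.

Let Dchi_cvg t : 0 < t < 1 -> (Dchi n t @[n --> \oo] --> Dent t)%E.
Proof.
move=> t01; apply: integral_chi_cvg; first exact: measurable_gam_phi.
by move=> u; exact: gp0.
Qed.

(** At u = e the weight [wgt] is at most a multiple of e^a, and all other factors are bounded for u
    in [0, 1], uniformly in t and n. As a > 0, no boundary term survives at 0. *)
Let flux_bound : exists C, forall n t, S t ->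
  `|flux a l mu n.+1%:R t n.+2%:R^-1| <= C * (n.+2%:R^-1 `^ a).
Proof.
have [C hC] := bndM (bnd_ln_dens a12 l0 mupos 1 t10 (ltW t12) t21)
   (bnd_dens_u a12 l0 mupos 1 t10 t21).
have [D hD] := bnd_phi_dens a12 l0 mupos 1 t10 (ltW t12) t21.
exists (gamC a l * (C + 2 * D)) => n t Stt.
set e : R := n.+2%:R^-1; set N : R := n.+1%:R.
have e0 : 0 < e by rewrite invr_gt0.
have e1 : e <= 1 by rewrite invf_le1// ler1n.
have N1 : 1 <= N by rewrite ler1n.
have N0 : 0 < N by rewrite ltr0n.
have eU : e <= expR N - 1.
  rewrite lerBrDl; apply: (@le_trans _ _ (1 + N)); last exact: expR_ge1Dx.
  by rewrite lerD2l (le_trans e1).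
have /andP[c0 c1] := cut_itv N0 (ltW e0) eU.
have /andP[p0 p1] := cutp_ge0 N0 (ltW e0) eU.
have St' : t1 <= t <= t2 by move: Stt; rewrite /S/= in_itv.
have Ie : 0 <= e <= 1 by rewrite ltW.
have h1 := hC t e St' Ie; have h2 := hD t e St' Ie.
have k1 : `|cut1 N e| <= 2.
  have q0 : 0 < N * (1 + e) by rewrite mulr_gt0// addr_gt0.
  rewrite /cut1 normrN ger0_norm; last by rewrite divr_ge0 ?(ltW q0)// (mulr_ge0 _ p0).
  rewrite ler_pdivrMr ?mulr_gt0 ?addr_gt0//.
  rewrite ler_wpM2l//; apply: (le_trans p1).
  by rewrite mulr_ege1// lerDl ltW.
have g0 : 0 <= gamC a l by rewrite divr_ge0 ?powR_ge0// ltW// GammaR_gt0.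
have w0 : 0 <= wgt a l e by rewrite mulr_ge0// mulr_ge0 ?powR_ge0 ?expR_ge0.
have w1 : wgt a l e <= gamC a l * e `^ a.
  rewrite /wgt ler_wpM2l// ler_piMr ?powR_ge0//.
  by rewrite expR_le1 oppr_le0 mulr_ge0 ?(ltW l0)// ltW.
have C0 : 0 <= C by exact: le_trans h1.
have D0 : 0 <= D by exact: le_trans h2.
have key : wgt a l e * (C + 2 * D) <= gamC a l * (C + 2 * D) * e `^ a.
  have CD : 0 <= C + 2 * D by rewrite addr_ge0// mulr_ge0.
  by rewrite (mulrAC _ (C + 2 * D)); exact: (ler_wpM2r CD w1).
apply: (le_trans _ key).
rewrite (mulrDr (wgt a l e) C) /flux; apply: (le_trans (ler_normB _ _)); apply: lerD.
  rewrite (_ : cut N e * _ = wgt a l e * (cut N e * (ln (dens t e) * dens_u a l mu t e))); last by ring.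
  rewrite normrM ger0_norm// ler_wpM2l// normrM ger0_norm// -[leRHS]mul1r.
  by rewrite ler_pM.
rewrite (_ : cut1 N e * _ = wgt a l e * (cut1 N e * phi (dens t e))); last by ring.
by rewrite normrM ger0_norm// ler_wpM2l// normrM ler_pM.
Qed.

Let Dent_bound : exists Db, forall t, S t -> (Dent t <= Db%:E)%E.
Proof.
(* The range [0, 1] for u is arbitrary, since [bcoef] depends on t only. *)
have [C hC] := bnd_bcoef l 1 t10 t21.
exists (- a * ln (1 - t2) + Num.sqrt C * (2 * (a / l))) => t Stt.
have t01 := S01 Stt; have St' : t1 <= t <= t2 by move: Stt; rewrite /S/= in_itv.
have /andP[tl tu] := St'.
apply: (le_trans (Dent_le a12 l0 mupos t01 EX)); rewrite lee_fin lerD//.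
  rewrite !mulNr lerN2 ler_wpM2l ?(ltW a0)// ler_ln ?posrE ?subr_gt0//.
    by rewrite lerD2l lerN2.
  by case/andP: t01.
have al0 : 0 <= 2 * (a / l) by rewrite mulr_ge0// divr_ge0 ?ltW.
rewrite ler_wpM2r//.
apply: ler_wsqrtr; apply: le_trans (hC t 0 St' _); first exact: ler_norm.
by rewrite lexx ler01.
Qed.

Let approx : exists2 d : nat -> R, d n @[n --> \oo] --> 0 & forall n,
  (Dchi n t2 <= Dchi n t1 + DJ n + (d n)%:E)%E /\
  (Dchi n t1 + DJ n <= Dchi n t2 + (d n)%:E)%E.
Proof.
have [C hC] := flux_bound; have [Db hDb] := Dent_bound.
exists (fun n => ((4 + 2 * a + 2 * l) / n.+1%:R * Db + C * (n.+2%:R^-1 `^ a)) / (l * t1) * (t2 - t1)).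
  have -> : (0 : R) = ((4 + 2 * a + 2 * l) * 0 * Db + C * 0) / (l * t1) * (t2 - t1) by ring.
  apply: cvgMl; apply: cvgMl; apply: cvgD.
    by apply: cvgMl; apply: cvgMr; exact: cvg_inv1.
  by apply: cvgMr; exact: cvg_powR_inv.
move=> n.
have U0 : 0 <= expR n.+1%:R - 1 :> R by rewrite subr_ge0 -expR0 ler_expR.
have [C2 hC2] := bndM (bnd_ln_dens a12 l0 mupos (expR n.+1%:R - 1) t10 (ltW t12) t21)
   (bnd_dens_t a12 l0 mupos (expR n.+1%:R - 1) t10 t21).
have C20 : 0 <= C2.
  apply: le_trans (hC2 t1 0 _ _); first exact: normr_ge0.
    by rewrite lexx ltW.
  by rewrite lexx.
have e1 : n.+2%:R^-1 <= 1 :> R by rewrite invf_le1// ler1n.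
have e0 : 0 < n.+2%:R^-1 :> R by rewrite invr_gt0.
have N1 : 1 <= n.+1%:R :> R by rewrite ler1n.
have hC2' t u : S t -> 0 <= u <= expR n.+1%:R - 1 -> `|ln (dens t u) * dens_t a l mu t u| <= C2.
  by rewrite /S/= in_itv/= => h1 h2; exact: hC2.
have := local_deBruijn a12 l0 mupos t10 t12 t21 N1 e0 e1 C20 hC2' hDb (hC n).
move=> /=.
have E t : (\int[leb]_(u in cutI n) (cutphi a l mu n.+1%:R t u)%:E = Dchi n t)%E.
  rewrite /Dchi -integral_cut; apply: eq_integral => u /set_mem/cutI_gt0 u0.
  by rewrite gamxE.
have F : (\int[leb]_(t in S) ((l * t)^-1%:E * \int[leb]_(u in cutI n) (cutfisher a l mu n.+1%:R t u)%:E) = DJ n)%E.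
  apply: eq_integral => t _; congr (_ * _)%E; rewrite /Jrel_chi -integral_cut.
  by apply: eq_integral => u /set_mem/cutI_gt0 u0; rewrite gamxE.
rewrite -/(cutI n) -/S !E F; exact.
Qed.

(** Monotone convergence in n gives the limits of the cut entropies and of the cut Fisher integrals;
    the two inequalities of [approx] then close up to an equality. *)
Lemma deBruijn :
  (Dent t2 = Dent t1 + \int[leb]_(t in `[t1, t2]) ((l * t)^-1%:E * Jrel t))%E.
Proof.
have s1 : 0 < t1 < 1 by apply: S01; apply: St; rewrite lexx ltW.
have s2 : 0 < t2 < 1 by apply: S01; apply: St; rewrite lexx ltW.
have [d d0 hd] := approx.
have d0' : ((d n)%:E @[n --> \oo] --> 0)%E by apply: cvg_EFin => //; near=> n.
have J0 : (0 <= \int[leb]_(t in S) ((l * t)^-1%:E * Jrel t))%E.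
  by apply: integral_ge0 => t Stt; rewrite mule_ge0 ?lt0// Jrel_ge0// S01.
have L : ((Dchi n t1 + DJ n)%E @[n --> \oo] --> Dent t1 + \int[leb]_(t in S) ((l * t)^-1%:E * Jrel t))%E.
  apply: cvgeD; [|exact: Dchi_cvg|exact: DJ_cvg].
  by rewrite ge0_adde_def ?inE// Dent_ge0.
apply/eqP; rewrite eq_le; apply/andP; split.
  have h : ((Dchi n t1 + DJ n + (d n)%:E)%E @[n --> \oo] -->
      Dent t1 + \int[leb]_(t in S) ((l * t)^-1%:E * Jrel t) + 0)%E.
    by apply: cvgeD => //; rewrite fin_num_adde_defl.
  rewrite adde0 in h; apply: (lee_cvg_to (Dchi_cvg s2) h).
  by near=> n; have [] := hd n.
have h : ((Dchi n t2 + (d n)%:E)%E @[n --> \oo] --> Dent t2 + 0)%E.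
  by apply: cvgeD => //; [rewrite fin_num_adde_defl|exact: Dchi_cvg].
rewrite adde0 in h; apply: (lee_cvg_to L h).
by near=> n; have [] := hd n.
Unshelve. all: by end_near. Qed.

End DeBruijn.

(** * Weak convergence at the end of the path and lower semicontinuity *)

Section Portmanteau.
Variable R : realType.
Variables (a l : R) (mu : probability R R).
Hypotheses (a12 : 1 / 2 <= a) (l0 : 0 < l) (mupos : mu Rpos = 1%E).
Local Notation dens := (dens a l mu).
Local Notation gam := (gamma_pdf a l).
Local Notation ker := (ker a l).
Local Notation leb := (@lebesgue_measure R).
Implicit Types (t x u r : R) (U : set R) (n : nat).

Let a0 : 0 < a. Proof. by rewrite (lt_le_trans _ a12). Qed.

Definition ksqr t x : R :=
  (a * (a + 1) * ((1 - t) / l) ^+ 2 + 2 * (a + 1) * ((1 - t) / l) * (t * x) + (t * x) ^+ 2)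
  + x ^+ 2 - 2 * x * ((1 - t) * (a / l) + t * x).

Let gk0 t x u : 0 < t < 1 -> 0 <= x -> 0 <= gam u * ker t x u.
Proof.
move=> t01 x0; have [u0|u0] := ltP 0 u.
  by rewrite mulr_ge0 ?gamma_pdf_ge0// ltW// ker_gt0// ltW.
by rewrite gamma_pdf_out ?mul0r//; apply/negP; rewrite -leNgt.
Qed.

Let mgk t x : measurable_fun setT (fun u => gam u * ker t x u).
Proof.
apply: measurable_funM; first exact: measurable_gamma_pdf.
have h : measurable_fun setT (fun u : R => (x, u)) by exact: measurable_fun_pair.
exact: (measurableT_comp (measurable_ker_joint l a12 t) h).
Qed.

(** The transition probability from x into [U] at time t. *)
Definition ptr t (U : set R) x : \bar R := (\int[leb]_u ((\1_U u : R) * (gam u * ker t x u))%:E)%E.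

Lemma ptr_ge0 t U x : 0 < t < 1 -> 0 <= x -> (0 <= ptr t U x)%E.
Proof. by move=> t01 x0; apply: integral_ge0 => u _; rewrite lee_fin mulr_ge0// gk0. Qed.

Lemma ptr_le1 t U x : 0 < t < 1 -> 0 <= x -> measurable U -> (ptr t U x <= 1)%E.
Proof.
move=> t01 x0 mU; rewrite -(integral_ker a0 l0 t01 x0).
have mI : measurable_fun setT (\1_U : R -> R) by exact: measurable_indic.
apply: ge0_le_integral_real => //.
- have h := measurable_funM mI (mgk t x); exact: h.
- exact: mgk.
- by move=> u _; rewrite mulr_ge0// gk0.
- by move=> u _; rewrite indicE; case: (u \in U); rewrite ?mul1r// mul0r gk0.
Qed.

(* Chebyshev's inequality; [ksqr t x] is the conditional mean square of [X_t - x]. *)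
Lemma ptr_ge t U x r : 0 < t < 1 -> 0 < x -> measurable U -> 0 < r ->
  (forall u, `|u - x| < r -> U u) -> ((1 - ksqr t x / r ^+ 2)%:E <= ptr t U x)%E.
Proof.
move=> t01 x0 mU r0 xU; have xx := ltW x0.
have mI : measurable_fun setT (\1_U : R -> R) by exact: measurable_indic.
have m1 : measurable_fun setT (fun u => (\1_U u : R) * (gam u * ker t x u)).
  have h := measurable_funM mI (mgk t x); exact: h.
have m2 : measurable_fun setT (fun u => u ^+ 2 * (gam u * ker t x u)).
  by have h := measurable_funM (measurable_funX 2 (@measurable_id _ R setT)) (mgk t x); exact: h.
have m3 : measurable_fun setT (fun u => `|u| * (gam u * ker t x u)).
  by have h := measurable_funM (@normr_measurable R setT) (mgk t x); exact: h.
have r2 : 0 < r ^+ 2 by rewrite exprn_gt0.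
pose c := (r ^+ 2)^-1.
have c0 : 0 < c by rewrite invr_gt0.
have mM (k : R) f : measurable_fun setT f -> measurable_fun setT (fun u : R => k * f u).
  by move=> mf; exact: measurable_funM.
(* This is 1 <= 1_U(u) + (u - x)^2 / r^2 integrated against the transition law, with the cross term
   2 x u / r^2 moved to the left to keep both integrands nonnegative. *)
have le : (\int[leb]_u (gam u * ker t x u + (2 * x * c) * (`|u| * (gam u * ker t x u)))%:E <=
   \int[leb]_u ((\1_U u : R) * (gam u * ker t x u) + (c * (u ^+ 2 * (gam u * ker t x u))
      + (c * x ^+ 2) * (gam u * ker t x u)))%:E)%E.
  apply: ge0_le_integral_real => //.
  - by have h := measurable_funD (mgk t x) (mM (2 * x * c) _ m3); exact: h.
  - by have h := measurable_funD m1 (measurable_funD (mM c _ m2) (mM (c * x ^+ 2) _ (mgk t x))); exact: h.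
  - move=> u _; apply: addr_ge0; first exact: gk0.
    apply: mulr_ge0; first by rewrite !mulr_ge0// ltW.
    by apply: mulr_ge0; last exact: gk0.
  - move=> u _; have [u0|u0] := ltP 0 u; last first.
      by rewrite gamma_pdf_out ?mul0r ?mulr0 ?addr0//; apply/negP; rewrite -leNgt.
    have g0 : 0 <= gam u * ker t x u by exact: gk0.
    rewrite (ger0_norm (ltW u0)).
    have k : 1 <= (\1_U u : R) + c * (u - x) ^+ 2.
      rewrite indicE; case: (boolP (u \in U)) => [_|/negP uU].
        by rewrite lerDl mulr_ge0 ?sqr_ge0// ltW.
      rewrite add0r /c mulrC ler_pdivlMr// mul1r -[leRHS]real_normK ?num_real//.
      rewrite lerXn2r ?nnegrE ?(ltW r0)// leNgt; apply/negP => /xU h.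
      by apply: uU; rewrite inE.
    have := ler_wpM2r g0 k; lra.
have E1 : (\int[leb]_u (gam u * ker t x u + (2 * x * c) * (`|u| * (gam u * ker t x u)))%:E =
    (1 + (2 * x * c) * ((1 - t) * (a / l) + t * x))%:E)%E.
  rewrite ge0_integralD_real//.
  - rewrite ge0_integralZl_real//.
    + by rewrite integral_ker// integral_ker_id// -EFinM -EFinD.
    + by move=> u _; rewrite mulr_ge0 ?gk0.
    + by rewrite !mulr_ge0 ?(ltW c0).
  - exact: mgk.
  - exact: mM.
  - by move=> u _; exact: gk0.
  - move=> u _; apply: mulr_ge0; first by rewrite !mulr_ge0// ltW.
    by apply: mulr_ge0; last exact: gk0.
have E2 : (\int[leb]_u ((\1_U u : R) * (gam u * ker t x u) + (c * (u ^+ 2 * (gam u * ker t x u))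
      + (c * x ^+ 2) * (gam u * ker t x u)))%:E = ptr t U x +
   (c * (a * (a + 1) * ((1 - t) / l) ^+ 2 + 2 * (a + 1) * ((1 - t) / l) * (t * x) + (t * x) ^+ 2)
    + c * x ^+ 2)%:E)%E.
  have p1 u : 0 <= u ^+ 2 * (gam u * ker t x u) by rewrite mulr_ge0 ?sqr_ge0 ?gk0.
  have cx0 : 0 <= c * x ^+ 2 by rewrite mulr_ge0 ?sqr_ge0// ltW.
  have p2 u : 0 <= c * x ^+ 2 * (gam u * ker t x u) by rewrite mulr_ge0 ?gk0.
  have p3 u : 0 <= c * (u ^+ 2 * (gam u * ker t x u)) by rewrite mulr_ge0// ltW.
  rewrite ge0_integralD_real//.
  - congr (_ + _)%E; rewrite ge0_integralD_real//.
    + rewrite ge0_integralZl_real//; last exact: ltW.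
      rewrite ge0_integralZl_real//; last 2 first.
        exact: mgk.
        by move=> u _; exact: gk0.
      rewrite integral_ker// integral_ker_sqr// mule1 -EFinM -EFinD; congr EFin.
      congr (_ * _ + _); rewrite /theta /rate; field.
      by rewrite (gt_eqF l0)/= subr_eq0 eq_sym lt_eqF//; case/andP: t01.
    + exact: mM.
    + by apply: mM; exact: mgk.
  - apply: measurable_funD; first exact: mM.
    by apply: mM; exact: mgk.
  - by move=> u _; rewrite mulr_ge0 ?gk0.
  - by move=> u _; rewrite addr_ge0.
rewrite E1 E2 in le.
rewrite /ksqr -/c; move: le; case: (ptr t U x) => [p| |] //=.
- by rewrite -EFinD !lee_fin => h; lra.
- by move=> _; rewrite leey.
Qed.

(** A sequence inside ]0, 1[ with limit 1, since dominated convergence is applied along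
    sequences. *)
Definition tseq n : R := 1 - n.+2%:R^-1.

Lemma tseq01 n : 0 < tseq n < 1.
Proof.
rewrite /tseq ltrBlDr ltrDl invr_gt0 ltr0n andbT subr_gt0 invf_lt1// ?ltr1n//.
Qed.

Lemma tseq_cvg : tseq n @[n --> \oo] --> (1 : R).
Proof.
rewrite -[X in _ --> X]subr0; apply: cvgB; first exact: cvg_cst.
exact: cvg_inv2.
Qed.

Lemma ksqr_cvg x : ksqr (tseq n) x @[n --> \oo] --> (0 : R).
Proof.
have c : {for 1, continuous (ksqr ^~ x)}.
  have h1 : {for 1, continuous (fun t : R => (1 - t) / l)}.
    by apply: cvgMl; apply: cvgB; [exact: cvg_cst|exact: cvg_id].
  have h2 : {for 1, continuous (fun t : R => t * x)} by apply: cvgMl; exact: cvg_id.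
  apply: cvgB.
    apply: cvgD; last exact: cvg_cst.
    apply: cvgD; last by apply: cvgM.
    apply: cvgD; first by apply: cvgMr; apply: cvgM.
    by apply: cvgM => //; apply: cvgMr.
  apply: cvgMr; apply: cvgD => //; apply: cvgMl; apply: cvgB; [exact: cvg_cst|exact: cvg_id].
have := cvg_comp _ _ tseq_cvg c.
have -> : ksqr 1 x = 0 by rewrite /ksqr subrr !mul0r !mul1r; ring.
exact.
Qed.

Lemma measurable_ptr t U : 0 < t < 1 -> measurable U -> measurable_fun Rpos (ptr t U).
Proof.
move=> t01 mU.
have mI : measurable_fun setT (\1_U : R -> R) by exact: measurable_indic.
apply: (@measurable_tonelli_on1 _ _ _ _ _ leb Rpos setT
    (fun p => ((\1_U p.2 : R) * (gam p.2 * ker t p.1 p.2))%:E)).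
- exact: (@measurable_Rpos R).
- exact: measurableT.
- apply/measurable_EFinP; apply: measurable_funTS; apply: measurable_funM.
    by apply: (measurableT_comp mI); exact: measurable_snd.
  apply: measurable_funM; last exact: measurable_ker_joint.
  by apply: (measurableT_comp (@measurable_gamma_pdf R a l)); exact: measurable_snd.
- by move=> x u; rewrite RposE => /ltW x0 _; rewrite lee_fin mulr_ge0// gk0.
Qed.

Lemma ptr_cvg U x : 0 < x -> open U -> U x -> (ptr (tseq n) U x @[n --> \oo] --> 1)%E.
Proof.
move=> x0 oU Ux.
have mU : measurable U by exact: open_measurable.
have [r r0 hr] : exists2 r : R, 0 < r & forall u, `|u - x| < r -> U u.
  have /nbhs_ballP[r r0 hr] : nbhs x U by exact: open_nbhs_nbhs.
  by exists r => // u ux; apply: hr; rewrite /ball/= distrC.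
apply: (@squeeze_cvge _ _ _ _ (fun n => (1 - ksqr (tseq n) x / r ^+ 2)%:E) _ (fun=> 1%E)).
- near=> n; apply/andP; split.
    exact: ptr_ge (tseq01 n) x0 mU r0 hr.
  by apply: ptr_le1 => //; [exact: tseq01|exact: ltW].
- apply: cvg_EFin; first by near=> n.
  rewrite [X in _ --> X](_ : 1 = 1 - 0 / r ^+ 2); last by rewrite mul0r subr0.
  by apply: cvgB; [exact: cvg_cst|apply: cvgMl; exact: ksqr_cvg].
- exact: cvg_cst.
Unshelve. all: by end_near. Qed.

Definition pathU t U : \bar R := (\int[leb]_(u in Rpos) ((\1_U u : R) * (gam u * dens t u))%:E)%E.

(** Only starting points in [U] itself are kept: there the transition probabilities into the open
    set [U] tend to 1, and a lower bound for the mass of [U] is all that is required. *)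
Let lowU n U : \bar R := (\int[mu]_(x in U `&` Rpos) ptr (tseq n) U x)%E.

Let mUR U : open U -> measurable (U `&` Rpos).
Proof. by move=> oU; apply: measurableI; [exact: open_measurable|exact: measurable_Rpos]. Qed.

Let lowU_cvg U : open U -> (lowU n U @[n --> \oo] --> mu (U `&` Rpos))%E.
Proof.
move=> oU; have mU : measurable U by exact: open_measurable.
have -> : mu (U `&` Rpos) = (\int[mu]_(x in U `&` Rpos) 1)%E.
  by rewrite integral_cst ?mul1e//; exact: mUR.
apply: (@dominated_cvg _ _ _ mu _ (mUR oU) (fun n => ptr (tseq n) U) (fun=> 1%E) (fun=> 1%E)) => //.
- move=> n; apply: measurable_funS (measurable_ptr (tseq01 n) mU).
    exact: measurable_Rpos.
  exact: subIsetr.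
- by move=> x [Ux]; rewrite RposE => x0; exact: ptr_cvg.
- exact: (@finite_measure_integrable_cst _ _ _ mu (U `&` Rpos) 1 (mUR oU)).
- move=> n x [Ux]; rewrite RposE => /ltW x0; rewrite gee0_abs; last by apply: ptr_ge0 => //; exact: tseq01.
  by apply: ptr_le1 => //; exact: tseq01.
Qed.

Let lowU_le n U : open U -> (lowU n U <= pathU (tseq n) U)%E.
Proof.
move=> oU; have mU : measurable U by exact: open_measurable.
have mI : measurable_fun setT (\1_U : R -> R) by exact: measurable_indic.
rewrite /pathU -integral_path//; last exact: tseq01.
apply: ge0_subset_integral.
- exact: mUR.
- exact: measurable_Rpos.
- exact: measurable_ptr (tseq01 n) mU.
- by move=> x; rewrite RposE => /ltW x0; apply: ptr_ge0 => //; exact: tseq01.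
- exact: subIsetr.
Qed.

(** The portmanteau inequality for open sets, in weighted form: a bound that is uniform along the
    path passes to the law of X. *)
Lemma open_sum_le (J : nat) (U : nat -> set R) (d : R) (B : \bar R) :
  (forall j, open (U j)) -> 0 <= d ->
  (forall t, 0 < t < 1 -> (\sum_(j < J) d%:E * pathU t (U j) <= B)%E) ->
  (\sum_(j < J) d%:E * mu (U j `&` Rpos) <= B)%E.
Proof.
move=> oU d0 hB.
have h : (\sum_(j < J) d%:E * lowU n (U j) @[n --> \oo] --> \sum_(j < J) d%:E * mu (U j `&` Rpos))%E.
  apply: cvg_nnesum => j _.
    near=> n; rewrite mule_ge0 ?lee_fin//; apply: integral_ge0 => x [_].
    by rewrite RposE => /ltW x0; apply: ptr_ge0 => //; exact: tseq01.
  by apply: cvgeZl => //; exact: lowU_cvg.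
apply: (cvge_le _ h); near=> n.
apply: le_trans (hB _ (tseq01 n)); apply: lee_sum => j _.
by rewrite lee_wpmul2l ?lee_fin//; exact: lowU_le.
Unshelve. all: by end_near. Qed.

End Portmanteau.

(** * Outer regularity of the gamma law *)

Section GammaRegularity.
Variable R : realType.
Variables (a l : R).
Hypotheses (a0 : 0 < a) (l0 : 0 < l).
Local Notation gam := (gamma_pdf a l).
Local Notation leb := (@lebesgue_measure R).
Implicit Types (u : R) (A U : set R) (n : nat).

Definition gmass A : \bar R := (\int[leb]_(u in A `&` Rpos) (gam u)%:E)%E.

Let mg A : measurable_fun A (fun u => (gam u)%:E).
Proof. by apply/measurable_EFinP; apply: measurable_funTS; exact: measurable_gamma_pdf. Qed.

Let g0 u : (0 <= (gam u)%:E)%E.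
Proof. by rewrite lee_fin gamma_pdf_ge0. Qed.

Lemma gmass_ge0 A : (0 <= gmass A)%E.
Proof. by apply: integral_ge0 => u _. Qed.

Lemma gmass_le A B : measurable A -> measurable B -> A `<=` B -> (gmass A <= gmass B)%E.
Proof.
move=> mA mB AB; apply: ge0_subset_integral.
- by apply: measurableI => //; exact: measurable_Rpos.
- by apply: measurableI => //; exact: measurable_Rpos.
- exact: mg.
- by move=> u _.
- exact: setSI.
Qed.

Lemma gmassU A B : measurable A -> measurable B -> [disjoint A & B] ->
  (gmass (A `|` B) = gmass A + gmass B)%E.
Proof.
move=> mA mB AB; rewrite /gmass setIUl ge0_integral_setU//.
- by apply: measurableI => //; exact: measurable_Rpos.
- by apply: measurableI => //; exact: measurable_Rpos.
- exact: mg.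
- by apply/disj_setPS => u [[Au _] [Bu _]]; move/disj_setPS: AB => /(_ u); apply.
Qed.

Lemma gmassT : gmass setT = 1%E.
Proof.
rewrite /gmass setTI; exact: integral_gamma_pdf.
Qed.

Let K n : set R := `[n.+2%:R^-1, n.+2%:R]%classic.

Let mK n : measurable (K n). Proof. exact: measurable_itv. Qed.

Lemma gmass_tail (eps : R) : 0 < eps -> exists n, (gmass (~` K n) <= eps%:E)%E.
Proof.
move=> e0.
have cv : (gmass (K n) @[n --> \oo] --> 1)%E.
  rewrite -gmassT.
  have KR n : K n `&` Rpos = K n.
    apply/setIidPl => u; rewrite /K/= in_itv/= => /andP[h _].
    by rewrite RposE (lt_le_trans _ h).
  have -> : (fun n => gmass (K n)) = (fun n => \int[leb]_(u in K n) (gam u)%:E)%E.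
    by apply/funext => n; rewrite /gmass KR.
  rewrite /gmass setTI -(bigcup_cc_Rpos R).
  have h := @ge0_nondecreasing_set_cvg_integral _ (measurableTypeR R) R K (fun u => (gam u)%:E) leb (@nd_cc_Rpos R) mK (fun n => @mg (K n)) (fun n u _ => g0 u).
  exact: h.
have fin n : gmass (K n) \is a fin_num.
  rewrite ge0_fin_numE ?gmass_ge0//; apply: le_lt_trans (ltry 1).
  by rewrite -gmassT; apply: gmass_le.
have [_ /cvgrPdist_le/(_ _ e0)[n _ hn]] := (fine_cvgP _ _).1 cv.
exists n; have := hn n (leqnn n) => /=.
have : (gmass (K n) + gmass (~` K n) = 1)%E.
  rewrite -gmassU//; last 2 first.
    exact: measurableC.
    by apply/disj_setPS; rewrite setICr.
  by rewrite setUCr gmassT.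
have := gmass_ge0 (~` K n).
rewrite -(fineK (fin n)); case: (gmass (~` K n)) => [x| |]//=.
rewrite lee_fin -EFinD => x0 [h]; rewrite -h addrAC subrr add0r => hx.
by rewrite lee_fin (le_trans (ler_norm _)).
Qed.

(** Outer regularity is imported from Lebesgue measure. On the compact set [K n] the density is
    bounded, so a set of small length has small gamma mass; the complement of [K n] is open, carries
    little mass and is added whole. *)
Lemma gmass_outer_regular A (eps : R) : measurable A -> A `<=` Rpos -> 0 < eps ->
  exists U, [/\ open U, A `<=` U & (gmass (U `\` A) <= eps%:E)%E].
Proof.
move=> mA AR e0; have e20 : 0 < eps / 2 by rewrite divr_gt0.
have [n hn] := gmass_tail e20.
pose V : set R := `]n.+3%:R^-1, n.+3%:R[%classic.
(* The bound on [V] comes from writing u^(a - 1) as u^a / u, which covers both signs of a - 1. *)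
pose M := gamC a l * (n.+3%:R `^ a * n.+3%:R).
have M0 : 0 < M.
  have c0 : 0 < gamC a l by rewrite divr_gt0 ?powR_gt0// GammaR_gt0.
  by rewrite (mulr_gt0 c0)// mulr_gt0 ?powR_gt0.
have VM u : V u -> gam u <= M.
  rewrite /V/= in_itv/= => /andP[h1 h2].
  have u0 : 0 < u by rewrite (lt_trans _ h1).
  rewrite gamxE// /gamx /M ler_wpM2l//.
    by rewrite divr_ge0 ?powR_ge0// ltW// GammaR_gt0.
  have -> : u `^ (a - 1) = u `^ a / u.
    by rewrite -(mulr_powRB1 (ltW u0) a0) mulrAC divff ?mul1r// gt_eqF.
  rewrite -[leRHS]mulr1; apply: ler_pM; rewrite ?expR_ge0 ?mulr_ge0 ?powR_ge0 ?invr_ge0 ?(ltW u0)//.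
    apply: ler_pM; rewrite ?powR_ge0 ?invr_ge0 ?(ltW u0)//.
      by apply: ge0_ler_powR; rewrite ?nnegrE ?(ltW a0) ?(ltW u0) ?(ltW h2)//.
    by rewrite -[leRHS]invrK lef_pV2 ?posrE ?invr_gt0// ltW.
  by rewrite expR_le1 oppr_le0 mulr_ge0 ?ltW.
have mAK : measurable (A `&` K n) by exact: measurableI.
have fAK : (leb (A `&` K n) < +oo)%E.
  apply: (@le_lt_trans _ _ (leb (K n))).
    by apply: le_measure; [rewrite inE; exact: mAK|rewrite inE; exact: mK|exact: subIsetr].
  by rewrite /K lebesgue_measure_itv/=; case: ifPn => // _; rewrite -EFinB ltry.
have e40 : 0 < eps / (2 * M) by rewrite divr_gt0// mulr_gt0.
have [W [oW AW WA]] := lebesgue_regularity_outer mAK fAK e40.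
pose U := (W `&` V) `|` (~` K n).
have oV : open V by exact: itv_open.
have oWV : open (W `&` V) by exact: openI.
have cK : closed (K n) by exact: itv_closed.
have KV : K n `<=` V.
  move=> u; rewrite /K /V/= !in_itv/= => /andP[h1 h2]; apply/andP; split.
    by apply: lt_le_trans h1; rewrite ltf_pV2 ?posrE// ltr_nat.
  by apply: (le_lt_trans h2); rewrite ltr_nat.
exists U; split.
- by apply: openU => //; exact: closed_openC.
- move=> u Au; have [Ku|Ku] := pselect (K n u); [left|by right].
  by split; [apply: AW|exact: KV].
have mW : measurable W by exact: open_measurable.
have mV : measurable V by exact: measurable_itv.
have mD : measurable ((W `\` (A `&` K n)) `&` V `&` K n).
  by apply: measurableI => //; apply: measurableI => //; exact: measurableD.
have mCK : measurable (~` K n) by exact: measurableC.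
apply: (@le_trans _ _ (gmass (((W `\` (A `&` K n)) `&` V `&` K n) `|` ~` K n))).
  apply: gmass_le.
  - by apply: measurableD => //; apply: measurableU => //; exact: measurableI.
  - exact: measurableU.
  - move=> u [[[Wu Vu]|Ku] Au]; last by right.
    have [Ku|Ku] := pselect (K n u); [left|by right].
    by split => //; split => //; split => // -[].
rewrite gmassU//; last first.
  by apply/disj_setPS => u [[_ Ku] nKu].
have -> : eps = eps / 2 + eps / 2 by field.
rewrite EFinD leeD//.
have mDR : measurable ((W `\` (A `&` K n)) `&` V `&` K n `&` Rpos).
  by apply: measurableI => //; exact: measurable_Rpos.
apply: (@le_trans _ _ (\int[leb]_(u in (W `\` (A `&` K n)) `&` V `&` K n `&` Rpos) M%:E)%E).
  apply: ge0_le_integral => //.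
  - exact: mg.
  - by move=> u [[[_ Vu] _] _]; rewrite lee_fin VM.
rewrite integral_cst//.
apply: (@le_trans _ _ (M%:E * leb (W `\` (A `&` K n)))%E).
  rewrite lee_wpmul2l ?lee_fin ?(ltW M0)//.
  apply: le_measure; rewrite ?inE//; first exact: measurableD.
  by move=> u [[[]]].
apply: (@le_trans _ _ (M%:E * (eps / (2 * M))%:E)%E).
  by rewrite lee_wpmul2l ?lee_fin ?(ltW M0)// ltW.
rewrite -EFinM lee_fin le_eqVlt; apply/orP; left; apply/eqP; field.
by rewrite gt_eqF.
Qed.

End GammaRegularity.

Section Quantization.
Variable R : realType.
Implicit Types (y : R) (J : nat).

(** The sum counts the integers 0 <= j < J strictly below y, that is the minimum of J and y rounded
    up; rounding up overshoots by at most 1. *)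
Lemma sum_below_bounds J y : 0 <= y ->
  let s := \sum_(j < J) (if j%:R < y then 1 else 0 : R) in
  s <= y + 1 /\ s <= J%:R /\ (y <= J%:R -> y <= s) /\ (J%:R <= y -> s = J%:R).
Proof.
move=> y0; elim: J => [|J /= [h1 [h2 [h3 h4]]]] /=.
  rewrite big_ord0; split; first by rewrite addr_ge0.
  by [].
rewrite big_ord_recr/=; case: (ltP J%:R y) => Jy.
  rewrite (h4 (ltW Jy)) -[J.+1]addn1 natrD; split; first lra.
  by split => //; split.
rewrite addr0; split => //; split; first by rewrite (le_trans h2)// ler_nat.
split; first by move=> _; exact: h3.
by rewrite leNgt (le_lt_trans Jy)// ltr_nat.
Qed.

End Quantization.

(** * The Donsker-Varadhan bound for the law of X *)

Section Variational.
Variable R : realType.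
Variables (a l : R) (mu : probability R R).
Hypotheses (a12 : 1 / 2 <= a) (l0 : 0 < l) (mupos : mu Rpos = 1%E).
Local Notation dens := (dens a l mu).
Local Notation gam := (gamma_pdf a l).
Local Notation leb := (@lebesgue_measure R).
Local Notation Dent := (Dent a l mu).
Local Notation pathU := (pathU a l mu).
Local Notation gmass := (gmass a l).
Implicit Types (t x u : R).

Let a0 : 0 < a. Proof. by rewrite (lt_le_trans _ a12). Qed.

Variable S : R.
Hypothesis hS : forall t, 0 < t < 1 -> (Dent t <= S%:E)%E.

Let mgam (A : set R) : measurable_fun A gam.
Proof. by apply: measurable_funTS; exact: measurable_gamma_pdf. Qed.

Let mgM (f : R -> R) : measurable_fun setT f -> measurable_fun Rpos (fun u => gam u * f u).
Proof.
move=> mf; have mf' : measurable_fun Rpos f by exact: measurable_funTS.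
have h := measurable_funM (@mgam Rpos) mf'; exact: h.
Qed.

Let mgd t : 0 < t < 1 -> measurable_fun Rpos (fun u => gam u * dens t u).
Proof. by move=> t01; apply: measurable_funTS; exact: measurable_gam_dens. Qed.

Let gd0 t u : 0 < t < 1 -> Rpos u -> 0 <= gam u * dens t u.
Proof.
move=> t01; rewrite RposE => /ltW u0.
by rewrite mulr_ge0 ?gamma_pdf_ge0// ltW// dens_gt0.
Qed.

Lemma integral_gam_dens t : 0 < t < 1 -> (\int[leb]_(u in Rpos) (gam u * dens t u)%:E = 1)%E.
Proof.
move=> t01.
transitivity (\int[leb]_(u in Rpos) (1 * (gam u * dens t u))%:E)%E.
  by apply: eq_integral => u _; rewrite mul1r.
rewrite -(@integral_path R a l mu a12 l0 t (fun=> 1))//.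
transitivity (\int[mu]_(x in Rpos) 1)%E.
  apply: eq_integral => x; rewrite in_Rpos => /ltW x0.
  by under eq_integral do rewrite mul1r; exact: integral_ker.
rewrite integral_cst ?mul1e//; exact: measurable_Rpos.
Qed.

Let mM (c : R) (D : set R) f : measurable_fun D f -> measurable_fun D (fun u : R => c * f u).
Proof. by move=> mf; exact: measurable_funM. Qed.

(* The Young inequality at [g - N] gives the Donsker-Varadhan bound for X_t. *)
Lemma young_path t (g : R -> R) (N : R) : 0 < t < 1 -> 0 <= N ->
  measurable_fun setT g -> (forall u, 0 <= g u) ->
  (\int[leb]_(u in Rpos) (g u * (gam u * dens t u))%:E + 1 <=
   (N + S)%:E + (expR (- N))%:E * \int[leb]_(u in Rpos) (gam u * expR (g u))%:E)%E.
Proof.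
move=> t01 N0 mg g0; have mR := @measurable_Rpos R.
have gp u : Rpos u -> 0 <= gam u * phi (dens t u).
  rewrite RposE => /ltW u0.
  by rewrite mulr_ge0 ?gamma_pdf_ge0// phi_ge0// ltW// dens_gt0.
have mgp : measurable_fun Rpos (fun u => gam u * phi (dens t u)) by exact: measurable_gam_phi.
have mge : measurable_fun Rpos (fun u => gam u * expR (g u)).
  by apply: mgM; exact: measurableT_comp.
have m1 : measurable_fun Rpos (fun u => g u * (gam u * dens t u)).
  have mg' : measurable_fun Rpos g by exact: measurable_funTS.
  have h := measurable_funM mg' (mgd t01); exact: h.
have le : (\int[leb]_(u in Rpos) (g u * (gam u * dens t u) + gam u)%:E <=
    \int[leb]_(u in Rpos) (N * (gam u * dens t u) +
      (gam u * phi (dens t u) + expR (- N) * (gam u * expR (g u))))%:E)%E.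
  apply: ge0_le_integral_real => //.
  - by have h := measurable_funD m1 (@mgam Rpos); exact: h.
  - have h := measurable_funD (mM N (mgd t01)) (measurable_funD mgp (mM (expR (- N)) mge)); exact: h.
  - move=> u Ru; apply: addr_ge0; last exact: gamma_pdf_ge0.
    by apply: mulr_ge0 => //; exact: gd0.
  - move=> u Ru; move: (Ru); rewrite RposE => /ltW u0.
    have d0 : 0 <= dens t u by rewrite ltW// dens_gt0.
    have := @phi_young R (dens t u) (g u - N) d0.
    move=> /(ler_wpM2l (gamma_pdf_ge0 l u a0)).
    rewrite expRD; move: (expR (g u)) (expR (- N)) (phi (dens t u)) => p q r; lra.
have E1 : (\int[leb]_(u in Rpos) (g u * (gam u * dens t u) + gam u)%:E =
  \int[leb]_(u in Rpos) (g u * (gam u * dens t u))%:E + 1)%E.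
  rewrite ge0_integralD_real//.
  - by rewrite integral_gamma_pdf.
  - exact: mgam.
  - by move=> u Ru; apply: mulr_ge0 => //; exact: gd0.
  - by move=> u _; exact: gamma_pdf_ge0.
rewrite E1 in le; apply: (le_trans le).
have e0 u : 0 <= gam u * expR (g u) by rewrite mulr_ge0 ?gamma_pdf_ge0 ?expR_ge0.
rewrite ge0_integralD_real//; last 4 first.
- by apply: mM; exact: mgd.
- by have h := measurable_funD mgp (mM (expR (- N)) mge); exact: h.
- by move=> u Ru; apply: mulr_ge0 => //; exact: gd0.
- by move=> u Ru; apply: addr_ge0; [exact: gp|apply: mulr_ge0; rewrite ?expR_ge0].
rewrite ge0_integralD_real//; last 2 first.
- exact: mM.
- by move=> u Ru; apply: mulr_ge0; rewrite ?expR_ge0.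
rewrite ge0_integralZl_real//; last 2 first.
- exact: mgd.
- by move=> u Ru; exact: gd0.
rewrite integral_gam_dens// mule1 ge0_integralZl_real ?expR_ge0//.
rewrite addeA EFinD; apply: leeD => //; apply: leeD => //; exact: hS.
Qed.

Section Step.
Variables (M : R) (g : R -> R) (N : R) (J : nat) (eps : R).
Hypotheses (mg : measurable_fun setT g) (gM : forall u, 0 <= g u <= M) (N0 : 0 <= N).
Hypotheses (J0 : (0 < J)%N) (eps0 : 0 < eps) (M0 : 0 < M).

(* [g] is rounded up to a sum of [d * \1_(B j)], and each level set [B j] is then
   enlarged to an open set, for which weak convergence gives a lower bound. *)
Let d := M / J%:R.
Let d0 : 0 < d. Proof. by rewrite divr_gt0// ltr0n. Qed.

Let B j : set R := [set u | j%:R < g u / d] `&` Rpos.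

Let mB j : measurable (B j).
Proof.
apply: measurableI; last exact: measurable_Rpos.
have mgd' : measurable_fun setT (fun u => g u / d) by exact: measurable_funM.
rewrite [X in measurable X](_ : _ = setT `&` (fun u => g u / d) @^-1` `]j%:R, +oo[%classic).
  by apply: mgd' => //; exact: measurable_itv.
by apply/seteqP; split => u /=; rewrite in_itv/= andbT; [move=> h; split|case].
Qed.

Let exU j : { U : set R | [/\ open U, B j `<=` U & (gmass (U `\` B j) <= eps%:E)%E] }.
Proof.
by apply: cid; apply: gmass_outer_regular => //; exact: subIsetr.
Qed.

Let U j := sval (exU j).
Let oU j : open (U j). Proof. by rewrite /U; case: (exU j) => ? []. Qed.
Let BU j : B j `<=` U j. Proof. by rewrite /U; case: (exU j) => ? []. Qed.
Let UB j : (gmass (U j `\` B j) <= eps%:E)%E. Proof. by rewrite /U; case: (exU j) => ? []. Qed.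
Let mU j : measurable (U j). Proof. exact: open_measurable. Qed.
Let mUB j : measurable (U j `\` B j). Proof. exact: measurableD. Qed.

Let g' u : R := \sum_(j < J) d * (\1_(U j) u : R).

Let mI (A : set R) : measurable A -> measurable_fun setT (\1_A : R -> R).
Proof. by move=> mA; exact: measurable_indic. Qed.

Let mg' : measurable_fun setT g'.
Proof. by apply: measurable_sum => j; apply: mM; exact: mI. Qed.

Let g'0 u : 0 <= g' u.
Proof. by apply: sumr_ge0 => j _; rewrite mulr_ge0// ltW. Qed.

Let dJ : d * J%:R = M.
Proof. by rewrite /d -mulrA mulVf ?mulr1// pnatr_eq0 -lt0n. Qed.

Let g'M u : g' u <= M.
Proof.
rewrite -dJ /g' -mulr_sumr ler_wpM2l ?(ltW d0)//.
apply: (@le_trans _ _ (\sum_(j < J) (1 : R))).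
  by apply: ler_sum => j _; rewrite indicE; case: (_ \in _).
by rewrite sumr_const card_ord.
Qed.

Let gd u : 0 <= g u / d <= J%:R.
Proof.
have /andP[h1 h2] := gM u.
by rewrite divr_ge0 ?(ltW d0)//= ler_pdivrMr// mulrC dJ.
Qed.

Let sB u : Rpos u -> \sum_(j < J) (\1_(B j) u : R) = \sum_(j < J) (if j%:R < g u / d then 1 else 0 : R).
Proof.
move=> Ru; apply: eq_bigr => j _; rewrite indicE.
case: ifPn => h; first by rewrite mem_set.
by rewrite memNset// => -[/= h' _]; move/negP: h.
Qed.

Let g_le u : Rpos u -> g u <= \sum_(j < J) d * (\1_(B j) u : R).
Proof.
move=> Ru; rewrite -mulr_sumr sB// mulrC -ler_pdivrMr//.
have /andP[h1 h2] := gd u.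
have [_ [_ [h _]]] := sum_below_bounds J h1; exact: h.
Qed.

Let g'_le u : Rpos u -> (forall j : 'I_J, ~ (U j `\` B j) u) -> g' u <= g u + d.
Proof.
move=> Ru hu; have /andP[h1 h2] := gd u.
have [h _] := sum_below_bounds J h1.
have -> : g u + d = d * (g u / d + 1) by field; rewrite gt_eqF.
rewrite /g' -mulr_sumr ler_wpM2l ?(ltW d0)//; apply: le_trans h; rewrite -sB//.
apply: ler_sum => j _; rewrite !indicE; case: (boolP (u \in U j)) => // /set_mem Uu.
rewrite mem_set//; apply: contrapT => nB; exact: (hu j).
Qed.

Let eM := expR M.

(** Where some [U j] exceeds [B j] only the crude bound [g' u <= M] is available, but these excess
    sets have small gamma mass. Everywhere else [g'] is [g] rounded up, so it exceeds [g] by at most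
    the step [d]. *)
Let exp_g' u : Rpos u -> gam u * expR (g' u) <= expR d * (gam u * expR (g u)) +
  \sum_(j < J) eM * ((\1_(U j `\` B j) u : R) * gam u).
Proof.
move=> Ru; have g0 := gamma_pdf_ge0 l u a0.
have s0 : 0 <= \sum_(j < J) eM * ((\1_(U j `\` B j) u : R) * gam u).
  by apply: sumr_ge0 => j _; rewrite mulr_ge0 ?expR_ge0// mulr_ge0.
have [[j hj]|hu] := pselect (exists j : 'I_J, (U j `\` B j) u).
  rewrite (bigD1 j)//= indicE mem_set// mul1r.
  have r0 : 0 <= \sum_(i < J | i != j) eM * ((\1_(U i `\` B i) u : R) * gam u).
    by apply: sumr_ge0 => i _; rewrite mulr_ge0 ?expR_ge0// mulr_ge0.
  have k : gam u * expR (g' u) <= eM * gam u by rewrite mulrC ler_wpM2r// ler_expR.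
  have k2 : 0 <= expR d * (gam u * expR (g u)) by rewrite mulr_ge0 ?expR_ge0// mulr_ge0 ?expR_ge0.
  lra.
have k : g' u <= g u + d by apply: g'_le => // j hj; apply: hu; exists j.
have k2 : gam u * expR (g' u) <= gam u * (expR (g u) * expR d).
  by rewrite ler_wpM2l// -expRD ler_expR.
lra.
Qed.

Let G := (\int[leb]_(u in Rpos) (gam u * expR (g u))%:E)%E.

Let int_exp_g' : (\int[leb]_(u in Rpos) (gam u * expR (g' u))%:E <=
  (expR d)%:E * G + (eM * (J%:R * eps))%:E)%E.
Proof.
have mR := @measurable_Rpos R.
have mge h : measurable_fun setT h -> measurable_fun Rpos (fun u => gam u * expR (h u)).
  by move=> mh; apply: mgM; exact: measurableT_comp.
have e0 u : 0 <= gam u * expR (g u) by rewrite mulr_ge0 ?gamma_pdf_ge0 ?expR_ge0.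
have mi j : measurable_fun Rpos (fun u => (\1_(U j `\` B j) u : R) * gam u).
  have mi' : measurable_fun Rpos (\1_(U j `\` B j) : R -> R) by apply: measurable_funTS; exact: mI.
  have h := measurable_funM mi' (@mgam Rpos); exact: h.
have ms : measurable_fun Rpos (fun u => \sum_(j < J) eM * ((\1_(U j `\` B j) u : R) * gam u)).
  by apply: measurable_sum => j; exact: mM.
have i0 j u : 0 <= eM * ((\1_(U j `\` B j) u : R) * gam u).
  by rewrite mulr_ge0 ?expR_ge0// mulr_ge0 ?gamma_pdf_ge0.
apply: (@le_trans _ _ (\int[leb]_(u in Rpos) (expR d * (gam u * expR (g u)) +
  \sum_(j < J) eM * ((\1_(U j `\` B j) u : R) * gam u))%:E)%E).
  apply: ge0_le_integral_real => //.
  - exact: mge.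
  - by have h := measurable_funD (mM (expR d) (mge _ mg)) ms; exact: h.
  - by move=> u _; rewrite mulr_ge0 ?gamma_pdf_ge0 ?expR_ge0.
rewrite ge0_integralD_real//; last 3 first.
- by apply: mM; exact: mge.
- by move=> u _; rewrite mulr_ge0 ?expR_ge0.
- by move=> u _; apply: sumr_ge0.
rewrite ge0_integralZl_real ?expR_ge0//; last exact: mge.
apply: leeD => //.
under eq_integral do rewrite -sumEFin.
rewrite ge0_integral_sum//; last 2 first.
- by move=> j; apply/measurable_EFinP; exact: mM.
- by move=> j u _; rewrite lee_fin.
apply: (@le_trans _ _ (\sum_(j < J) (eM * eps)%:E)%E); last first.
  by rewrite sumEFin sumr_const card_ord lee_fin -[leLHS]mulr_natl mulrCA.
apply: lee_sum => j _.
rewrite ge0_integralZl_real ?expR_ge0//; last 2 first.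
- exact: mi.
- by move=> u _; rewrite mulr_ge0 ?gamma_pdf_ge0.
rewrite EFinM lee_wpmul2l ?lee_fin ?expR_ge0//.
apply: le_trans (UB j); rewrite /gmass [X in (_ <= X)%E]integral_mkcondl le_eqVlt.
apply/orP; left; apply/eqP; apply: eq_integral => u _.
by rewrite patchE indicE; case: ifPn => uA; rewrite ?mul1r ?mul0r.
Qed.

Let pathg' t : 0 < t < 1 -> (\sum_(j < J) d%:E * pathU t (U j) =
   \int[leb]_(u in Rpos) (g' u * (gam u * dens t u))%:E)%E.
Proof.
move=> t01; have mR := @measurable_Rpos R.
have mi j : measurable_fun Rpos (fun u => (\1_(U j) u : R) * (gam u * dens t u)).
  have mi' : measurable_fun Rpos (\1_(U j) : R -> R) by apply: measurable_funTS; exact: mI.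
  have h := measurable_funM mi' (mgd t01); exact: h.
have i0 j u : Rpos u -> 0 <= (\1_(U j) u : R) * (gam u * dens t u).
  by move=> Ru; apply: mulr_ge0 => //; exact: gd0.
transitivity (\int[leb]_(u in Rpos) \sum_(j < J) (d * ((\1_(U j) u : R) * (gam u * dens t u)))%:E)%E; last first.
  apply: eq_integral => u _; rewrite sumEFin /g' mulr_suml; congr EFin.
  by apply: eq_bigr => j _; rewrite mulrA.
rewrite ge0_integral_sum//; last 2 first.
- by move=> j; apply/measurable_EFinP; exact: mM.
- by move=> j u Ru; rewrite lee_fin; apply: mulr_ge0; [exact: ltW|exact: i0].
apply: eq_bigr => j _; rewrite ge0_integralZl_real//; [exact: mi|by move=> u; exact: i0|exact: ltW].
Qed.

(** The dual bound [young_path] is applied to [g'], a combination of indicators of open sets, and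
    passes to the law of X by [open_sum_le]. Then [g] lies below the corresponding sum over the
    [B j], each contained in [U j]. *)
Lemma variational_step :
  (\int[mu]_(x in Rpos) (g x)%:E + 1 <=
   (N + S)%:E + (expR (- N))%:E * ((expR d)%:E * G + (eM * (J%:R * eps))%:E))%E.
Proof.
have mR := @measurable_Rpos R.
set X := ((N + S)%:E + _)%E.
have le1 : (\sum_(j < J) d%:E * mu (U j `&` Rpos) <= X - 1)%E.
  apply: (@open_sum_le R a l mu a12 l0 J U d _ oU (ltW d0)).
  move=> t t01; rewrite pathg'// leeBrDr//.
  apply: (le_trans (young_path t01 N0 mg' g'0)); rewrite /X.
  by apply: leeD => //; apply: lee_wpmul2l; [rewrite lee_fin expR_ge0|exact: int_exp_g'].
rewrite -leeBrDr//; apply: le_trans le1.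
have mi j : measurable_fun Rpos (\1_(B j) : R -> R) by apply: measurable_funTS; exact: mI.
apply: (@le_trans _ _ (\int[mu]_(x in Rpos) (\sum_(j < J) d * (\1_(B j) x : R))%:E)%E).
  apply: ge0_le_integral_real => //.
  - exact: measurable_funTS.
  - by apply: measurable_sum => j; exact: mM.
  - by move=> u _; case/andP: (gM u).
under eq_integral do rewrite -sumEFin.
rewrite ge0_integral_sum//; last 2 first.
- by move=> j; apply/measurable_EFinP; exact: mM.
- by move=> j u _; rewrite lee_fin mulr_ge0// ltW.
apply: lee_sum => j _; rewrite ge0_integralZl_real ?(ltW d0)//.
rewrite lee_wpmul2l ?lee_fin ?(ltW d0)// integral_indic//.
apply: le_measure; rewrite ?inE.
- exact: measurableI.
- exact: measurableI.
- by apply: setSI; exact: BU.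
Qed.

End Step.

Lemma variational (M : R) (g : R -> R) (N : R) : measurable_fun setT g ->
  (forall u, 0 <= g u <= M) -> 0 <= N -> 0 < M ->
  (\int[mu]_(x in Rpos) (g x)%:E + 1 <=
   (N + S)%:E + (expR (- N))%:E * \int[leb]_(u in Rpos) (gam u * expR (g u))%:E)%E.
Proof.
move=> mg gM N0 M0.
have mR := @measurable_Rpos R.
have mge : measurable_fun Rpos (fun u => gam u * expR (g u)).
  by apply: mgM; exact: measurableT_comp.
set G := (\int[leb]_(u in Rpos) (gam u * expR (g u))%:E)%E.
have Gfin : G \is a fin_num.
  rewrite ge0_fin_numE; last first.
    by apply: integral_ge0 => u _; rewrite lee_fin mulr_ge0 ?gamma_pdf_ge0 ?expR_ge0.
  apply: (@le_lt_trans _ _ (\int[leb]_(u in Rpos) (expR M * gam u)%:E)%E).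
    apply: ge0_le_integral_real => //.
    - by apply: mM; exact: mgam.
    - by move=> u _; rewrite mulr_ge0 ?gamma_pdf_ge0 ?expR_ge0.
    - move=> u _; rewrite mulrC ler_wpM2r ?gamma_pdf_ge0// ler_expR.
      by case/andP: (gM u).
  rewrite ge0_integralZl_real ?expR_ge0//; last 2 first.
  - exact: mgam.
  - by move=> u _; exact: gamma_pdf_ge0.
  by rewrite integral_gamma_pdf// mule1 ltry.
(* The choice is J + 1 levels and eps = 1 / (J + 1)^2. The step M / (J + 1) then tends to 0, and so
   does the total excess mass (J + 1) eps = 1 / (J + 1), which is weighted by the fixed factor
   exp(M). *)
have hc : ((fun J => (N + S)%:E + (expR (- N))%:E *
    ((expR (M / J.+1%:R))%:E * G + (expR M * (J.+1%:R * (J.+1%:R^-1 * J.+1%:R^-1)))%:E)) J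
    @[J --> \oo] --> (N + S)%:E + (expR (- N))%:E * G)%E.
  have h : (N + S + expR (- N) * (expR (M / J.+1%:R) * fine G +
      expR M * (J.+1%:R * (J.+1%:R^-1 * J.+1%:R^-1))) @[J --> \oo] --> N + S + expR (- N) * fine G).
    apply: cvgD; first exact: cvg_cst.
    apply: cvgMr.
    rewrite [X in _ --> X](_ : fine G = expR (M * 0) * fine G + expR M * 0); last first.
      by rewrite mulr0 expR0 mul1r mulr0 addr0.
    apply: cvgD.
      apply: cvgMl; apply: (@cvg_comp _ _ _ (fun J : nat => M / J.+1%:R) (@expR R)); last exact: continuous_expR.
      by apply: cvgMr; exact: cvg_inv1.
    apply: cvgMr.
    under eq_fun do rewrite mulrA divff ?mul1r ?pnatr_eq0//.
    exact: cvg_inv1.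
  rewrite -(fineK Gfin).
  have h' : ((N + S + expR (- N) * (expR (M / J.+1%:R) * fine G +
      expR M * (J.+1%:R * (J.+1%:R^-1 * J.+1%:R^-1))))%:E @[J --> \oo] -->
      (N + S + expR (- N) * fine G)%:E)%E.
    by apply: cvg_EFin; first by near=> J.
  exact: h'.
apply: (cvge_ge _ hc); near=> J.
by apply: variational_step => //; rewrite mulr_gt0 ?invr_gt0.
Unshelve. all: by end_near. Qed.

End Variational.

(** * Relative entropy of the initial law *)

Section DensityIntegral.
Variable R : realType.
Variables (mu : probability R R) (f : R -> R).
Hypothesis df : is_density mu f.
Local Notation leb := (@lebesgue_measure R).
Implicit Types (k : R -> R) (s u x : R).

Let mf : measurable_fun setT f. Proof. by case: df. Qed.
Let f0 u : 0 <= f u. Proof. by case: df => _ [h _]; exact: h. Qed.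
Let muE (A : set R) : measurable A -> (mu A = \int[leb]_(u in A `&` Rpos) (f u)%:E)%E.
Proof. by case: df => _ [_ h]; exact: h. Qed.

(* The layer cake formula reduces the identity to indicator functions. *)
Lemma integral_density k : measurable_fun setT k -> (forall x, 0 <= k x) ->
  (\int[mu]_(x in Rpos) (k x)%:E = \int[leb]_(x in Rpos) (f x * k x)%:E)%E.
Proof.
move=> mk k0; have mR := @measurable_Rpos R.
have mI : measurable_fun setT (\1_(Rpos) : R -> R) by exact: measurable_indic.
pose c x s : R := \1_Rpos (k x - s).
have c0 x s : 0 <= c x s by rewrite /c.
have mc : measurable_fun setT (fun p : R * R => c p.1 p.2).
  apply: (measurableT_comp mI); apply: measurable_funB; last exact: measurable_snd.
  by apply: (measurableT_comp mk); exact: measurable_fst.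
have mc1 s : measurable_fun setT (fun x => c x s).
  by apply: (measurableT_comp mI); exact: measurable_funB.
have mc2 x : measurable_fun setT (fun s => c x s).
  by apply: (measurableT_comp mI); exact: measurable_funB.
have ick x : (\int[leb]_(s in Rpos) (c x s)%:E = (k x)%:E)%E.
  transitivity (\int[leb]_(s in Rpos) (\1_(`]-oo, k x[%classic) s : R)%:E)%E.
    apply: eq_integral => s _; congr EFin; rewrite /c !indicE; congr (_%:R).
    by rewrite in_Rpos subr_gt0 mem_setE in_itv.
  rewrite integral_indic//.
  have h : (leb (`]-oo, k x[%classic `&` Rpos) = (k x)%:E)%E.
    rewrite (_ : `]-oo, k x[%classic `&` Rpos = `]0%R, k x[%classic).
      rewrite lebesgue_measure_itv/= lte_fin; case: ltP => h.
        by rewrite -EFinB subr0.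
      by have -> : k x = 0 by apply/eqP; rewrite eq_le h k0.
    apply/seteqP; split => s; rewrite /= !in_itv/= RposE; first by case=> -> ->.
    by case/andP.
  exact: h.
transitivity (\int[mu]_(x in Rpos) \int[leb]_(s in Rpos) (c x s)%:E)%E.
  by apply: eq_integral => x _; rewrite ick.
transitivity (\int[leb]_(s in Rpos) \int[mu]_(x in Rpos) (c x s)%:E)%E.
  apply: (@tonelli_on _ _ _ _ _ mu leb Rpos Rpos (fun p => (c p.1 p.2)%:E)).
  - exact: mR.
  - exact: mR.
  - by apply/measurable_EFinP; apply: measurable_funTS; exact: mc.
  - by move=> x s _ _; rewrite lee_fin.
transitivity (\int[leb]_(s in Rpos) \int[leb]_(x in Rpos) (f x * c x s)%:E)%E.
  apply: eq_integral => s _.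
  pose A : set R := [set x | Rpos (k x - s)].
  have mA : measurable A.
    have mks : measurable_fun setT (fun x => k x - s) by exact: measurable_funB.
    by have := mks measurableT _ mR; rewrite setTI.
  have cE x : c x s = \1_A x by [].
  transitivity (mu (A `&` Rpos)).
    by rewrite -integral_indic//; apply: eq_integral => x _; rewrite cE.
  rewrite muE; last exact: measurableI.
  rewrite -setIA setIid [LHS]integral_mkcondl; apply: eq_integral => x _.
  by rewrite patchE cE indicE; case: ifPn => _; rewrite ?mulr1 ?mulr0.
transitivity (\int[leb]_(x in Rpos) \int[leb]_(s in Rpos) (f x * c x s)%:E)%E.
  apply/esym; apply: (@tonelli_on _ _ _ _ _ leb leb Rpos Rpos (fun p => (f p.1 * c p.1 p.2)%:E)).
  - exact: mR.
  - exact: mR.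
  - apply/measurable_EFinP; apply: measurable_funTS; apply: measurable_funM; last exact: mc.
    by apply: (measurableT_comp mf); exact: measurable_fst.
  - by move=> x s _ _; rewrite lee_fin mulr_ge0.
apply: eq_integral => x _; rewrite ge0_integralZl_real//.
- by rewrite ick.
- by apply: measurable_funTS; exact: mc2.
Qed.

Lemma integral_density1 : mu Rpos = 1%E -> (\int[leb]_(x in Rpos) (f x)%:E = 1)%E.
Proof.
by move=> mupos; have h := muE (@measurable_Rpos R); rewrite mupos setIid in h; rewrite h.
Qed.

End DensityIntegral.

(** * Relative entropy of a law with a density *)

Section RelativeEntropy.
Variable R : realType.
Variables (a l : R) (mu : probability R R) (f : R -> R).
Hypotheses (a12 : 1 / 2 <= a) (l0 : 0 < l) (mupos : mu Rpos = 1%E).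
Hypothesis df : is_density mu f.
Local Notation dens := (dens a l mu).
Local Notation gam := (gamma_pdf a l).
Local Notation ker := (ker a l).
Local Notation leb := (@lebesgue_measure R).
Implicit Types (t x u : R).

Let a0 : 0 < a. Proof. by rewrite (lt_le_trans _ a12). Qed.
Let mf : measurable_fun setT f. Proof. by case: df. Qed.
Let f0 u : 0 <= f u. Proof. by case: df => _ [h _]; exact: h. Qed.

Definition reld u : R := f u / gam u.

Let h := reld.

Let mgam (A : set R) : measurable_fun A gam.
Proof. by apply: measurable_funTS; exact: measurable_gamma_pdf. Qed.

Let gp u : Rpos u -> 0 < gam u.
Proof. by rewrite RposE => u0; exact: gamma_pdf_gt0. Qed.

Lemma measurable_reld : measurable_fun Rpos reld.
Proof.
have m1 : measurable_fun Rpos (fun u => gam u `^ (-1)).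
  exact: (measurableT_comp (measurable_powR _) (@mgam Rpos)).
have m2 : measurable_fun Rpos f by exact: measurable_funTS.
have m3 : measurable_fun Rpos (fun u => f u * gam u `^ (-1)).
  by have k := measurable_funM m2 m1; exact: k.
apply: (@eq_measurable_fun _ _ _ _ _ (fun u => f u * gam u `^ (-1))); last exact: m3.
by move=> u; rewrite in_Rpos => u0; rewrite /= powR_inv1// ltW// gamma_pdf_gt0.
Qed.

Let h0 u : 0 <= h u.
Proof. by rewrite divr_ge0// gamma_pdf_ge0. Qed.

Let gh u : Rpos u -> gam u * h u = f u.
Proof. by move=> /gp g0; rewrite /h /reld mulrC divfK// gt_eqF. Qed.

Let mphih : measurable_fun Rpos (fun u => gam u * phi (h u)).
Proof.
have m1 : measurable_fun Rpos (fun u => phi (h u)).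
  exact: (measurableT_comp (@measurable_phi R) measurable_reld).
have k := measurable_funM (@mgam Rpos) m1; exact: k.
Qed.

Definition relent : \bar R := (\int[leb]_(u in Rpos) (gam u * phi (reld u))%:E)%E.

Let F u := f u * ln (f u / gam u).

Let mF : measurable_fun Rpos F.
Proof.
have m1 : measurable_fun Rpos (fun u => ln (h u)).
  exact: (measurableT_comp (@measurable_ln R) measurable_reld).
have m2 : measurable_fun Rpos f by exact: measurable_funTS.
have k := measurable_funM m2 m1; exact: k.
Qed.

Let FE u : Rpos u -> F u = gam u * phi (h u) + f u - gam u.
Proof. by move=> Ru; rewrite /F /phi -/(h u) -{1}(gh Ru) -[in RHS](gh Ru); ring. Qed.

(** Pointwise f ln(f / gam) = gam phi(h) + f - gam, and [f] and [gam] both have mass 1. The negative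
    part is dominated by [gam], so the signed integral is well defined and the identity persists
    when [relent] is infinite. *)
Lemma relentE : (\int[leb]_(u in Rpos) (f u * ln (f u / gam u))%:E = relent)%E.
Proof.
have mR := @measurable_Rpos R.
pose P u := Num.max (F u) 0; pose Q u := Num.max (- F u) 0.
have mP : measurable_fun Rpos P by exact: measurable_maxr.
have mQ : measurable_fun Rpos Q by apply: measurable_maxr => //; exact: measurable_funN.
have P0 u : 0 <= P u by rewrite le_max lexx orbT.
have Q0 u : 0 <= Q u by rewrite le_max lexx orbT.
have PQ u : P u - Q u = F u.
  by rewrite /P /Q; case: (lerP 0 (F u)) => h1; case: (lerP 0 (- F u)) => h2; lra.
have p0 u : Rpos u -> 0 <= gam u * phi (h u).
  by move=> /gp/ltW g0; rewrite mulr_ge0// phi_ge0.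
have mf' : measurable_fun Rpos f by exact: measurable_funTS.
have If : (\int[leb]_(x in Rpos) (f x)%:E = 1)%E by exact: (integral_density1 df).
have Ig : (\int[leb]_(x in Rpos) (gam x)%:E = 1)%E by exact: integral_gamma_pdf.
have g0 u : 0 <= gam u by exact: gamma_pdf_ge0.
have Qfin : (\int[leb]_(u in Rpos) (Q u)%:E \is a fin_num)%E.
  rewrite ge0_fin_numE; last by apply: integral_ge0 => u _; rewrite lee_fin.
  apply: (@le_lt_trans _ _ 1%E); last exact: ltry.
  rewrite -Ig; apply: ge0_le_integral_real => //; first exact: mgam.
  move=> u Ru.
  by rewrite /Q ge_max g0 andbT FE//; have := p0 _ Ru; have := f0 u; lra.
have E : (\int[leb]_(u in Rpos) (P u)%:E + 1 = relent + (1 + \int[leb]_(u in Rpos) (Q u)%:E))%E.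
  have e1 : (\int[leb]_(u in Rpos) (P u + gam u)%:E = \int[leb]_(u in Rpos) (P u)%:E + 1)%E.
    rewrite ge0_integralD_real//; first by rewrite Ig.
    exact: mgam.
  have mfQ : measurable_fun Rpos (fun u => f u + Q u).
    by have k := measurable_funD mf' mQ; exact: k.
  have e2 : (\int[leb]_(u in Rpos) (gam u * phi (h u) + (f u + Q u))%:E =
      relent + (1 + \int[leb]_(u in Rpos) (Q u)%:E))%E.
    rewrite ge0_integralD_real//; last by move=> u _; rewrite addr_ge0.
    by rewrite ge0_integralD_real// If.
  rewrite -e1 -e2; apply: eq_integral => u; rewrite inE => Ru; congr EFin.
  by have := PQ u; rewrite FE//; lra.
rewrite integralE.
have -> : (\int[leb]_(u in Rpos) ((fun u => (F u)%:E)^\+ u) = \int[leb]_(u in Rpos) (P u)%:E)%E.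
  by apply: eq_integral => u _; rewrite funeposE EFin_max.
have -> : (\int[leb]_(u in Rpos) ((fun u => (F u)%:E)^\- u) = \int[leb]_(u in Rpos) (Q u)%:E)%E.
  by apply: eq_integral => u _; rewrite funenegE EFin_max.
have R0 : (0 <= relent)%E by apply: integral_ge0 => u Ru; rewrite lee_fin p0.
have PP : (0 <= \int[leb]_(u in Rpos) (P u)%:E)%E by apply: integral_ge0 => u _; rewrite lee_fin.
move: E PP R0; rewrite -(fineK Qfin).
move: (\int[leb]_(u in Rpos) (P u)%:E)%E relent (fine _) => [p| |] [r| |] q //=.
- by rewrite -!EFinD => -[k] _ _; congr EFin; lra.
Qed.

(** By symmetry [gam x * ker t x u] is, for each u, a probability density in x, and [dens t u] is
    the mean of h under it. Jensen's inequality holds for each u; integrating it against the gamma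
    law and using the mass 1 of the kernel in u gives back the entropy of h. *)
Lemma Dent_le_relent t : 0 < t < 1 -> (Dent a l mu t <= relent)%E.
Proof.
move=> t01; have mR := @measurable_Rpos R.
have mk : measurable_fun setT (fun p : R * R => ker t p.1 p.2) by exact: measurable_ker_joint.
have mk1 u (D : set R) : measurable_fun D (fun x => ker t x u).
  apply: measurable_funTS.
  have m1 : measurable_fun setT (fun x : R => (x, u)) by exact: measurable_fun_pair.
  exact: (measurableT_comp mk m1).
have k0 x u : Rpos x -> Rpos u -> 0 <= ker t x u.
  by rewrite !RposE => /ltW x0 /ltW u0; rewrite ltW// ker_gt0.
have Ik u : Rpos u -> (\int[leb]_(x in Rpos) (gam x * ker t x u)%:E = 1)%E.
  rewrite RposE => u0; transitivity (\int[leb]_x (gam x * ker t u x)%:E)%E.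
    transitivity (\int[leb]_(x in Rpos) (gam x * ker t u x)%:E)%E.
      by apply: eq_integral => x _; rewrite kerC.
    by apply: integral_Rpos_setT => x x0; rewrite gamma_pdf_out ?mul0r.
  by apply: integral_ker => //; exact: ltW.
have mgk u : measurable_fun Rpos (fun x => gam x * ker t x u).
  by have k := measurable_funM (@mgam Rpos) (mk1 u Rpos); exact: k.
have gk0 x u : Rpos x -> Rpos u -> 0 <= gam x * ker t x u.
  by move=> Rx Ru; rewrite mulr_ge0 ?k0// ltW// gp.
have mphi' : measurable_fun Rpos (fun x => phi (h x)).
  exact: (measurableT_comp (@measurable_phi R) measurable_reld).
have jensen u : Rpos u -> ((phi (dens t u))%:E <=
    \int[leb]_(x in Rpos) (gam x * ker t x u * phi (h x))%:E)%E.
  move=> Ru; have u0 : 0 < u by move: Ru; rewrite RposE.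
  apply: (@phi_jensen R _ _ leb Rpos (fun x => gam x * ker t x u) h (dens t u) mR (mgk u) measurable_reld).
  - by move=> x Rx; exact: gk0.
  - by move=> x _; exact: h0.
  - by apply: dens_gt0 => //; exact: ltW.
  - exact: Ik.
  rewrite EFin_dens//; last exact: ltW.
  (* The kernel is cut to the half-line because [integral_density] asks for a function that is
     nonnegative everywhere. *)
  pose k x := (ker t x u) * (\1_Rpos x : R).
  have mk' : measurable_fun setT k.
    by apply: measurable_funM => //; exact: measurable_indic.
  have k'0 x : 0 <= k x.
    rewrite /k indicE; case: (boolP (x \in Rpos)) => [/set_mem Rx|_]; rewrite ?mulr0// mulr1.
    exact: k0.
  transitivity (\int[mu]_(x in Rpos) (k x)%:E)%E; last first.
    by apply: eq_integral => x xR; rewrite /k indicE xR mulr1.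
  rewrite (integral_density df mk' k'0); apply: eq_integral => x xR.
  by rewrite /k indicE xR mulr1 -(gh (set_mem xR)); congr EFin; ring.
have mj : measurable_fun (Rpos `*` Rpos)
    (fun p : R * R => gam p.1 * (gam p.2 * ker t p.2 p.1 * phi (h p.2))).
  have c1 : measurable_fun (Rpos `*` Rpos) (fun p : R * R => gam p.1).
    by apply: measurable_funTS; apply: (measurableT_comp (@measurable_gamma_pdf R a l)); exact: measurable_fst.
  have c2 : measurable_fun (Rpos `*` Rpos) (fun p : R * R => gam p.2).
    by apply: measurable_funTS; apply: (measurableT_comp (@measurable_gamma_pdf R a l)); exact: measurable_snd.
  have c3 : measurable_fun (Rpos `*` Rpos) (fun p : R * R => ker t p.2 p.1).
    apply: measurable_funTS.
    by under eq_fun do rewrite kerC; exact: mk.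
  have c4 : measurable_fun (Rpos `*` Rpos) (fun p : R * R => phi (h p.2)).
    have m1 : measurable_fun setT ((fun x => phi (h x)) \_ Rpos).
      by apply/(measurable_restrictT _ mR).
    have m2 : measurable_fun (Rpos `*` Rpos) (fun p : R * R => ((fun x => phi (h x)) \_ Rpos) p.2).
      by apply: measurable_funTS; apply: (measurableT_comp m1); exact: measurable_snd.
    apply: (@eq_measurable_fun _ _ _ _ _ (fun p : R * R => ((fun x => phi (h x)) \_ Rpos) p.2)); last exact: m2.
    by move=> [x u] /set_mem[/= _ Ru]; rewrite patchE mem_set.
  exact: (measurable_funM c1 (measurable_funM (measurable_funM c2 c3) c4)).
have ph0 x : 0 <= phi (h x) by exact: phi_ge0.
apply: (@le_trans _ _ (\int[leb]_(u in Rpos) \int[leb]_(x in Rpos)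
    (gam u * (gam x * ker t x u * phi (h x)))%:E)%E).
  apply: ge0_le_integral => //.
  - by move=> u; rewrite RposE => /ltW u0; rewrite lee_fin mulr_ge0 ?gamma_pdf_ge0// phi_ge0// ltW// dens_gt0.
  - by apply/measurable_EFinP; exact: measurable_gam_phi.
  - apply: (@measurable_tonelli_on1 _ _ _ _ _ leb Rpos Rpos (fun p => (gam p.1 * (gam p.2 * ker t p.2 p.1 * phi (h p.2)))%:E)).
    + exact: mR.
    + exact: mR.
    + by apply/measurable_EFinP; exact: mj.
    + by move=> u x Ru Rx; rewrite lee_fin mulr_ge0 ?(ltW (gp Ru))// mulr_ge0// gk0.
  - move=> u Ru; rewrite ge0_integralZl_real//.
    + by rewrite EFinM lee_wpmul2l ?jensen// lee_fin ltW// gp.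
    + by have k := measurable_funM (mgk u) mphi'; exact: k.
    + by move=> x Rx; rewrite mulr_ge0// gk0.
    + by rewrite ltW// gp.
rewrite le_eqVlt; apply/orP; left; apply/eqP.
transitivity (\int[leb]_(x in Rpos) \int[leb]_(u in Rpos)
    (gam u * (gam x * ker t x u * phi (h x)))%:E)%E.
  apply: (@tonelli_on _ _ _ _ _ leb leb Rpos Rpos (fun p => (gam p.1 * (gam p.2 * ker t p.2 p.1 * phi (h p.2)))%:E)).
  - exact: mR.
  - exact: mR.
  - by apply/measurable_EFinP; exact: mj.
  - by move=> u x Ru Rx; rewrite lee_fin mulr_ge0 ?(ltW (gp Ru))// mulr_ge0// gk0.
apply: eq_integral => x /set_mem Rx.
transitivity (\int[leb]_(u in Rpos) (gam x * phi (h x) * (gam u * ker t u x))%:E)%E.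
  by apply: eq_integral => u _; rewrite (kerC a l t x); congr EFin; ring.
rewrite ge0_integralZl_real//.
- by rewrite Ik// mule1.
- exact: mgk.
- by move=> u Ru; exact: gk0.
- by rewrite mulr_ge0// ltW// gp.
Qed.

End RelativeEntropy.

Section BorelCopy.
Variables (R : realType) (mu : probability R R).

(* [mu] on the copy of [R] that carries the Lebesgue measure *)
Definition borel_copy (A : set (measurableTypeR R)) : \bar R := mu A.

Let copy0 : borel_copy set0 = 0%E. Proof. exact: measure0. Qed.

Let copy_ge0 A : (0 <= borel_copy A)%E. Proof. exact: measure_ge0. Qed.

Let copy_sigma_additive : semi_sigma_additive borel_copy.
Proof. by move=> F mF tF mU; exact: (@measure_semi_sigma_additive _ _ _ mu F mF tF mU). Qed.

HB.instance Definition _ :=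
  isMeasure.Build _ _ _ borel_copy copy0 copy_ge0 copy_sigma_additive.

Let copy_fin : fin_num_fun borel_copy.
Proof. by move=> A mA; exact: (@fin_num_measure _ _ _ mu A mA). Qed.

HB.instance Definition _ := Measure_isFinite.Build _ _ _ borel_copy copy_fin.

End BorelCopy.

(** * Existence of a density and lower semicontinuity of the entropy *)

Section EntropyLowerBound.
Variable R : realType.
Variables (a l : R) (mu : probability R R).
Hypotheses (a12 : 1 / 2 <= a) (l0 : 0 < l) (mupos : mu Rpos = 1%E).
Local Notation gam := (gamma_pdf a l).
Local Notation leb := (@lebesgue_measure R).
Implicit Types (t x u : R).

Let a0 : 0 < a. Proof. by rewrite (lt_le_trans _ a12). Qed.

Variable S : R.
Hypothesis hS : forall t, 0 < t < 1 -> (Dent a l mu t <= S%:E)%E.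

Let mR := @measurable_Rpos R.

Let mgam (A : set R) : measurable_fun A gam.
Proof. by apply: measurable_funTS; exact: measurable_gamma_pdf. Qed.

Lemma mu_out_Rpos : mu (~` Rpos) = 0%E.
Proof.
have h := probability_setC mu mR; rewrite mupos in h.
by rewrite h -EFinB subrr.
Qed.

Lemma mu_Rpos_setI (A : set R) : measurable A -> mu A = mu (A `&` Rpos).
Proof.
move=> mA; rewrite -[in LHS](setIT A) -(setUv Rpos) setIUr measureU.
- have h : mu (A `&` ~` Rpos) = 0%E; last by have := congr1 (fun z => (mu (A `&` Rpos) + z)%E) h; rewrite adde0.
  apply/eqP; rewrite eq_le measure_ge0 andbT -mu_out_Rpos.
  apply: le_measure; rewrite ?inE//.
  - by apply: measurableI => //; exact: measurableC.
  - exact: measurableC.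
- exact: measurableI.
- by apply: measurableI => //; exact: measurableC.
- by rewrite setIACA setICr setI0.
Qed.

(** For g equal to M on a Lebesgue-null set and 0 elsewhere, exp(g) has gamma integral 1. The
    variational bound at N = 0 then gives M mu(A) <= S for every M > 0. *)
Lemma mu_dominated (A : set R) : measurable A -> leb A = 0%E -> mu A = 0%E.
Proof.
move=> mA A0; rewrite mu_Rpos_setI//.
have mI : measurable_fun setT (\1_A : R -> R) by exact: measurable_indic.
have g0 u : 0 <= gam u by exact: gamma_pdf_ge0.
have mIg : measurable_fun Rpos (fun u => (\1_A u : R) * gam u).
  have mi : measurable_fun Rpos (\1_A : R -> R) by exact: measurable_funTS.
  by have h := measurable_funM mi (@mgam Rpos); exact: h.
have I0 : (\int[leb]_(u in Rpos) ((\1_A u : R) * gam u)%:E = 0)%E.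
  transitivity (\int[leb]_(u in A `&` Rpos) (gam u)%:E)%E.
    rewrite [RHS]integral_mkcondl; apply: eq_integral => u _.
    by rewrite patchE indicE; case: ifPn => _; rewrite ?mul1r ?mul0r.
  apply: null_set_integral.
  - exact: measurableI.
  - by apply/measurable_EFinP; exact: mgam.
  - apply/eqP; rewrite eq_le measure_ge0 andbT -A0.
    by apply: le_measure; rewrite ?inE//; exact: measurableI.
have bound (M : R) : 0 < M -> (M%:E * mu (A `&` Rpos) <= S%:E)%E.
  move=> M0; pose g u := M * (\1_A u : R).
  have mg : measurable_fun setT g by exact: measurable_funM.
  have gM u : 0 <= g u <= M.
    by rewrite /g indicE; case: (_ \in _); rewrite ?mulr1 ?mulr0 lexx ltW.
  have := variational a12 l0 mupos hS mg gM (lexx 0) M0.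
  rewrite add0r oppr0 expR0 mul1e => le.
  have le2 : (\int[leb]_(u in Rpos) (gam u * expR (g u))%:E <= 1)%E.
    apply: (@le_trans _ _ (\int[leb]_(u in Rpos) (gam u + expR M * ((\1_A u : R) * gam u))%:E)%E).
      apply: ge0_le_integral_real => //.
      - have me : measurable_fun Rpos (fun u => expR (g u)).
          by apply: measurable_funTS; exact: measurableT_comp.
        by have h := measurable_funM (@mgam Rpos) me; exact: h.
      - have h := measurable_funD (@mgam Rpos) (measurable_funM (measurable_cst (expR M)) mIg); exact: h.
      - by move=> u _; rewrite mulr_ge0 ?expR_ge0.
      - move=> u _; rewrite /g indicE; case: (_ \in _); rewrite ?mulr1 ?mulr0 ?mul1r ?mul0r ?expR0 ?mulr1 ?mulr0 ?addr0//.
        by rewrite mulrC lerDr.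
    rewrite ge0_integralD_real//.
    - rewrite ge0_integralZl_real ?expR_ge0// ?I0 ?mule0 ?adde0 ?integral_gamma_pdf//.
      by move=> u _; rewrite mulr_ge0.
    - exact: mgam.
    - have h := measurable_funM (measurable_cst (expR M)) mIg; exact: h.
    - by move=> u _; rewrite mulr_ge0 ?expR_ge0// mulr_ge0.
  have E : (\int[mu]_(x in Rpos) (g x)%:E = M%:E * mu (A `&` Rpos))%E.
    by rewrite ge0_integralZl_real ?(ltW M0)// integral_indic.
  rewrite E in le.
  rewrite -(leeD2rE (x := 1%E))//; apply: (le_trans le).
  by rewrite leeD2l.
have fin : mu (A `&` Rpos) \is a fin_num by apply: fin_num_measure; exact: measurableI.
have m0 : (0 <= mu (A `&` Rpos))%E by exact: measure_ge0.
move: bound m0; rewrite -(fineK fin).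
move: (fine _) => m bound; rewrite lee_fin => m0.
congr EFin; apply/eqP; rewrite eq_le m0 andbT leNgt; apply/negP => mp.
have S0 : 0 <= S.
  by have := bound 1 ltr01; rewrite mul1e lee_fin; apply: le_trans.
have M0 : 0 < (S + 1) / m by rewrite divr_gt0// ltr_wpDl.
by have := bound _ M0; rewrite -EFinM lee_fin divfK ?gt_eqF//; lra.
Qed.

Lemma exists_density : exists f, is_density mu f.
Proof.
have dom : borel_copy mu `<< leb.
  apply/null_content_dominatesP => A mA A0; exact: mu_dominated.
have [f [f0 ffin fi fE]] := radon_nikodym_sigma_finite dom.
exists (fun u => fine (f u)); split.
  have mf : measurable_fun setT f by exact: measurable_int fi.
  exact: (measurableT_comp (@fine_measurable R setT measurableT) mf).
split; first by move=> u; exact: fine_ge0.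
move=> A mA; rewrite mu_Rpos_setI//.
transitivity (\int[leb]_(u in A `&` Rpos) f u)%E; first by apply: fE; exact: measurableI.
by apply: eq_integral => u _; rewrite fineK.
Qed.

Variable f : R -> R.
Hypothesis df : is_density mu f.

Let mf : measurable_fun setT f. Proof. by case: df. Qed.
Let f0 u : 0 <= f u. Proof. by case: df => _ [h _]; exact: h. Qed.

Let h := reld a l f.
Let h0 u : 0 <= h u.
Proof. by rewrite divr_ge0// gamma_pdf_ge0. Qed.

Let gp u : Rpos u -> 0 < gam u.
Proof. by rewrite RposE => u0; exact: gamma_pdf_gt0. Qed.

Let gh u : Rpos u -> gam u * h u = f u.
Proof. by move=> /gp g0; rewrite /h /reld mulrC divfK// gt_eqF. Qed.

(* Truncation of [h]; it keeps [ln] bounded, also where [h] vanishes. *)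
Let clip (n : nat) u : R := Num.max (expR (- n%:R)) (Num.min (h u) (expR n%:R)).

Let clip_le n u : clip n u <= expR n%:R.
Proof.
by rewrite /clip ge_max ge_min lexx orbT andbT ler_expR ge0_cp// oppr_le0.
Qed.

Let clip_ge n u : expR (- n%:R) <= clip n u.
Proof. by rewrite /clip le_max lexx. Qed.

Let clip_gt0 n u : 0 < clip n u.
Proof. exact: lt_le_trans (expR_gt0 _) (clip_ge n u). Qed.

Let ln_clip n u : - n%:R <= ln (clip n u) <= n%:R.
Proof.
have c0 := clip_gt0 n u.
apply/andP; split.
  by rewrite -[leLHS]expRK ler_ln ?posrE ?expR_gt0// clip_ge.
by rewrite -[leRHS]expRK ler_ln ?posrE ?expR_gt0// clip_le.
Qed.

(** Young's lower bound h g - exp(g) + 1 for phi(h), at the truncated slope g = ln(clip); the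
    optimal slope would be ln h. *)
Let psi n u : R := h u * ln (clip n u) - clip n u + 1.

(** phi(clip) is nonnegative, and replacing clip by h in front of the logarithm can only increase
    it: clip exceeds h at the lower truncation only, where ln(clip) <= 0, and falls below h at the
    upper one only, where ln(clip) >= 0. Fatou's lemma requires this sign. *)
Let psi_ge0 n u : 0 <= psi n u.
Proof.
have c0 := clip_gt0 n u; have /andP[l1 l2] := ln_clip n u.
have key : 0 <= phi (clip n u) by rewrite phi_ge0// ltW.
suff k : clip n u * ln (clip n u) <= h u * ln (clip n u).
  by move: key; rewrite /phi /psi; lra.
have e1 : expR (- n%:R) <= 1 :> R by rewrite expR_le1 oppr_le0.
have e2 : 1 <= expR n%:R :> R by rewrite -expR0 ler_expR.
have [hc|hc] := lerP (h u) (clip n u).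
  have [->|ne] := eqVneq (h u) (clip n u); first exact: lexx.
  have hlt : h u < clip n u by rewrite lt_neqAle ne.
  suff : ln (clip n u) <= 0 by move=> k; exact: ler_wnM2r.
  apply: ln_le0; move: hlt; rewrite /clip lt_max lt_min ltxx/= orbF => hlt.
  rewrite ge_max e1/= ge_min; apply/orP; left; apply: le_trans e1; exact: ltW.
suff : 0 <= ln (clip n u) by move=> k; apply: ler_wpM2r => //; exact: ltW.
apply: ln_ge0; move: hc; rewrite /clip gt_max => /andP[hc1].
rewrite gt_min ltxx/= => hc2.
by rewrite le_max le_min e2 andbT (le_trans e2 (ltW hc2)) orbT.
Qed.

Let mclip n : measurable_fun Rpos (clip n).
Proof.
apply: measurable_maxr => //; apply: measurable_minr => //.
exact: (measurable_reld a12 l0 df).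
Qed.

Let mln n : measurable_fun Rpos (fun u => ln (clip n u)).
Proof. exact: (measurableT_comp (@measurable_ln R) (mclip n)). Qed.

Let mpsi n : measurable_fun Rpos (fun u => gam u * psi n u).
Proof.
have mh : measurable_fun Rpos h by exact: (measurable_reld a12 l0 df).
have m1 := measurable_funM mh (mln n).
have m2 := measurable_funD (measurable_funB m1 (mclip n)) (measurable_cst (1 : R)).
have k := measurable_funM (@mgam Rpos) m2; exact: k.
Qed.

(** [variational] asks for a bounded nonnegative function, so ln(clip), which lies in [-n, n], is
    shifted by N = n; the factor exp(-N) in that bound undoes the shift. Positivity of n makes the
    upper bound 2 n positive. *)
Let psi_int n : (0 < n)%N -> (\int[leb]_(u in Rpos) (gam u * psi n u)%:E <= S%:E)%E.
Proof.
move=> n0; pose N : R := n%:R; have N0 : 0 <= N by exact: ler0n.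
have Np : 0 < N + N by rewrite -natrD ltr0n addn_gt0 n0.
pose g u : R := if u \in Rpos then ln (clip n u) + N else 0.
have mg : measurable_fun setT g.
  have m1 := measurable_funD (mln n) (measurable_cst N).
  by have m2 := (measurable_restrictT _ mR).1 m1; exact: m2.
have gM u : 0 <= g u <= N + N.
  rewrite /g; case: ifPn => _; last by rewrite lexx ltW.
  by have /andP[l1 l2] := ln_clip n u; apply/andP; split; rewrite /N; lra.
have gR u : Rpos u -> g u = ln (clip n u) + N by move=> Ru; rewrite /g mem_set.
have := variational a12 l0 mupos hS mg gM N0 Np.
have fg0 u : Rpos u -> 0 <= gam u by move=> /gp/ltW.
have g00 u : 0 <= g u by case/andP: (gM u).
have -> : (\int[leb]_(u in Rpos) (gam u * expR (g u))%:E =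
    (expR N)%:E * \int[leb]_(u in Rpos) (gam u * clip n u)%:E)%E.
  rewrite -ge0_integralZl_real ?expR_ge0//.
  - apply: eq_integral => u /set_mem Ru; rewrite gR// expRD lnK ?posrE//.
    by congr EFin; ring.
  - have k := measurable_funM (@mgam Rpos) (mclip n); exact: k.
  - by move=> u Ru; rewrite mulr_ge0 ?fg0// ltW.
rewrite muleA -EFinM -expRD addNr expR0 mul1e.
rewrite (integral_density df mg g00).
set C := (\int[leb]_(u in Rpos) (gam u * clip n u)%:E)%E.
have C0 u : Rpos u -> 0 <= gam u * clip n u.
  by move=> Ru; rewrite mulr_ge0 ?fg0// ltW.
have mC : measurable_fun Rpos (fun u => gam u * clip n u).
  have k := measurable_funM (@mgam Rpos) (mclip n); exact: k.
have Cfin : C \is a fin_num.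
  rewrite ge0_fin_numE; last by apply: integral_ge0 => u Ru; rewrite lee_fin C0.
  apply: (@le_lt_trans _ _ (\int[leb]_(u in Rpos) (expR N * gam u)%:E)%E).
    apply: ge0_le_integral_real => //.
    - by apply: measurable_funM => //; exact: mgam.
    - by move=> u Ru; rewrite mulrC ler_wpM2r ?fg0.
  rewrite ge0_integralZl_real ?expR_ge0//.
  - by rewrite integral_gamma_pdf// mule1 ltry.
  - exact: mgam.
have mf' : measurable_fun Rpos f by exact: measurable_funTS.
have mg' : measurable_fun Rpos g by exact: measurable_funTS.
have p0 u : Rpos u -> 0 <= gam u * psi n u by move=> Ru; rewrite mulr_ge0 ?fg0.
have mNf : measurable_fun Rpos (fun u => N * f u) by exact: measurable_funM.
have E : (\int[leb]_(u in Rpos) (f u * g u)%:E + 1 =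
    \int[leb]_(u in Rpos) (gam u * psi n u)%:E + (N%:E + C))%E.
  have mfg : measurable_fun Rpos (fun u => f u * g u).
    by have k := measurable_funM mf' mg'; exact: k.
  have e1 : (\int[leb]_(u in Rpos) (f u * g u + gam u)%:E = \int[leb]_(u in Rpos) (f u * g u)%:E + 1)%E.
    rewrite ge0_integralD_real//.
    - by rewrite integral_gamma_pdf.
    - exact: mgam.
    - by move=> u _; rewrite mulr_ge0.
  have mNC : measurable_fun Rpos (fun u => N * f u + gam u * clip n u).
    by have k := measurable_funD mNf mC; exact: k.
  have e2 : (\int[leb]_(u in Rpos) (gam u * psi n u + (N * f u + gam u * clip n u))%:E =
      \int[leb]_(u in Rpos) (gam u * psi n u)%:E + (N%:E + C))%E.
    rewrite ge0_integralD_real//; last 2 first.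
    - exact: mpsi.
    - by move=> u Ru; rewrite addr_ge0 ?C0// mulr_ge0.
    rewrite ge0_integralD_real//; last by move=> u Ru; rewrite mulr_ge0.
    by rewrite ge0_integralZl_real// (integral_density1 df mupos) mule1.
  rewrite -e1 -e2; apply: eq_integral => u /set_mem Ru; congr EFin.
  by rewrite gR// /psi -(gh Ru); ring.
rewrite E -(fineK Cfin).
have I0 : (0 <= \int[leb]_(u in Rpos) (gam u * psi n u)%:E)%E.
  by apply: integral_ge0 => u Ru; rewrite lee_fin p0.
move: I0; case: (\int[leb]_(u in Rpos) (gam u * psi n u)%:E)%E => [x| |] //= _.
by rewrite -!EFinD !lee_fin => k; lra.
Qed.

(** If h u > 0 the truncation is eventually inactive. If h u = 0 the logarithmic term vanishes and
    the value is 1 - exp(-n), with limit phi(0) = 1. *)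
Let psi_cvg u : psi n u @[n --> \oo] --> phi (h u).
Proof.
have [hp|hn] := ltP 0 (h u); last first.
  have hz : h u = 0 by apply/eqP; rewrite eq_le hn h0.
  have e : (fun n => psi n u) = (fun n : nat => - expR (- n%:R) + 1).
    apply/funext => n; rewrite /psi /clip hz mul0r sub0r; congr (- _ + 1).
    by rewrite min_l ?expR_ge0// max_l ?expR_ge0.
  rewrite e /phi hz mul0r subrr add0r -[X in _ --> X]add0r -[X in _ --> X + _]oppr0.
  apply: cvgD; last exact: cvg_cst.
  apply: cvgN; exact: cvgn_expR.
apply: cvg_near_cst; near=> n.
have k1 : ln (h u) <= n%:R by near: n; exact: nbhs_infty_ger.
have k2 : - ln (h u) <= n%:R by near: n; exact: nbhs_infty_ger.
have e1 : h u <= expR n%:R by rewrite -[leLHS](lnK hp) ler_expR.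
have e2 : expR (- n%:R) <= h u by rewrite -[leRHS](lnK hp) ler_expR; lra.
by rewrite /psi /clip /phi min_l// max_r//; lra.
Unshelve. all: by end_near. Qed.

Lemma relent_le : (relent a l f <= S%:E)%E.
Proof.
(* The index is shifted because [psi_int] holds for positive truncation levels. *)
have cv u : ((gam u * psi n.+1 u)%:E @[n --> \oo] --> (gam u * phi (h u))%:E)%E.
  have k : (gam u * psi n u)%:E @[n --> \oo] --> (gam u * phi (h u))%:E.
    by apply: cvg_EFin; [near=> n|apply: cvgMr; exact: psi_cvg].
  by have := k; rewrite -(cvg_shiftS (fun n => (gam u * psi n u)%:E)).
have := @fatou _ _ R leb Rpos mR (fun n u => (gam u * psi n.+1 u)%:E).
have -> : (\int[leb]_(u in Rpos) limn_einf (fun n => (gam u * psi n.+1 u)%:E) = relent a l f)%E.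
  by apply: eq_integral => u _; have [e _] := cvg_limn_einf_sup (cv u); exact: e.
move=> fat; apply: (le_trans (fat _ _)).
- by move=> n; apply/measurable_EFinP; exact: mpsi.
- by move=> n u Ru; rewrite lee_fin mulr_ge0 ?(ltW (gp Ru)).
rewrite limn_einf_lim; apply: lime_le; first exact: is_cvg_einfs.
near=> n; apply: (@le_trans _ _ (\int[leb]_(u in Rpos) (gam u * psi n.+1 u)%:E)%E).
  by apply: ereal_inf_lbound; exists n => /=.
exact: psi_int.
Unshelve. all: by end_near. Qed.

End EntropyLowerBound.

Section SteinInformation.
Variable R : realType.
Variables (a l : R) (mu : probability R R).
Hypotheses (a12 : 1 / 2 <= a) (l0 : 0 < l) (mupos : mu Rpos = 1%E).
Local Notation dens := (dens a l mu).
Local Notation dens_u := (dens_u a l mu).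
Local Notation gam := (gamma_pdf a l).
Local Notation leb := (@lebesgue_measure R).
Implicit Types (t u : R).

Let a0 : 0 < a. Proof. by rewrite (lt_le_trans _ a12). Qed.

(** The density is defined by cases, so the derivative is taken from the formula [wgt v / v], which
    agrees with it near every u > 0. *)
Lemma is_derive_gamma_pdf u : 0 < u -> is_derive u 1 gam (((a - 1) / u - l) * gam u).
Proof.
move=> u0; have near_u : \forall v \near u, wgt a l v * v^-1 = gam v.
  near=> v; have v0 : 0 < v by near: v; exact: lt_nbhsr.
  by rewrite gamxE// wgtE// mulrC mulKf// gt_eqF.
apply: (near_eq_is_derive near_u).
have u1 : u != 0 by rewrite gt_eqF.
have hV := @is_deriveV R (@id R) u 1 1 u1 (is_derive_id _ _).
have h := is_deriveM (is_derive_wgt l a12 u0) hV.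
apply: (is_derive_eq h).
rewrite wgtE// gamxE// /GRing.scale/=; field.
exact: u1.
Unshelve. all: by end_near. Qed.

Lemma is_derive_path t u : 0 < t < 1 -> 0 < u ->
  is_derive u 1 (fun u => gam u * dens t u)
    (((a - 1) / u - l) * gam u * dens t u + gam u * dens_u t u).
Proof.
move=> t01 u0.
have h := is_deriveM (is_derive_gamma_pdf u0) (is_derive_dens_u mu a12 l0 t01 u0).
by apply: (is_derive_eq h); rewrite /GRing.scale/=; ring.
Qed.

(** The score of the gamma law is (a - 1) / u - l; subtracting it from the score of X_t leaves the
    logarithmic derivative of the relative density. *)
Lemma J_st_gamma_path t : 0 < t < 1 ->
  J_st_gamma a l (fun u => gam u * dens t u) = Jrel a l mu t.
Proof.
move=> t01; apply: eq_integral => u; rewrite in_Rpos => u0; congr EFin.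
have h := is_derive_path t01 u0.
have -> : derive1 (fun u => gam u * dens t u) u =
    ((a - 1) / u - l) * gam u * dens t u + gam u * dens_u t u.
  by rewrite derive1E; exact: derive_val.
rewrite /fisher.
have g0 : 0 < gam u by exact: gamma_pdf_gt0.
have d0 : 0 < dens t u by apply: dens_gt0 => //; exact: ltW.
move: (gam u) (dens t u) (dens_u t u) g0 d0 => g d d' g0 d0.
by field; rewrite !gt_eqF.
Qed.

End SteinInformation.

(** * The time integral as supremum of the entropies along the path *)

Section PathIntegral.
Variable R : realType.
Variables (a l : R) (mu : probability R R).
Hypotheses (a12 : 1 / 2 <= a) (l0 : 0 < l) (mupos : mu Rpos = 1%E).
Hypothesis EX : (\int[mu]_(x in Rpos) x%:E = (a / l)%:E)%E.
Local Notation leb := (@lebesgue_measure R).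
Local Notation Dent := (Dent a l mu).
Implicit Types (t : R) (n : nat).

Let a0 : 0 < a. Proof. by rewrite (lt_le_trans _ a12). Qed.

Let Jt t : \bar R := ((l * t)^-1%:E * Jrel a l mu t)%E.

Definition fisher_path_integral : \bar R := (\int[leb]_(t in @U01 R) Jt t)%E.

Let Jt0 t : @U01 R t -> (0 <= Jt t)%E.
Proof.
rewrite U01E => t01; have /andP[tp _] := t01.
by rewrite mule_ge0 ?Jrel_ge0// lee_fin invr_ge0 mulr_ge0 ?ltW.
Qed.

Let mJt : measurable_fun (@U01 R) Jt.
Proof.
apply: emeasurable_funM; last exact: measurable_Jrel.
apply/measurable_EFinP.
apply: (@eq_measurable_fun _ _ _ _ _ (fun t => (l * t) `^ (- 1))).
  move=> t /set_mem; rewrite U01E => /andP[t0 _].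
  by rewrite powR_inv1// mulr_ge0 ?ltW.
apply: (measurableT_comp (measurable_powR _)).
by apply: measurable_funM.
Qed.

(** Starting at 1/3 makes every interval [s n, 1 - s n] nondegenerate. *)
Let s n : R := n.+3%:R^-1.
Let A n : set R := `[s n, 1 - s n]%classic.

Let s0 n : 0 < s n. Proof. by rewrite invr_gt0. Qed.

Let s3 n : s n <= 3^-1.
Proof. by rewrite lef_pV2 ?posrE// ler_nat. Qed.

Let s12 n : s n < 1 - s n.
Proof. by have := s3 n; lra. Qed.

Let s_cvg : s n @[n --> \oo] --> (0 : R).
Proof.
have h := @cvg_inv2 R.
by have := h; rewrite -(cvg_shiftS (fun n => n.+2%:R^-1 : R)).
Qed.

Let A_nd n m : (n <= m)%N -> A n `<=` A m.
Proof.
move=> nm t; rewrite /A/= !in_itv/= => /andP[h1 h2].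
have k : s m <= s n by rewrite lef_pV2 ?posrE// ler_nat !ltnS.
by rewrite (le_trans k h1)/= (le_trans h2)// lerD2l lerN2.
Qed.

Let A_U01 n : A n `<=` @U01 R.
Proof.
move=> t; rewrite /A U01E/= in_itv/= => /andP[h1 h2].
rewrite (lt_le_trans (s0 n) h1)/= (le_lt_trans h2)//.
by rewrite ltrBlDr ltrDl.
Qed.

Let bigcupA : \bigcup_n A n = @U01 R.
Proof.
apply/seteqP; split => [t [n _]|t]; first exact: A_U01.
rewrite U01E => /andP[t0 t1].
have h1 : \forall n \near \oo, s n < t by apply: (cvgr_lt _ s_cvg).
have h2 : \forall n \near \oo, s n < 1 - t by apply: (cvgr_lt _ s_cvg); rewrite subr_gt0.
have [n _ hn] : \forall n \near \oo, s n < t /\ s n < 1 - t.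
  by near=> n; split; near: n.
exists n => //; have [k1 k2] := hn n (leqnn n).
by rewrite /A/= in_itv/= (ltW k1)/=; lra.
Unshelve. all: by end_near. Qed.

Let I n : \bar R := (\int[leb]_(t in A n) Jt t)%E.

Let I_cvg : (I n @[n --> \oo] --> fisher_path_integral)%E.
Proof.
rewrite /fisher_path_integral -bigcupA.
have mA n : measurable (A n) by exact: measurable_itv.
have k := @ge0_nondecreasing_set_cvg_integral _ (measurableTypeR R) R A Jt leb.
apply: k.
- by move=> n m nm; rewrite subsetEset; exact: A_nd.
- exact: mA.
- by move=> n; apply: (measurable_funS _ (@A_U01 n) mJt); exact: measurable_U01.
- by move=> n t /A_U01; exact: Jt0.
Qed.

Let s01 n : 0 < s n < 1.
Proof. by rewrite s0/=; have := s3 n; lra. Qed.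

Let s01' n : 0 < 1 - s n < 1.
Proof. by have /andP[h1 h2] := s01 n; rewrite subr_gt0 h2/= ltrBlDr ltrDl. Qed.

(** De Bruijn's identity between s n and 1 - s n, after dropping the nonnegative entropy at s n. *)
Lemma fisher_path_le (B : \bar R) : (forall t, 0 < t < 1 -> (Dent t <= B)%E) ->
  (fisher_path_integral <= B)%E.
Proof.
move=> hB; apply: (cvge_le _ I_cvg); near=> n.
have h := deBruijn a12 l0 mupos EX (s0 n) (s12 n) (_ : 1 - s n < 1).
apply: le_trans (hB _ (s01' n)); rewrite h; last by case/andP: (s01' n).
by rewrite leeDr// Dent_ge0.
Unshelve. all: by end_near. Qed.

Let Dent_s_bound : exists2 b : nat -> R, b n @[n --> \oo] --> (0 : R) &
  forall n, (Dent (s n) <= (b n)%:E)%E.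
Proof.
exists (fun n => - a * ln (1 - s n) + Num.sqrt (bcoef l (s n)) * (2 * (a / l))); last first.
  by move=> n; exact: Dent_le.
have c : {for 0, continuous (fun t : R => - a * ln (1 - t) + Num.sqrt (bcoef l t) * (2 * (a / l)))}.
  have c1 : {for 0, continuous (fun t : R => 1 - t)} by apply: cvgB; [exact: cvg_cst|exact: cvg_id].
  apply: cvgD.
    apply: cvgMr; apply: (@continuous_comp _ _ _ (fun t : R => 1 - t) (@ln R)) => //.
    by apply: continuous_ln; rewrite subr0.
  apply: cvgMl; apply: (@continuous_comp _ _ _ (bcoef l) (@Num.sqrt R)); last exact: sqrt_continuous.
  rewrite /bcoef; apply: cvgM; first by apply: cvgMr; exact: cvg_id.
  by apply: cvgV; [rewrite subr0 expr1n oner_neq0|rewrite expr2; apply: cvgM].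
have := cvg_comp _ _ s_cvg c.
by rewrite /= subr0 ln1 mulr0 /bcoef mulr0 mul0r sqrtr0 mul0r addr0.
Qed.

(** De Bruijn's identity between s n and t: the entropy at s n tends to 0, and enlarging the time
    interval only increases the integral. *)
Lemma Dent_le_fisher_path t : 0 < t < 1 -> (Dent t <= fisher_path_integral)%E.
Proof.
move=> t01; have /andP[tp t1] := t01.
have [b b0 hb] := Dent_s_bound.
have h : ((b n)%:E + fisher_path_integral @[n --> \oo] --> 0%:E + fisher_path_integral)%E.
  apply: cvgeD; [by rewrite fin_num_adde_defr|by apply: cvg_EFin => //; near=> n|exact: cvg_cst].
rewrite add0e in h; apply: (cvge_ge _ h); near=> n.
have st : s n < t by near: n; apply: (cvgr_lt _ s_cvg).
rewrite (deBruijn a12 l0 mupos EX (s0 n) st t1); apply: leeD => //.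
apply: ge0_subset_integral.
- exact: measurable_itv.
- exact: measurable_U01.
- exact: mJt.
- exact: Jt0.
- move=> x; rewrite U01E/= in_itv/= => /andP[h1 h2].
  by rewrite (lt_le_trans (s0 n) h1) (le_lt_trans h2 t1).
Unshelve. all: by end_near. Qed.

(** The entropy is defined through a chosen density, and the two bounds hold for whichever one was
    chosen. If there is none, the left side is infinite by definition; a finite right side would
    bound the entropies along the path and so produce a density. *)
Lemma rel_entropy_fisher_path : rel_entropy_gamma a l mu = fisher_path_integral.
Proof.
have [t0 t01] : exists t : R, 0 < t < 1 by exists (1 / 2); lra.
have I0 : (0 <= fisher_path_integral)%E by apply: integral_ge0 => t; exact: Jt0.
have lower f : is_density mu f -> (relent a l f <= fisher_path_integral)%E.
  move=> df; case E : fisher_path_integral I0 => [S| |]//= _; last by rewrite leey.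
  apply: (relent_le a12 l0 mupos _ df) => t t01'; rewrite -E.
  exact: Dent_le_fisher_path.
rewrite /rel_entropy_gamma; case: pselect => [H|H].
  have df := projT2 (cid H); rewrite (relentE a12 l0 mupos df).
  apply/eqP; rewrite eq_le lower//=.
  by apply: fisher_path_le => t t01'; exact: (Dent_le_relent a12 l0 mupos df).
case E : fisher_path_integral I0 => [S| |]//= _; exfalso; apply: H.
apply: (exists_density a12 l0 mupos (S := S)) => t t01'; rewrite -E.
exact: Dent_le_fisher_path.
Qed.

End PathIntegral.

Theorem theorem4p2 (R : realType) (alpha lambda : R) (mu : probability R R) :
  1 / 2 <= alpha -> 0 < lambda ->
  mu Rpos = 1%E ->
  (\int[mu]_(x in Rpos) (x `^ (alpha + 4))%:E < +oo)%E ->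
  (\int[mu]_(x in Rpos) x%:E = (alpha / lambda)%:E)%E ->
  exists f : R -> R -> R,
    (forall tau, 0 < tau < 1 ->
       is_density (smart_path_law mu alpha lambda tau) (f tau) /\
       (forall u, 0 < u -> 0 < f tau u) /\
       (forall u, 0 < u -> derivable (f tau) u 1)) /\
    rel_entropy_gamma alpha lambda mu =
      (\int[@lebesgue_measure R]_(tau in `]0%R, 1%R[%classic)
         (((lambda * tau)^-1)%:E * J_st_gamma alpha lambda (f tau)))%E.
Proof.
move=> a12 l0 mupos _ EX.
have a0 : 0 < alpha by rewrite (lt_le_trans _ a12).
exists (fun t u => gamma_pdf alpha lambda u * dens alpha lambda mu t u); split.
  move=> t t01; split; first exact: is_density_dens.
  split=> u u0; last by have [] := is_derive_path mu a12 l0 t01 u0.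
  by rewrite mulr_gt0 ?gamma_pdf_gt0// dens_gt0// ltW.
rewrite (rel_entropy_fisher_path a12 l0 mupos EX).
apply: eq_integral => t /set_mem; rewrite -/(@U01 R t) U01E => t01.
by rewrite J_st_gamma_path.
Qed.
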